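(* Suppose $B'(1)<0$. Then the first (smallest) eigenvalue $\ell_0$ of the operator $(S,D(S))$, which equals the decay parameter $\lambda_C$ of the quadratic Markov branching process, is given by $$\ell_0=\inf\left\{\frac{\int_0^1 s\,(g'(s))^2\,ds}{\int_0^1 g^2(s)w(s)\,ds}:\ g\not\equiv0,\ g\in C_c^\infty((0,1))\right\}.$$ Furthermore, $\ell_0=\lambda_C$ satisfies $$\frac{1}{4D^2}\le \ell_0\le\frac1{D^2},\qquad\text{where}\qquad D^2:=\sup_{s\in(0,1)}\left\{(-\log s)\int_0^s\frac{1}{B(r)}\,dr\right\}.$$
   Context: Let $(b_j)_{j\ge0}$ be a real sequence with $b_j\ge 0$ for $j\ne 1$, $-b_1=\sum_{j\neq1}b_j$, $b_0>0$ and $\sum_{j\ge2}b_j>0$; put $B(s)=\sum_{j\ge0}b_js^j$ and $m_b=\sum_{j\ge2}(j-1)b_j$, so $B'(1)=m_b-b_0$. The quadratic Markov branching process (QMBP) is the continuous-time Markov chain on $\mathbb{Z}_+=\{0,1,2,\dots\}$ with $q$-matrix $q_{ij}=i^2b_{j-i+1}$ if $j\ge i-1$ and $q_{ij}=0$ otherwise (for $m_b\le b_0$ its transition function $P_{ij}(t)$ is unique and is the Feller minimal one). Its communicating class is $C=\{1,2,\dots\}$, and its decay parameter is $\lambda_C=-\lim_{t\to\infty}\frac1t\log P_{ij}(t)$, $i,j\in C$ (the limit exists and does not depend on $i,j\in C$). Let $J=(0,1)$, $w(s)=1/B(s)$ and $My=-(s\,y'(s))'$. Functions are real-valued; $L^2(J,w)$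 is the weighted $L^2$ space with norm $\left(\int_0^1 f^2w\,ds\right)^{1/2}$. Define $D_{max}=\{g\in L^2(J,w): g,\ s g'\in AC_{loc}(J),\ w^{-1}Mg\in L^2(J,w)\}$, $S_{max}g=w^{-1}Mg$ for $g\in D_{max}$; $S_{min}'$ is the restriction of $S_{max}$ to those $g\in D_{max}$ having compact support in $J$; $S_{min}$ is the closure of $S_{min}'$, with domain $D_{min}$. Fix $0<c_1<c_2<1$ and $v_1\in C^\infty(J)$ with $v_1=1$ on $(0,c_1)$ and $v_1=0$ on $(c_2,1)$. The self-adjoint operator $(S,D(S))$ is $Sg=w^{-1}Mg$ on $D(S)=\{y+c\,v_1: y\in D_{min},\ c\in\mathbb{R}\}$. $C_c^\infty((0,1))$ is the space of real-valued smooth functions with compact support in $(0,1)$. *)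

(* Defs.v *)
From HB Require Import structures.
From mathcomp Require Export all_boot all_order all_algebra.
From mathcomp Require Export all_classical all_reals all_analysis.
Export Order.TTheory GRing.Theory Num.Theory.
Export numFieldNormedType.Exports.

Set Implicit Arguments.
Unset Strict Implicit.
Unset Printing Implicit Defensive.

Local Open Scope classical_set_scope.
Local Open Scope ring_scope.

Local Notation leb := (@lebesgue_measure _).

(* All series below except the one in [Bgen] have nonnegative terms, so they are
   taken in the extended reals. *)
Definition branching_rates (R : realType) (b : nat -> R) : Prop :=
  [/\ (forall j, j != 1%N -> 0 <= b j),
      (\sum_(0 <= j <oo | j != 1%N) (b j)%:E)%E = (- b 1%N)%:E,
      0 < b 0%N &
      (0 < \sum_(2 <= j <oo) (b j)%:E)%E].

Definition Bgen (R : realType) (b : nat -> R) (s : R) : R :=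
  limn (pseries b s).

Definition m_b (R : realType) (b : nat -> R) : \bar R :=
  (\sum_(2 <= j <oo) ((j.-1)%:R * b j)%:E)%E.

(* B'(1) is the left derivative at 1, possibly +oo.  It is the value at 1 of
   the differentiated series, \sum_j j b_j, which is m_b - b_0 because
   - b_1 = \sum_(j != 1) b_j. *)
Definition dB1 (R : realType) (b : nat -> R) : \bar R :=
  (m_b b - (b 0%N)%:E)%E.

Definition qmat (R : realType) (b : nat -> R) (i j : nat) : R :=
  if (i <= j.+1)%N then (i ^ 2)%:R * b (j.+1 - i)%N else 0.

(* Feller's construction of the minimal transition function: iterate, from 0,
   the integral form of the backward equation
     P_ij(t) = delta_ij e^(q_ii t)
       + \int_0^t e^(q_ii u) \sum_(k != i) q_ik P_kj(t - u) du.
   The iterates are nonnegative and nondecreasing in [n]. *)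
Fixpoint feller_iter (R : realType) (b : nat -> R) (n i j : nat) (t : R)
    : \bar R :=
  if n is n'.+1 then
    (((i == j)%:R * expR (qmat b i i * t))%:E +
     \int[leb]_(u in `[0%R, t])
       ((expR (qmat b i i * u))%:E *
        \sum_(0 <= k <oo | k != i)
          ((qmat b i k)%:E * feller_iter b n' k j (t - u)%R)))%E
  else 0%E.

Definition qmbp (R : realType) (b : nat -> R) (i j : nat) (t : R) : \bar R :=
  limn (fun n => feller_iter b n i j t).

(* [lam] is the decay parameter of the class {1, 2, ...}: the limit exists and
   has the same value for all states of the class. *)
Definition is_decay_parameter (R : realType) (b : nat -> R) (lam : R) : Prop :=
  forall i j : nat, (1 <= i)%N -> (1 <= j)%N ->
    (- ((t^-1)%:E * lne (qmbp b i j t)))%E @[t --> +oo%R] --> lam%:E.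

(* A function on J = (0,1) is represented by a function on the whole line, of
   which only the values on J matter. *)
Definition J (R : realType) : set R := `]0, 1[.

Definition weight (R : realType) (b : nat -> R) (s : R) : R := (Bgen b s)^-1.

Definition sqnorm (R : realType) (b : nat -> R) (f : R -> R) : \bar R :=
  (\int[leb]_(s in @J R) ((f s) ^+ 2 * weight b s)%:E)%E.

Definition L2 (R : realType) (b : nat -> R) : set (R -> R) :=
  [set f | measurable_fun (@J R) f /\ (sqnorm b f < +oo)%E].

Definition L2cvg (R : realType) (b : nat -> R) (f : nat -> R -> R) (g : R -> R)
    : Prop :=
  sqnorm b (fun s => f n s - g s) @[n --> \oo] --> 0%E.

Definition abs_continuous (R : realType) (a c : R) (f : R -> R) : Prop :=
  forall e : R, 0 < e -> exists2 d : R, 0 < d &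
    forall (n : nat) (x y : 'I_n -> R),
      (forall k, [/\ a <= x k, x k <= y k & y k <= c]) ->
      trivIset setT (fun k => [set` `]x k, y k[]) ->
      \sum_k (y k - x k) < d -> \sum_k `|f (y k) - f (x k)| < e.

Definition AC_loc (R : realType) (f : R -> R) : Prop :=
  forall a c : R, 0 < a -> a < c -> c < 1 -> abs_continuous a c f.

Definition qderiv (R : realType) (g : R -> R) (s : R) : R := s * derive1 g s.

(* [Sop b g] is w^-1 M g.  [derive1] is total, with a default value where there is no
   derivative; for g in [Dmax] both g and s g' are locally absolutely
   continuous, so (s g')' is a genuine derivative almost everywhere, and g' is
   one everywhere on J. *)
Definition Sop (R : realType) (b : nat -> R) (g : R -> R) (s : R) : R :=
  (weight b s)^-1 * - derive1 (qderiv g) s.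

Definition Dmax (R : realType) (b : nat -> R) : set (R -> R) :=
  [set g | [/\ L2 b g, AC_loc g, AC_loc (qderiv g) & L2 b (Sop b g)]].

Definition compact_support (R : realType) (g : R -> R) : Prop :=
  exists K : set R, [/\ compact K, K `<=` @J R &
    forall s, @J R s -> ~ K s -> g s = 0].

Definition Dmin' (R : realType) (b : nat -> R) : set (R -> R) :=
  [set g | Dmax b g /\ compact_support g].

(* Graph of the closure of [Sop b] restricted to [D]. *)
Definition closure_graph (R : realType) (b : nat -> R) (D : set (R -> R))
    (y f : R -> R) : Prop :=
  [/\ L2 b y, L2 b f &
    exists g : nat -> R -> R, [/\ (forall n, D (g n)),
      L2cvg b g y & L2cvg b (fun n => Sop b (g n)) f]].

(* S_max is closed, so an element of the domain of the closure, which is a class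
   modulo null sets, has a representative in [Dmax]; it is unique on J by
   continuity, and it is the one we keep. *)
Definition Dmin (R : realType) (b : nat -> R) : set (R -> R) :=
  [set y | Dmax b y /\ exists f, closure_graph b (@Dmin' R b) y f].

Definition smooth (R : realType) (g : R -> R) : Prop :=
  forall (n : nat) (s : R), @J R s -> derivable (derive1n n g) s 1.

Definition DS (R : realType) (b : nat -> R) (v1 : R -> R) : set (R -> R) :=
  [set g | exists (y : R -> R) (c : R), Dmin b y /\
    forall s, @J R s -> g s = y s + c * v1 s].

Definition eigenvalue_S (R : realType) (b : nat -> R) (v1 : R -> R) (l : R)
    : Prop :=
  exists g : R -> R, [/\ DS b v1 g,
    ~ {ae leb, forall s, @J R s -> g s = 0} &
    {ae leb, forall s, @J R s -> Sop b g s = l * g s}].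

Definition is_first_eigenvalue (R : realType) (b : nat -> R) (v1 : R -> R)
    (l : R) : Prop :=
  eigenvalue_S b v1 l /\ forall l' : R, eigenvalue_S b v1 l' -> l <= l'.

Definition test_function (R : realType) : set (R -> R) :=
  [set g | smooth g /\ compact_support g].

Definition rayleigh (R : realType) (b : nat -> R) (g : R -> R) : R :=
  (\int[leb]_(s in @J R) (s * (derive1 g s) ^+ 2)) /
  (\int[leb]_(s in @J R) ((g s) ^+ 2 * weight b s)).

Definition Dsq (R : realType) (b : nat -> R) : \bar R :=
  ereal_sup [set ((- ln s)%:E * \int[leb]_(r in `]0%R, s[) ((Bgen b r)^-1)%:E)%E
            | s in @J R].

(* Main.v *)
From HB Require Import structures.
Require Import Defs.
From mathcomp Require Import ring lra zify measurable_realfun.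

(** All the assertions are about one function. Let [phi l] be the solution of
    [(s phi')' = - l w phi] that is regular at 0 with value 1, a power series with
    unit radius of convergence because [w = 1 / B] is one; the hypothesis
    [B'(1) < 0] gives [(b 0 - m) (1 - s) <= B(s) <= b 0 (1 - s)]. The number [l0] is
    the largest [l] for which [phi l] is positive on (0, 1) ([principal_ex]). Then
    [phi = phi l0] vanishes at 1, linearly, and its flux [- s phi'] is bounded
    ([principal_bounds]).

    Bounds by [Dsq]. Comparing the flux with the integral [W] of the weight on one
    side and with [- ln s] on the other gives [l0 (- ln s) W(s) <= 1] ([eigen_le]).
    Conversely, if [4 l0 D^2 < 1] then the Riccati variable [flux / phi] cannot reach
    [1 / (2 (- ln s))], so that [phi^2 / (- ln s)] increases, which contradicts the
    linear vanishing at 1 ([hardy_lower]).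

    Decay parameter. The transition rates send [i |-> 1 - s^i] to
    [i |-> - i^2 s^(i-1) B(s)], which is [B(s)] times the image of [1 - s^i] under
    [f |-> (s f')']; integrating against [l0 w phi] turns the eigenfunction into a
    bounded positive vector [dvec] with [Q x = - l0 x] ([dvec_invariant]). It bounds
    the Feller iterates from above by a multiple of [e^(- l0 t)] ([feller_upper]).
    From below, [dvec] is truncated to a finitely supported vector [y] with
    [Q y >= - lam y] where [y] is positive, for any [lam > l0]
    ([finite_subinvariant]), and the iterates are compared with [e^(- lam t) y]
    after time 1, when irreducibility has made all transition probabilities positive
    ([qmbp_lower]).

    Spectrum. Both the Rayleigh quotient and the operator are bounded below by [l0]
    through Picone's identity: the logarithmic derivative of [phi] completes the
    square in the quadratic form ([rayleigh_identity], [picone]). The bound is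
    approached by the functions [chi n phi], where the cut-off [chi n] varies on the
    logarithmic scale ([rayleigh_inf]). The same cut-off shows that [phi - v1] lies
    in the minimal domain, so that [l0] is an eigenvalue ([eigenvalue_principal]).
    For another eigenvalue [l'] the form inequality is taken to the limit along the
    sequence that defines the closure, and Green's formula evaluates the limit as
    [l' <g, g>] ([eigenvalue_ge]). The functions of the maximal domain are
    only locally absolutely continuous together with their quasi-derivative, so
    Green's formula and Picone's identity rest on the fundamental theorem of calculus
    for absolutely continuous functions ([abs_continuous_FTC]). It is obtained from
    the Radon-Nikodym theorem for the Stieltjes measure of the total variation, and
    from Lebesgue's differentiation theorem. *)

Set Implicit Arguments.
Unset Strict Implicit.
Unset Printing Implicit Defensive.

Local Open Scope classical_set_scope.
Local Open Scope ring_scope.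

(** * Absolutely continuous functions and their derivatives *)

Section ac_total_variation.
Context {R : realType}.
Implicit Types (a c x y : R) (f : R -> R) (L : seq (R * R)).

Definition disjoint_pair (p q : R * R) : bool := (p.2 <= q.1) || (q.2 <= p.1).

(** The consecutive pairs of the subdivision starting at [x] through the points of
    [s], which is how [variation] enumerates its increments. *)
Definition chain_of x (s : seq R) : seq (R * R) := zip (x :: s) s.

Lemma abs_continuous_seq a c f (e : R) : abs_continuous a c f -> 0 < e ->
  exists2 d : R, 0 < d & forall L,
    (forall p, p \in L -> [/\ a <= p.1, p.1 <= p.2 & p.2 <= c]) ->
    pairwise disjoint_pair L -> \sum_(p <- L) (p.2 - p.1) < d ->
    \sum_(p <- L) `|f p.2 - f p.1| < e.
Proof.
move=> acf e0; have [d d0 H] := acf e e0; exists d => // L Lac Ldis Ld.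
have := H (size L) (fun k => (nth (0, 0) L k).1) (fun k => (nth (0, 0) L k).2).
rewrite (big_nth (0, 0)) big_mkord in Ld.
rewrite (big_nth (0, 0)) big_mkord; apply => //.
  by move=> k; apply: Lac; apply: mem_nth.
have {}Ldis : forall i j : 'I_(size L), (i < j)%N ->
    disjoint_pair (nth (0, 0) L i) (nth (0, 0) L j).
  by move=> i j ij; move/(pairwiseP (0, 0)) : Ldis; apply; rewrite ?inE.
apply/trivIsetP => i j _ _.
wlog ij : i j / (i < j)%N.
  move=> wl; rewrite neq_ltn => /orP[ij|ij].
    by apply: wl => //; rewrite neq_ltn ij.
  by rewrite setIC; apply: wl => //; rewrite neq_ltn ij.
move=> _; apply/seteqP; split => // z /= [].
rewrite !in_itv/= => /andP[iz zi] /andP[jz zj].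
have /orP[h|h] := Ldis _ _ ij.
  by have := lt_trans (lt_le_trans zi h) jz; rewrite ltxx.
by have := lt_trans (lt_le_trans zj h) iz; rewrite ltxx.
Qed.

Lemma chain_of_cons x y s : chain_of x (y :: s) = (x, y) :: chain_of y s.
Proof. by []. Qed.

Lemma chain_of_sum x s : \sum_(p <- chain_of x s) (p.2 - p.1) = last x s - x.
Proof.
elim: s x => [|y s ih] x; first by rewrite /chain_of/= big_nil subrr.
by rewrite chain_of_cons big_cons ih/= addrC addrA subrK.
Qed.

Lemma chain_of_mem x s : path <%R x s -> forall p, p \in chain_of x s ->
  [/\ x <= p.1, p.1 <= p.2 & p.2 <= last x s].
Proof.
elim: s x => [|y s ih] x //= /andP[xy ys] p.
rewrite inE => /predU1P[->/=|/(ih _ ys)[h1 h2 h3]].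
  split => //; first exact: ltW.
  move: ys; rewrite lt_path_sortedE => /andP[ys _].
  elim/last_ind: s ys {ih} => //= s z _; rewrite last_rcons all_rcons.
  by case/andP => /ltW.
by split => //; exact: le_trans (ltW xy) h1.
Qed.

Lemma chain_of_disjoint x s : path <%R x s ->
  pairwise disjoint_pair (chain_of x s).
Proof.
elim: s x => [|y s ih] x //= /andP[xy ys]; rewrite ih// andbT.
by apply/allP => p /(chain_of_mem ys)[h _ _]; rewrite /disjoint_pair/= h.
Qed.

Lemma chain_of_variation x b f s :
  variation x b f s = \sum_(p <- chain_of x s) `|f p.2 - f p.1|.
Proof.
elim: s x => [|y s ih] x.
  by rewrite /variation/= !big_nil.
rewrite chain_of_cons big_cons -ih /variation/= big_nat_recl//=.
Qed.

(** Each total variation in the sum is a supremum of variations along finite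
    partitions, and refining the intervals one after the other by such
    partitions keeps the total length. *)
Lemma abs_continuous_total_variation_seq a c f (e : R) :
  abs_continuous a c f -> 0 < e ->
  exists2 d : R, 0 < d & forall L,
    (forall p, p \in L -> [/\ a <= p.1, p.1 <= p.2 & p.2 <= c]) ->
    pairwise disjoint_pair L -> \sum_(p <- L) (p.2 - p.1) < d ->
    (\sum_(p <- L) total_variation p.1 p.2 f <= e%:E)%E.
Proof.
move=> acf e0; have [d d0 H] := abs_continuous_seq acf e0; exists d => // L.
suff : forall L1 L2,
    (forall p, p \in L1 ++ L2 -> [/\ a <= p.1, p.1 <= p.2 & p.2 <= c]) ->
    pairwise disjoint_pair (L1 ++ L2) ->
    \sum_(p <- L1 ++ L2) (p.2 - p.1) < d ->
    (\sum_(p <- L1) total_variation p.1 p.2 f +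
       (\sum_(p <- L2) `|f p.2 - f p.1|)%:E <= e%:E)%E.
  move=> /(_ L [::]); rewrite cats0 big_nil adde0; exact.
elim => [|[x y] L1 ih] L2 Lac Ldis Ld.
  by rewrite big_nil add0e lee_fin ltW// H.
have [ax xy yc] : [/\ a <= x, x <= y & y <= c].
  by apply: (Lac (x, y)); rewrite mem_head.
have part s : itv_partition x y s ->
    ((variation x y f s)%:E + (\sum_(p <- L1) total_variation p.1 p.2 f +
       (\sum_(p <- L2) `|f p.2 - f p.1|)%:E) <= e%:E)%E.
  move=> [xs /eqP ls].
  rewrite addeCA -EFinD chain_of_variation -big_cat/=.
  have perm : perm_eq (L1 ++ (chain_of x s ++ L2)) (chain_of x s ++ (L1 ++ L2)).
    by rewrite perm_catCA.
  have Pac : forall p, p \in chain_of x s ++ (L1 ++ L2) ->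
      [/\ a <= p.1, p.1 <= p.2 & p.2 <= c].
    move=> p; rewrite mem_cat => /orP[/(chain_of_mem xs)[h1 h2 h3]|pL].
      split => //; first exact: le_trans h1.
      by rewrite (le_trans h3)// ls.
    by apply: Lac; rewrite inE pL orbT.
  have Psum : \sum_(p <- chain_of x s ++ (L1 ++ L2)) (p.2 - p.1) < d.
    rewrite big_cat/= chain_of_sum ls.
    by move: Ld; rewrite big_cons.
  apply: ih.
  - by move=> p; rewrite (perm_mem perm); apply: Pac.
  - move: Ldis => /=; rewrite all_cat !pairwise_cat allrel_catr.
    move=> /andP[/andP[xyL1 xyL2] /and3P[-> -> ->]].
    rewrite chain_of_disjoint// !andbT/=; apply/andP; split.
      apply/allrelP => p q pL /(chain_of_mem xs)[h1 h2 h3].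
      have /= := allP xyL1 _ pL; rewrite /disjoint_pair/= => /orP[h|h].
        by rewrite (le_trans h3) ?orbT// ls.
      by rewrite (le_trans h h1).
    apply/allrelP => p q /(chain_of_mem xs)[h1 h2 h3] qL.
    have /= := allP xyL2 _ qL; rewrite /disjoint_pair/= => /orP[h|h].
      by rewrite (le_trans h3)//= ls.
    by rewrite (le_trans h h1) orbT.
  - by rewrite (perm_big _ perm).
rewrite big_cons/= -addeA.
set S := (X in (_ + X)%E).
have [->|xy'] := eqVneq x y.
  rewrite total_variationxx add0e.
  apply: ih => [p pL||].
  - by apply: Lac; rewrite inE pL orbT.
  - by move: Ldis => /andP[].
  - by move: Ld; rewrite cat_cons big_cons/= => h; apply: le_lt_trans h; rewrite lerDr subr_ge0.
have xyp : itv_partition x y [:: y].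
  by apply: itv_partition1; rewrite lt_neqAle xy' xy.
have S0 : (0 <= S)%E.
  apply: adde_ge0; last by rewrite lee_fin sumr_ge0.
  rewrite big_seq; apply: sume_ge0 => p pL1; apply: total_variation_ge0.
  by have [] := Lac p; rewrite // inE mem_cat pL1 orbT.
have Sfin : S \is a fin_num.
  rewrite ge0_fin_numE//; apply: le_lt_trans (ltry e).
  apply: le_trans (part _ xyp); rewrite leeDr// lee_fin.
  by rewrite chain_of_variation sumr_ge0.
rewrite -leeBrDr//; apply: ge_ereal_sup => _ [_ [s xys <-] <-].
rewrite leeBrDr//; exact: part.
Qed.

End ac_total_variation.

Section ac_nondecreasing.
Context {R : realType}.
Implicit Types (a c x y : R) (f : R -> R).

Lemma uniq_pairwise (T : eqType) (r : rel T) (s : seq T) : uniq s ->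
  {in s &, forall u v : T, u != v -> r u v} -> pairwise r s.
Proof.
elim: s => //= x s ih /andP[xs us] h; apply/andP; split.
  apply/allP => y ys; apply: h; rewrite ?mem_head ?inE ?ys ?orbT//.
  by apply: contraNneq xs => ->.
by apply: ih => // y z ys zs; apply: h; rewrite inE ?ys ?zs orbT.
Qed.

Lemma abs_continuousN a c f : abs_continuous a c f ->
  abs_continuous a c (fun x => - f x).
Proof.
move=> acf e e0; have [d d0 H] := acf e e0; exists d => // n x y h1 h2 h3.
apply: le_lt_trans (H n x y h1 h2 h3).
by apply: ler_sum => i _; rewrite -opprD normrN.
Qed.

Lemma abs_continuousD a c f g : abs_continuous a c f -> abs_continuous a c g ->
  abs_continuous a c (fun x => f x + g x).
Proof.
move=> acf acg e e0; have e20 : 0 < e / 2 by rewrite divr_gt0.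
have [d d0 H] := acf _ e20; have [d' d'0 H'] := acg _ e20.
exists (Num.min d d') => [|n x y h1 h2]; first by rewrite lt_min d0.
rewrite lt_min => /andP[h3 h4].
rewrite [e]splitr; apply: le_lt_trans (ltrD (H n x y h1 h2 h3) (H' n x y h1 h2 h4)).
rewrite -big_split/=; apply: ler_sum => i _.
by rewrite opprD addrACA; exact: ler_normD.
Qed.

Lemma abs_continuous_uniform a c f (e : R) : abs_continuous a c f -> 0 < e ->
  exists2 d : R, 0 < d & forall x y, a <= x -> x <= y -> y <= c ->
    y - x < d -> `|f y - f x| < e.
Proof.
move=> acf e0; have [d d0 H] := acf e e0; exists d => // x y ax xy yc yxd.
have := H 1%N (fun=> x) (fun=> y).
rewrite !big_ord1; apply => //.
by apply/trivIsetP => i j _ _; rewrite !ord1 eqxx.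
Qed.

Lemma abs_continuous_bounded_variation a c f : a <= c ->
  abs_continuous a c f -> bounded_variation a c f.
Proof.
move=> ac acf; apply/bounded_variationP => //.
have [d d0 H] := abs_continuous_total_variation_seq acf (@ltr01 R).
have H' x y : a <= x -> x <= y -> y <= c -> y - x < d ->
    total_variation x y f \is a fin_num.
  move=> ax xy yc xyd; rewrite ge0_fin_numE ?total_variation_ge0//.
  apply: (@le_lt_trans _ _ 1%:E); last exact: ltry.
  have := H [:: (x, y)]; rewrite !big_seq1/=; apply => //.
  by move=> p; rewrite inE => /eqP ->.
pose N := (Num.bound ((c - a) / d)).
have N0 : (0 < N)%N.
  rewrite -(ltr_nat R); apply: le_lt_trans (archi_boundP _).
    by rewrite divr_ge0 ?subr_ge0// ltW.
  by rewrite divr_ge0 ?subr_ge0// ltW.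
have N0' : 0 < (N%:R : R) by rewrite ltr0n.
pose h := (c - a) / N%:R.
have h0 : 0 <= h by rewrite divr_ge0// ?subr_ge0.
have hd : h < d.
  rewrite ltr_pdivrMr// mulrC -ltr_pdivrMr//.
  by rewrite archi_boundP// divr_ge0 ?subr_ge0// ltW.
have ch : c = a + h *+ N by rewrite -mulr_natr divfK ?lt0r_neq0// addrC subrK.
suff : forall k, (k <= N)%N -> total_variation a (a + h *+ k) f \is a fin_num.
  by move=> /(_ N (leqnn _)); rewrite -ch.
elim => [|k ih] kN; first by rewrite mulr0n addr0 total_variationxx.
have akc : a + h *+ k.+1 <= c by rewrite ch lerD2l -!(mulr_natr h) ler_wpM2l ?ler_nat.
rewrite (@total_variationD _ _ _ (a + h *+ k)).
- rewrite fin_numD ih ?(ltnW kN)//=; apply: H' => //.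
  + by rewrite lerDl mulrn_wge0.
  + by rewrite lerD2l mulrS lerDr.
  + by rewrite mulrS addrCA addrK.
- by rewrite lerDl mulrn_wge0.
- by rewrite lerD2l mulrS lerDr.
Qed.

(** The increments of the total variation over disjoint intervals are the total
    variations on them, which the previous bound controls. *)
Lemma abs_continuous_total_variation a c f : a <= c -> abs_continuous a c f ->
  abs_continuous a c (fun x => fine (total_variation a x f)).
Proof.
move=> ac acf e e0.
have bv := abs_continuous_bounded_variation ac acf.
have fin x : a <= x -> x <= c -> total_variation a x f \is a fin_num.
  move=> ax xc; apply/bounded_variationP => //.
  exact: bounded_variationl xc bv.
have [d d0 H] := abs_continuous_total_variation_seq acf (divr_gt0 e0 (ltr0Sn R 1)).
exists d => // n x y hxy dis hd.
pose L := [seq (x k, y k) | k <- [seq k <- enum 'I_n | x k < y k]].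
have toL (F : R * R -> R) : (forall k, x k = y k -> F (x k, y k) = 0) ->
    \sum_(p <- L) F p = \sum_k F (x k, y k).
  move=> F0; rewrite big_map big_filter big_enum_cond/= big_mkcond/=.
  apply: eq_bigr => k _; case: ifPn => //; rewrite -leNgt => yx.
  by rewrite F0//; apply/eqP; rewrite eq_le yx; have [_ ->] := hxy k.
have toLe : \sum_k `|fine (total_variation a (y k) f) -
      fine (total_variation a (x k) f)| =
    \sum_(p <- L) fine (total_variation p.1 p.2 f).
  rewrite (toL (fun p => fine (total_variation p.1 p.2 f)))/=; last first.
    by move=> k ->; rewrite total_variationxx.
  apply: eq_bigr => k _; have [ax xy yc] := hxy k.
  rewrite (total_variationD f ax xy) fineD ?fin ?(le_trans xy)//; last first.
    have := fin _ (le_trans ax xy) yc.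
    by rewrite (total_variationD f ax xy) fin_numD => /andP[].
  rewrite addrC addKr ger0_norm// fine_ge0// total_variation_ge0//.
have Lac : forall p, p \in L -> [/\ a <= p.1, p.1 <= p.2 & p.2 <= c].
  by move=> p /mapP[k _ ->]; exact: hxy.
rewrite toLe -lte_fin; apply: (@le_lt_trans _ _ (e / 2)%:E); last first.
  by rewrite lte_fin ltr_pdivrMr// ltr_pMr// ltr1n.
apply: le_trans (H L Lac _ _).
- rewrite -sumEFin big_seq [X in (_ <= X)%E]big_seq; apply: lee_sum => p pL.
  have [ax xy yc] := Lac p pL; rewrite fineK//.
  have := fin _ (le_trans ax xy) yc.
  by rewrite (total_variationD f ax xy) fin_numD => /andP[].
- rewrite pairwise_map; apply: uniq_pairwise.
    by rewrite filter_uniq// enum_uniq.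
  move=> i j; rewrite !mem_filter => /andP[xyi _] /andP[xyj _] ij.
  rewrite /disjoint_pair/= leNgt [X in _ || X]leNgt -negb_and.
  apply/negP => /andP[h1 h2].
  have /trivIsetP/(_ i j I I ij) := dis.
  apply/eqP/set0P; pose l := Num.max (x i) (x j); pose u := Num.min (y i) (y j).
  have lu : l < u by rewrite gt_max !lt_min xyi h1 h2 xyj.
  exists ((l + u) / 2); have [lm mu] := midf_lt lu.
  have := lm; have := mu; rewrite /l/u gt_max lt_min => /andP[m1 m2] /andP[m3 m4].
  by split; rewrite /= in_itv/= ?m1 ?m2 ?m3 ?m4.
- rewrite (toL (fun p => p.2 - p.1))//= => k ->; exact: subrr.
Qed.

Lemma total_variationB_nondecreasing a c f : a <= c -> abs_continuous a c f ->
  {in `[a, c] &, {homo (fun x => fine (total_variation a x f) - f x) : x y / x <= y}}.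
Proof.
move=> ac acf x y; rewrite !in_itv/= => /andP[ax xc] /andP[ay yc] xy.
have bv := abs_continuous_bounded_variation ac acf.
have fin z : a <= z -> z <= c -> total_variation a z f \is a fin_num.
  move=> az zc; apply/bounded_variationP => //.
  exact: bounded_variationl zc bv.
have finxy : total_variation x y f \is a fin_num.
  by have := fin _ ay yc; rewrite (total_variationD f ax xy) fin_numD => /andP[].
rewrite (total_variationD f ax xy) fineD ?fin//.
have : f y - f x <= fine (total_variation x y f).
  rewrite -lee_fin fineK//; apply: le_trans (total_variation_ge f xy).
  by rewrite lee_fin ler_norm.
lra.
Qed.

Lemma total_variation_fine_nondecreasing a c f : a <= c -> abs_continuous a c f ->
  {in `[a, c] &, {homo (fun x => fine (total_variation a x f)) : x y / x <= y}}.
Proof.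
move=> ac acf x y; rewrite !in_itv/= => /andP[ax xc] /andP[ay yc] xy.
have bv := abs_continuous_bounded_variation ac acf.
apply: fine_le.
- exact/(bounded_variationP _ ax)/(bounded_variationl ax xc).
- exact/(bounded_variationP _ ay)/(bounded_variationl ay yc).
- by apply: (@total_variation_nondecreasing _ a c); rewrite ?in_itv//= ?ax ?ay.
Qed.

End ac_nondecreasing.

Section ac_density.
Context {R : realType}.
Implicit Types (a c x y : R) (f : R -> R).

Local Notation leb := (@lebesgue_measure R).

Definition clamp a c x := Num.max a (Num.min x c).

Lemma clamp_itv a c x : a <= c -> a <= clamp a c x <= c.
Proof.
move=> ac; rewrite /clamp le_max lexx/= ge_max ac/=.
by rewrite ge_min lexx orbT.
Qed.

Lemma clamp_id a c x : a <= x -> x <= c -> clamp a c x = x.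
Proof. by move=> ax xc; rewrite /clamp min_l// max_r. Qed.

Lemma clamp_le a c x y : x <= y -> clamp a c x <= clamp a c y.
Proof.
move=> xy; rewrite /clamp /Order.max /Order.min.
by do 4! case: ifP => /idP; rewrite -?leNgt => *; lra.
Qed.

Lemma clamp_dist a c x y : x <= y -> clamp a c y - clamp a c x <= y - x.
Proof.
move=> xy; rewrite /clamp /Order.max /Order.min.
by do 4! case: ifP => /idP; rewrite -?leNgt => *; lra.
Qed.

(** The function is extended by constants outside [a, c], so that it generates a
    Stieltjes measure on the whole line. *)
Lemma stieltjes_ex a c f : a < c ->
  {in `[a, c] &, {homo f : x y / x <= y}} -> abs_continuous a c f ->
  exists m : {measure set (measurableTypeR R) -> \bar R},
    forall x y, x <= y -> m `]x, y]%classic = (f (clamp a c y) - f (clamp a c x))%:E.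
Proof.
move=> ac fnd acf; pose g x := f (clamp a c x).
have gnd : {homo g : x y / x <= y}.
  move=> x y xy; apply: fnd; rewrite ?in_itv/= ?clamp_itv ?(ltW ac)//.
  exact: clamp_le.
have grc : right_continuous g.
  move=> x; apply/cvgrPdist_lt => e e0.
  have [d d0 H] := abs_continuous_uniform acf e0.
  near=> y.
  rewrite distrC; apply: H.
  - by have /andP[] := clamp_itv x (ltW ac).
  - by apply: clamp_le; near: y; exact: nbhs_right_ge.
  - by have /andP[] := clamp_itv y (ltW ac).
  - apply: le_lt_trans (clamp_dist _ _ _) _; first by near: y; exact: nbhs_right_ge.
    by rewrite ltrBlDl; near: y; apply: nbhs_right_lt; rewrite ltrDl.
pose G : cumulative R R := HB.pack g (isCumulative.Build R _ R g gnd grc).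
exists (lebesgue_stieltjes_measure G) => x y xy.
have h := @measurable_mu_extE _ _ _ (wlength G) _ (is_ocitv x y).
exact: (etrans h (wlength_itv_bnd G false false xy)).
Unshelve. all: by end_near. Qed.


(** Up to a null set, an open set is a countable union of disjoint intervals, on
    which absolute continuity controls the Stieltjes measure. *)
Lemma stieltjes_dominates a c f (m : {measure set (measurableTypeR R) -> \bar R}) :
  a < c -> abs_continuous a c f ->
  (forall x y, x <= y ->
    m `]x, y]%classic = (f (clamp a c y) - f (clamp a c x))%:E) ->
  forall A, measurable A -> leb A = 0 -> m (A `&` `]a, c]) = 0.
Proof.
move=> ac acf mE A mA A0.
have mitv x y : measurable (`]x, y]%classic : set R) by exact: measurable_itv.
suff small e : 0 < e -> (m (A `&` `]a, c]) <= (e + e)%:E)%E.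
  apply/eqP; rewrite eq_le measure_ge0 andbT; apply/lee_addgt0Pr => e e0.
  by rewrite add0e [e]splitr; apply: small; rewrite divr_gt0.
move=> e0.
have [d d0 H] := acf e e0.
have [d' d'0 H'] := abs_continuous_uniform acf e0.
have [U [oU AU Ud]] := lebesgue_regularity_outer mA (eq_ind _ (fun z => z < +oo)%E (ltry 0) _ (esym A0)) d0.
have {}Ud : (leb U < d%:E)%E.
  apply: le_lt_trans Ud.
  have mU : measurable (U : set R) by exact: measurable_realfun.open_measurable.
  rewrite -[X in (_ <= X)%E]adde0 -A0.
  apply: (@le_trans _ _ (leb ((U `\` A) `|` A))).
    apply: le_measure; rewrite ?inE//.
      by apply: measurableU => //; exact: measurableD.
    by move=> z Uz; have [Az|nAz] := pselect (A z); [right|left].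
  by apply: measureU2 => //; exact: measurableD.
pose t := Num.max a (c - d' / 2).
have [at_ tc] : a <= t /\ t < c.
  rewrite /t le_max lexx gt_max ac/=; split => //.
  by rewrite ltrBlDr ltrDl divr_gt0.
pose V := U `&` `]a, c[%classic.
have oV : open V by apply: openI => //; exact: interval_open.
have [I [oI tI VI]] := OpenSetDisjointItvs.open_disjoint_itv oV.
have mI k : measurable (I k : set R) by apply: measurable_realfun.open_measurable; have [] := oI k.
have mV : measurable V by exact: measurable_realfun.open_measurable.
have IV k : I k `<=` V by rewrite VI; exact: bigcup_sup.
have IL k : exists xy : R * R, [/\ a <= xy.1, xy.1 <= xy.2, xy.2 <= c,
    I k `<=` `]xy.1, xy.2]%classic & `]xy.1, xy.2[%classic `<=` I k].
  have [->|/set0P Ik0] := eqVneq (I k) set0.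
    exists (a, a); split => //=; first exact: ltW.
    by move=> z /=; rewrite in_itv/= => /andP[az /(lt_trans az)]; rewrite ltxx.
  have Iac z : I k z -> a < z < c by move=> /IV[_ /=]; rewrite in_itv.
  have lbI : has_lbound (I k) by exists a => z /Iac/andP[/ltW].
  have ubI : has_ubound (I k) by exists c => z /Iac/andP[_ /ltW].
  exists (inf (I k), sup (I k)) => /=; split.
  - by apply: lb_le_inf => // z /Iac/andP[/ltW].
  - by case: Ik0 => z Iz; apply: (@le_trans _ _ z); [exact: ge_inf|exact: ub_le_sup].
  - by apply: ge_sup => // z /Iac/andP[_ /ltW].
  - move=> z Iz; rewrite /= in_itv/=; apply/andP; split; last exact: ub_le_sup.
    have /nbhs_ballP[r /= r0 zr] : nbhs z (I k).
      by apply: open_nbhs_nbhs; split => //; have [] := oI k.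
    apply: (@le_lt_trans _ _ (z - r / 2)); last by rewrite ltrBlDr ltrDl divr_gt0.
    apply: ge_inf => //; apply: zr; rewrite /ball/= opprD addNKr opprK.
    by rewrite ger0_norm ?ltr_pdivrMr ?ltr_pMr ?ltr1n// divr_ge0// ltW.
  - move=> z /=; rewrite in_itv/= => /andP[iz zs].
    have [u Iu uz] := inf_adherent (eq_ind _ is_true iz _ (esym (subr_gt0 _ _))) (conj Ik0 lbI).
    have [v Iv zv] := sup_adherent (eq_ind _ is_true zs _ (esym (subr_gt0 _ _))) (conj Ik0 ubI).
    have [_ itvI] := oI k.
    apply: (itvI u v Iu Iv); move: uz zv; rewrite addrC subrK opprB addrC subrK => uz zv.
    by rewrite !ltW.
have [xy xyP] := choice IL.
have mVe : (m V <= e%:E)%E.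
  rewrite VI measure_bigcup//; last by move=> k _; exact: mI.
  apply: lime_le.
    by apply: is_cvg_nneseries => k *; exact: measure_ge0.
  apply: nearW => n.
  rewrite big_mkcond/= big_mkord.
  apply: (@le_trans _ _ (\sum_(k < n) `|f (xy k).2 - f (xy k).1|)%:E).
    rewrite -sumEFin; apply: lee_sum => k _; rewrite in_setT.
    have [ax xy' yc sub _] := xyP k.
    apply: (@le_trans _ _ (m `](xy k).1, (xy k).2]%classic)).
      by apply: le_measure; rewrite ?inE//; exact: mI.
    rewrite mE// !clamp_id ?(le_trans ax)// ?(le_trans xy')//.
    by rewrite lee_fin ler_norm.
  rewrite lee_fin; apply/ltW/H.
  - by move=> k; have [] := xyP k.
  - apply/trivIsetP => i j _ _ ij; apply/seteqP; split => // z [zi zj].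
    have [_ _ _ _ si] := xyP i; have [_ _ _ _ sj] := xyP j.
    have /trivIsetP/(_ i j Logic.I Logic.I ij) := tI.
    by move/seteqP => [+ _] => /(_ z); apply; split; [exact: si|exact: sj].
  - rewrite -lte_fin; apply: le_lt_trans Ud.
    apply: (@le_trans _ _ (leb V)); last first.
      apply: le_measure; rewrite ?inE//; first exact: measurable_realfun.open_measurable.
      exact: subIsetl.
    rewrite VI measure_bigcup//; last by move=> k _; exact: mI.
    apply: le_trans (nneseries_lim_ge n _) => //.
    rewrite [X in (_ <= X)%E]big_mkcond/= big_mkord -sumEFin; apply: lee_sum => k _; rewrite in_setT.
    have [ax xy' yc _ sub] := xyP k.
    apply: (@le_trans _ _ (leb `](xy k).1, (xy k).2[%classic)).
      rewrite lebesgue_measure_itv/= lte_fin; case: ltP => //.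
      by move=> yx; rewrite lee_fin subr_le0.
    by apply: le_measure; rewrite ?inE//; exact: mI.
apply: (@le_trans _ _ (m (V `|` `]t, c]%classic))).
  apply: le_measure; rewrite ?inE.
  - by apply: measurableI.
  - by apply: measurableU.
  - move=> z [Az /=]; rewrite in_itv/= => /andP[az zc].
    have [zt|tz] := leP z t.
      left; split; first exact: AU.
      by rewrite /= in_itv/= az (le_lt_trans zt).
    by right; rewrite /= in_itv/= tz.
apply: (le_trans (measureU2 m mV (mitv t c))).
rewrite EFinD; apply: leeD => //.
apply: (le_trans (_ : _ <= (f c - f t)%:E)%E).
  by have := mE t c (ltW tc); rewrite !clamp_id ?(ltW tc) ?(ltW ac)// => h;
    rewrite le_eqVlt; apply/orP; left; apply/eqP; exact: h.
rewrite lee_fin; apply: (le_trans (ler_norm _)); apply/ltW/H' => //; first exact: ltW.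
have : c - d' / 2 <= t by rewrite /t le_max lexx orbT.
lra.
Qed.


(** Radon-Nikodym applied to the Stieltjes measure gives the density. *)
Lemma nondecreasing_ac_density a c f : a < c ->
  {in `[a, c] &, {homo f : x y / x <= y}} -> abs_continuous a c f ->
  exists r : R -> R, leb.-integrable setT (EFin \o r) /\
    forall x, a <= x -> x <= c -> f x - f a = \int[leb]_(z in `]a, x]) r z.
Proof.
move=> ac fnd acf.
have [m mE] := stieltjes_ex ac fnd acf.
have mac : measurable (`]a, c]%classic : set (measurableTypeR R)).
  exact: (measurable_itv `]a, c]).
have mfin : (m `]a, c]%classic < +oo)%E.
  have := mE a c (ltW ac) => ->; exact: ltry.
pose nu : {finite_measure set (measurableTypeR R) -> \bar R} := mfrestr mac mfin.
have dom : nu `<< leb.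
  apply/null_content_dominatesP => A mA A0.
  have := stieltjes_dominates ac acf mE mA A0; exact.
have [r [r0 rfin ri rE]] := radon_nikodym_sigma_finite dom.
exists (fine \o r); split.
  apply: eq_integrable ri => // x _ /=; by rewrite fineK.
move=> x ax xc.
have : nu `]a, x]%classic = (f x - f a)%:E.
  rewrite /nu/= /mfrestr/= /mrestr.
  have -> : `]a, x] `&` `]a, c] = `]a, x]%classic.
    apply/seteqP; split => [z []//|z /=]; rewrite !in_itv/= => /andP[az zx].
    by rewrite az zx (le_trans zx).
  have := mE a x ax; rewrite !clamp_id ?(ltW ac)//.
rewrite rE; last exact: (measurable_itv `]a, x]).
rewrite /Rintegral => h.
have -> : (\int[leb]_(z in `]a, x]) (fine (r z))%:E = \int[leb]_(z in `]a, x]) r z)%E.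
  by apply: eq_integral => z _; rewrite fineK.
have := congr1 fine h; exact: esym.
Qed.

(** The total variation splits an absolutely continuous function into a difference
    of nondecreasing ones, which are absolutely continuous too. *)
Lemma ac_density a c f : a < c -> abs_continuous a c f ->
  exists r : R -> R, leb.-integrable setT (EFin \o r) /\
    forall x, a <= x -> x <= c -> f x - f a = \int[leb]_(z in `]a, x]) r z.
Proof.
move=> ac acf; have acT := abs_continuous_total_variation (ltW ac) acf.
have [r [ri rE]] := nondecreasing_ac_density ac
  (total_variation_fine_nondecreasing (ltW ac) acf) acT.
have [r' [r'i r'E]] := nondecreasing_ac_density ac
  (total_variationB_nondecreasing (ltW ac) acf)
  (abs_continuousD acT (abs_continuousN acf)).
exists (fun x => r x - r' x); split.
  by apply: eq_integrable (integrableB measurableT ri r'i).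
move=> x ax xc; rewrite RintegralB//=.
- rewrite -rE// -r'E//; lra.
- by apply: integrableS ri.
- by apply: integrableS r'i.
Qed.

(** The Lebesgue differentiation theorem identifies the density with the
    derivative. *)
Lemma abs_continuous_FTC a c f : a < c -> abs_continuous a c f ->
  exists r : R -> R, [/\ leb.-integrable setT (EFin \o r),
    (forall x, a <= x -> x <= c -> f x - f a = \int[leb]_(z in `]a, x]) r z) &
    {ae leb, forall x, x \in `]a, c[ -> is_derive x 1 f (r x)}].
Proof.
move=> ac acf; have [r [ri rE]] := ac_density ac acf.
exists r; split => //.
have locr : locally_integrable setT r.
  by apply: open_integrable_locally => //; exact: openT.
have riS y : leb.-integrable [set` Interval (BRight a) (BRight y)] (EFin \o r).
  by apply: integrableS ri => //; exact: (measurable_itv `]a, y]).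
have := FTC1 riS locr.
apply: filterS; first exact: (ae_filter_ringOfSetsType leb).
move=> x /= H xac.
have [ax xc] : a < x /\ x < c by move: xac; rewrite in_itv => /andP.
have [dx dE] := H ax.
pose F y := f a + \int[leb]_(t in `]a, y]) r t.
have dF : is_derive x 1 F (r x).
  have dI : is_derive x 1 (fun y => \int[leb]_(t in `]a, y]) r t) (r x).
    by apply: (DeriveDef dx); rewrite -derive1E.
  have := is_deriveD (is_derive_cst (f a) x 1) dI; rewrite add0r; exact.
apply: near_eq_is_derive dF.
near=> y; have : y \in `]a, c[ by near: y; exact: near_in_itvoo.
rewrite in_itv/= => /andP[ay yc].
by rewrite /F -rE ?ltW// addrC subrK.
Unshelve. all: by end_near. Qed.

End ac_density.

(** * Rules for derivatives *)

Section derivative_rules.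
Context {R : realType}.
Implicit Types (f g : R -> R) (x k a b : R).

Lemma der_cst k x : is_derive x 1 (fun=> k) 0.
Proof. exact: is_derive_cst. Qed.

Lemma der_id x : is_derive x 1 (fun y : R => y) 1.
Proof. exact: is_derive_id. Qed.

Lemma derD f g x a b : is_derive x 1 f a -> is_derive x 1 g b ->
  is_derive x 1 (fun y => f y + g y) (a + b).
Proof. by move=> hf hg; exact: is_deriveD. Qed.

Lemma derN f x a : is_derive x 1 f a -> is_derive x 1 (fun y => - f y) (- a).
Proof. by move=> hf; exact: is_deriveN. Qed.

Lemma derB f g x a b : is_derive x 1 f a -> is_derive x 1 g b ->
  is_derive x 1 (fun y => f y - g y) (a - b).
Proof. by move=> hf hg; exact: is_deriveB. Qed.

Lemma derM f g x a b : is_derive x 1 f a -> is_derive x 1 g b ->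
  is_derive x 1 (fun y => f y * g y) (a * g x + f x * b).
Proof.
move=> hf hg; have := is_deriveM hf hg; rewrite addrC [_ *: a]mulrC; exact.
Qed.

Lemma derZ k f x a : is_derive x 1 f a -> is_derive x 1 (fun y => k * f y) (k * a).
Proof.
by move=> hf; have := derM (der_cst k x) hf; rewrite mul0r add0r.
Qed.

Lemma derV f x a : is_derive x 1 f a -> f x != 0 ->
  is_derive x 1 (fun y => (f y)^-1) (- a / (f x) ^+ 2).
Proof.
move=> hf fx0; have := is_deriveV fx0 hf; move=> h; apply: is_derive_eq h _.
by rewrite [_ *: _]mulrC mulrN mulNr -exprVn.
Qed.

Lemma der_comp f g x a b : is_derive (g x) 1 f a -> is_derive x 1 g b ->
  is_derive x 1 (fun y => f (g y)) (a * b).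
Proof. by move=> hf hg; exact: is_derive1_comp. Qed.

Lemma der_ln f x a : is_derive x 1 f a -> 0 < f x ->
  is_derive x 1 (fun y => ln (f y)) (a / f x).
Proof.
by move=> hf fx0; rewrite mulrC; apply: der_comp => //; exact: is_derive1_ln.
Qed.

Lemma der_eq f x a b : is_derive x 1 f a -> a = b -> is_derive x 1 f b.
Proof. by move=> h <-. Qed.

Lemma der_continuous f x a : is_derive x 1 f a -> {for x, continuous f}.
Proof.
by move=> [d _]; apply/differentiable_continuous/derivable1_diffP.
Qed.

Lemma der_derive1 f x a : is_derive x 1 f a -> derive1 f x = a.
Proof. by move=> h; rewrite derive1E; exact: derive_val. Qed.

Lemma der_near f g x a : (\forall y \near x, f y = g y) -> is_derive x 1 f a ->
  is_derive x 1 g a.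
Proof. exact: near_eq_is_derive. Qed.

End derivative_rules.

(** * Power series with unit radius of convergence *)

Section power_series.
Context {R : realType}.
Implicit Types (a b c : nat -> R) (x r q : R).

Definition ps a x : R := limn (pseries a x).

(** Subgeometric growth at every rate: the power series converges on the open
    unit disk, and so do all its derivatives. *)
Definition rad1 a := forall r, 0 < r < 1 -> exists M : R, forall k, `|a k| * r ^+ k <= M.

Lemma natr_expr_bound q r : 0 < q -> q < r ->
  exists2 C : R, 0 < C & forall n, n.+1%:R * q ^+ n <= C * r ^+ n.
Proof.
move=> q0 qr; pose t := r / q - 1.
have t0 : 0 < t by rewrite subr_gt0 ltr_pdivlMr// mul1r.
have bern n : 1 + n%:R * t <= (1 + t) ^+ n.
  elim: n => [|n ih]; first by rewrite mul0r addr0.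
  rewrite exprS; apply: (@le_trans _ _ ((1 + t) * (1 + n%:R * t))); last first.
    by rewrite ler_pM2l// addr_gt0.
  have nt : 0 <= n%:R * t * t by rewrite !mulr_ge0 ?ler0n ?(ltW t0).
  rewrite -natr1 (_ : (1 + t) * (1 + n%:R * t) = 1 + (n%:R + 1) * t + n%:R * t * t); last ring.
  by rewrite lerDl.
exists (1 + t^-1); first by rewrite addr_gt0 ?invr_gt0.
move=> n; have -> : r = q * (1 + t) by rewrite /t; field; rewrite gt_eqF.
rewrite exprMn mulrCA [_ * (q ^+ n)]mulrC ler_pM2l ?exprn_gt0//.
apply: (@le_trans _ _ ((1 + t^-1) * (1 + n%:R * t))); last first.
  by rewrite ler_pM2l// addr_gt0 ?invr_gt0.
have -> : (1 + t^-1) * (1 + n%:R * t) = n.+1%:R + n%:R * t + t^-1.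
  by rewrite -natr1; field; rewrite gt_eqF.
by rewrite -addrA lerDl addr_ge0 ?invr_ge0 ?mulr_ge0 ?ler0n ?(ltW t0).
Qed.

Lemma bounded_rad1 a (M : R) : (forall k, `|a k| <= M) -> rad1 a.
Proof.
move=> aM r /andP[r0 r1]; exists M => k; apply: le_trans (aM k).
by rewrite ler_piMr// exprn_ile1 ?ltW.
Qed.

Lemma rad1_diffs a : rad1 a -> rad1 (pseries_diffs a).
Proof.
move=> ra r /andP[r0 r1].
have [q [q0 rq q1]] : exists q, [/\ 0 < q, r < q & q < 1].
  by exists ((r + 1) / 2); split; lra.
have [M HM] := ra q (introT andP (conj q0 q1)).
have rq1 : r / q < 1 by rewrite ltr_pdivrMr// mul1r.
have [C C0 HC] := natr_expr_bound (divr_gt0 r0 q0) rq1.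
exists (M / q * C) => k.
have {}HC : k.+1%:R * (r / q) ^+ k <= C by have := HC k; rewrite expr1n mulr1.
rewrite /pseries_diffs normrM ger0_norm//.
have -> : k.+1%:R * `|a k.+1| * r ^+ k =
    (`|a k.+1| * q ^+ k.+1) / q * (k.+1%:R * (r / q) ^+ k).
  by rewrite exprMn exprVn exprS; field; rewrite expf_neq0 ?gt_eqF.
apply: ler_pM => //.
- by rewrite ?(mulr_ge0,invr_ge0,exprn_ge0) ?normr_ge0 ?ltW.
- by rewrite mulr_ge0 ?exprn_ge0 ?divr_ge0 ?ler0n ?(ltW r0) ?(ltW q0).
- by rewrite ler_pM2r ?invr_gt0.
Qed.

Lemma rad1_geo a x : rad1 a -> `|x| < 1 -> exists M q : R,
  [/\ 0 <= M, 0 < q, q < 1 & forall k, `|a k * x ^+ k| <= M * q ^+ k].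
Proof.
move=> ra x1.
have [r [r0 xr r1]] : exists r, [/\ 0 < r, `|x| < r & r < 1].
  by exists ((`|x| + 1) / 2); have := normr_ge0 x; split; lra.
have [M HM] := ra r (introT andP (conj r0 r1)).
have M0 : 0 <= M by apply: le_trans (HM 0%N); rewrite mulr_ge0.
pose q := (`|x| / r + 1) / 2.
have xr1 : `|x| / r < 1 by rewrite ltr_pdivrMr// mul1r.
have xr0 : 0 <= `|x| / r by rewrite divr_ge0// ltW.
exists M, q; split => //; rewrite ?/q; [lra|lra|] => k.
rewrite normrM normrX.
have -> : `|a k| * `|x| ^+ k = (`|a k| * r ^+ k) * (`|x| / r) ^+ k.
  by rewrite exprMn exprVn; field; rewrite expf_neq0 ?gt_eqF.
apply: ler_pM; [by rewrite mulr_ge0 ?exprn_ge0 ?(ltW r0)|exact: exprn_ge0|exact: HM|].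
by apply: lerXn2r; rewrite ?nnegrE /q; lra.
Qed.

Lemma rad1_norm_cvg a x : rad1 a -> `|x| < 1 ->
  cvgn [series `|a k * x ^+ k|]_k.
Proof.
move=> ra x1; have [M [q [M0 q0 q1 H]]] := rad1_geo ra x1.
apply: (series_le_cvg _ _ H); first by [].
  by move=> k; rewrite mulr_ge0// exprn_ge0// ltW.
by have := @is_cvg_geometric_series R M q; rewrite ger0_norm ?ltW//; exact.
Qed.

Lemma rad1_cvg a x : rad1 a -> `|x| < 1 -> cvgn (pseries a x).
Proof. by move=> ra x1; apply: normed_cvg; exact: rad1_norm_cvg. Qed.

Lemma ps_cvg a x : rad1 a -> `|x| < 1 -> series (fun k => a k * x ^+ k) @ \oo --> ps a x.
Proof. by move=> ra x1; exact: rad1_cvg. Qed.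

Lemma is_derive_ps a x : rad1 a -> `|x| < 1 ->
  is_derive x 1 (ps a) (ps (pseries_diffs a) x).
Proof.
move=> ra x1; have K1 : `|(`|x| + 1) / 2| < 1.
  by rewrite ger0_norm; have := normr_ge0 x; lra.
apply: (@pseries_snd_diffs R a ((`|x| + 1) / 2)).
- exact: rad1_cvg.
- exact/rad1_cvg/K1/rad1_diffs.
- exact/rad1_cvg/K1/rad1_diffs/rad1_diffs.
- by rewrite [X in _ < X]ger0_norm; have := normr_ge0 x; lra.
Qed.

Lemma ps_continuous a x : rad1 a -> `|x| < 1 -> {for x, continuous (ps a)}.
Proof.
move=> ra x1; apply/differentiable_continuous/derivable1_diffP.
by have [] := is_derive_ps ra x1.
Qed.

Lemma ps0 a : ps a 0 = a 0%N.
Proof.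
apply/cvg_lim => //; apply: cvg_near_cst; exists 1%N => // n /= n0.
rewrite /pseries /series/= big_ltn// expr0 mulr1 big_nat_cond big1 ?addr0//.
by move=> i /andP[/andP[i0 _] _]; rewrite expr0n gtn_eqF// mulr0.
Qed.

Lemma ps_shift a x : rad1 a -> `|x| < 1 -> rad1 (fun k => a k.+1) ->
  ps a x = a 0%N + x * ps (fun k => a k.+1) x.
Proof.
move=> ra x1 ra'; apply/cvg_lim => //; rewrite -cvg_shiftS.
have h := ps_cvg ra' x1.
rewrite (_ : (fun n => pseries a x n.+1) =
    (fun n => a 0%N + x * series (fun k => a k.+1 * x ^+ k) n)).
  by apply: cvgD; [exact: cvg_cst|exact: cvgMl_tmp].
apply/funext => n; rewrite /pseries/series/= big_nat_recl//= expr0 mulr1.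
congr (_ + _); rewrite big_distrr/=; apply: eq_bigr => i _.
by rewrite exprS; ring.
Qed.


Definition conv a b k : R := \sum_(i < k.+1) a i * b (k - i)%N.

Lemma conv_geo a b x : rad1 a -> rad1 b -> `|x| < 1 -> exists M q : R,
  [/\ 0 <= M, 0 < q, q < 1 &
    forall (n : nat) (s t : nat -> bool) k,
    `|(\sum_(i < k.+1) (if s i then a i else 0) * (if t (k - i)%N then b (k - i)%N else 0))
      * x ^+ k| <= M * (k.+1%:R * q ^+ k)].
Proof.
move=> ra rb x1.
have [M [q [M0 q0 q1 HM]]] := rad1_geo ra x1.
have [N [r [N0 r0 r1 HN]]] := rad1_geo rb x1.
exists (M * N), (Num.max q r); split.
- by rewrite mulr_ge0.
- by rewrite lt_max q0.
- by rewrite gt_max q1.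
move=> _ s t k; rewrite mulr_suml; apply: le_trans (ler_norm_sum _ _ _) _.
rewrite mulrCA -[k.+1 in X in _ <= X]card_ord mulr_natl -sumr_const.
apply: ler_sum => i _.
have qm : q <= Num.max q r by rewrite le_max lexx.
have rm : r <= Num.max q r by rewrite le_max lexx orbT.
set m := Num.max q r in qm rm *.
have m0 : 0 <= m by apply: le_trans qm; exact: ltW.
have ik : (i <= k)%N by rewrite -ltnS.
have -> : x ^+ k = x ^+ i * x ^+ (k - i) by rewrite -exprD subnKC.
have -> : m ^+ k = m ^+ i * m ^+ (k - i) by rewrite -exprD subnKC.
have -> : forall u v : R, u * v * (x ^+ i * x ^+ (k - i)) =
  (u * x ^+ i) * (v * x ^+ (k - i)) by move=> u v; ring.
rewrite [X in _ <= X]mulrACA normrM; apply: ler_pM => //.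
- apply: (@le_trans _ _ (M * q ^+ i)).
    case: ifP => _; [exact: HM|].
    by rewrite mul0r normr0 mulr_ge0// exprn_ge0// ltW.
  by apply: ler_wpM2l => //; apply: lerXn2r; rewrite ?nnegrE// ltW.
- apply: (@le_trans _ _ (N * r ^+ (k - i))).
    case: ifP => _; [exact: HN|].
    by rewrite mul0r normr0 mulr_ge0// exprn_ge0// ltW.
  by apply: ler_wpM2l => //; apply: lerXn2r; rewrite ?nnegrE// ltW.
Qed.

Lemma conv_rad1 a b : rad1 a -> rad1 b -> rad1 (conv a b).
Proof.
move=> ra rb r /andP[r0 r1].
have x1 : `|r| < 1 by rewrite ger0_norm// ltW.
have [M [q [M0 q0 q1 H]]] := conv_geo ra rb x1.
have [C C0 HC] := natr_expr_bound q0 q1.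
exists (M * C) => k.
have := H 0%N xpredT xpredT k; rewrite normrM normrX (ger0_norm (ltW r0)) => h.
apply: le_trans h _; rewrite ler_wpM2l//.
by have := HC k; rewrite expr1n mulr1.
Qed.

(** The product of two partial sums is a polynomial whose low coefficients are
    those of the Cauchy product; the others form a geometrically small tail. *)
Lemma ps_conv a b x : rad1 a -> rad1 b -> `|x| < 1 ->
  ps (conv a b) x = ps a x * ps b x.
Proof.
move=> ra rb x1.
have [M [q [M0 q0 q1 H]]] := conv_geo ra rb x1.
pose r := (q + 1) / 2.
have [qr r1 r0] : [/\ q < r, r < 1 & 0 < r] by rewrite /r; split; lra.
have [C C0 HC] := natr_expr_bound q0 qr.
pose r' := (r + 1) / 2.
have [rr' r'1 r'0] : [/\ r < r', r' < 1 & 0 < r'] by rewrite /r'; split; lra.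
have [C' C'0 HC'] := natr_expr_bound r0 rr'.
have cab := ps_cvg (conv_rad1 ra rb) x1.
have hab := cvgM (ps_cvg ra x1) (ps_cvg rb x1).
suff h : (series (fun k => a k * x ^+ k) n * series (fun k => b k * x ^+ k) n
    - series (fun k => conv a b k * x ^+ k) n) @[n --> \oo] --> 0.
  apply: (cvg_unique _ cab) => //.
  have := cvgB (hab _) h; rewrite subr0 => H'.
  set sc := series (fun k => conv a b k * x ^+ k) in H' *.
  set sa := series (fun k => a k * x ^+ k) in H' *.
  set sb := series (fun k => b k * x ^+ k) in H' *.
  have -> : sc = (fun n => sa n * sb n - (sa n * sb n - sc n)).
    by apply/funext => n; rewrite opprB addrC subrK.
  exact: H'.
have bound n : `|series (fun k => a k * x ^+ k) n * series (fun k => b k * x ^+ k) n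
    - series (fun k => conv a b k * x ^+ k) n| <= M * (C * C') * r' ^+ n.
  pose A : {poly R} := \poly_(i < n) a i; pose B : {poly R} := \poly_(i < n) b i.
  have hA : series (fun k => a k * x ^+ k) n = A.[x].
    by rewrite horner_poly /series/= big_mkord.
  have hB : series (fun k => b k * x ^+ k) n = B.[x].
    by rewrite horner_poly /series/= big_mkord.
  have sAB : (size (A * B)%R <= n + n)%N.
    apply: leq_trans (size_polyMleq _ _) _; apply: leq_trans (leq_pred _) _.
    by apply: leq_add; exact: size_poly.
  rewrite hA hB -hornerM (horner_coef_wide _ sAB) /series/=.
  rewrite -(big_mkord xpredT (fun i => (A * B)%R`_i * x ^+ i)).
  rewrite (@big_cat_nat _ _ _ n)//=; last exact: leq_addr.
  rewrite [X in X + _ - _](_ : _ = \sum_(0 <= k < n) conv a b k * x ^+ k); last first.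
    apply: eq_big_nat => k /andP[_ kn]; congr (_ * _); rewrite coefM.
    apply: eq_bigr => i _; rewrite !coef_poly.
    rewrite (leq_ltn_trans _ kn) 1?(leq_ltn_trans _ kn)// ?leq_subr//.
    by rewrite -ltnS.
  rewrite addrC addKr; apply: le_trans (ler_norm_sum _ _ _) _.
  apply: (@le_trans _ _ (\sum_(n <= k < n + n) M * C * r ^+ n)).
    rewrite !big_nat; apply: ler_sum => k /andP[nk _].
    rewrite coefM; under eq_bigr do rewrite !coef_poly.
    apply: le_trans (H n (fun i => (i < n)%N) (fun i => (i < n)%N) k) _.
    rewrite -mulrA; apply: ler_wpM2l => //; apply: le_trans (HC k) _.
    apply: ler_wpM2l; first exact: ltW.
    by apply: ler_wiXn2l; rewrite ?ltW.
  rewrite sumr_const_nat addnK -mulr_natr.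
  apply: (@le_trans _ _ (M * C * (n.+1%:R * r ^+ n))).
    rewrite -!mulrA !ler_wpM2l ?(ltW C0)// mulrC ler_wpM2r ?exprn_ge0 ?(ltW r0)//.
    by rewrite ler_nat.
  rewrite -!mulrA; do 2 (apply: ler_wpM2l; rewrite ?(ltW C0)//).
apply/norm_cvg0P.
apply: (squeeze_cvgr (f := fun=> 0) (h := fun n => M * (C * C') * r' ^+ n)).
- by apply: nearW => n; rewrite normr_ge0 bound.
- exact: cvg_cst.
- have -> : 0 = M * (C * C') * 0 :> R by rewrite mulr0.
  by apply: cvgMl_tmp; apply: cvg_expr; rewrite ger0_norm ?ltW.
Qed.

End power_series.

(** * The generating function of a subcritical branching mechanism *)

Section rates.
Context {R : realType}.
Implicit Types (b : nat -> R).

(** What the hypotheses on the rates say in terms of finite sums of reals; [m] is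
    an upper bound for the mean [m_b]. *)
Definition subcritical b (m : R) := [/\ (forall j, j != 1%N -> 0 <= b j), 0 < b 0%N /\ m < b 0%N,
  series b @ \oo --> (0 : R),
  (forall N, \sum_(2 <= j < N) j.-1%:R * b j <= m) &
  exists2 j, (2 <= j)%N & 0 < b j].

Lemma branching_subcritical b : branching_rates b -> (dB1 b < 0)%E ->
  exists m, subcritical b m.
Proof.
move=> [b0 bs b00 bp] hB.
have m0 : (0 <= m_b b)%E.
  apply: nneseries_ge0 => j j2 _; rewrite lee_fin mulr_ge0// b0//.
  by rewrite gtn_eqF.
have mlt : (m_b b < (b 0%N)%:E)%E.
  move: hB; rewrite /dB1; case: (m_b b) m0 => [r||]//= _.
  by rewrite -EFinB !lte_fin subr_lt0.
have mfin : m_b b \is a fin_num by rewrite ge0_fin_numE// (lt_trans mlt) ?ltry.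
exists (fine (m_b b)); split => //.
- by rewrite b00; split=> //; rewrite -lte_fin fineK.
- pose b' j := if j == 1%N then 0 else b j.
  have b'0 j : 0 <= b' j by rewrite /b'; case: ifPn => // /b0.
  have cb' : series b' @ \oo --> - b 1%N.
    have h : (fun n => \sum_(0 <= j < n) (b' j)%:E)%E @ \oo --> (- b 1%N)%:E.
      rewrite -bs.
      have -> : (\sum_(0 <= j <oo | j != 1%N) (b j)%:E = \sum_(0 <= j <oo) (b' j)%:E)%E.
        apply: congr_lim; apply/funext => n; rewrite big_mkcond/=.
        by apply: eq_bigr => j _; rewrite /b'; case: eqP.
      by apply: is_cvg_nneseries => j *; rewrite lee_fin.
    move/fine_cvgP : h => [_]; apply: cvg_trans; apply: near_eq_cvg.
    by apply: nearW => n /=; rewrite sumEFin.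
  rewrite -(cvg_shiftn 2).
  rewrite (_ : (fun n => series b (n + 2)%N) = (fun n => series b' (n + 2)%N + b 1%N)); last first.
    apply/funext => n; rewrite /series/= addn2 !big_nat_recl//= /b'/= add0r.
    by rewrite -!addrA; congr (_ + _); rewrite addrC.
  have H : series b' (n + 2)%N + b 1%N @[n --> \oo] --> - b 1%N + b 1%N.
    by apply: cvgD; [rewrite (cvg_shiftn 2 (series b'))|exact: cvg_cst].
  by rewrite addNr in H; exact: H.
- move=> N; rewrite -lee_fin fineK// -sumEFin.
  apply: nneseries_lim_ge => j j2 _; rewrite lee_fin mulr_ge0// b0//.
  by rewrite gtn_eqF.
- apply: contrapT => H; move: bp; rewrite eseries0 ?ltxx// => j j2 _.
  congr (_%:E); apply/eqP; rewrite eq_le b0 ?gtn_eqF// andbT leNgt.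
  by apply/negP => bj; apply: H; exists j.
Qed.

Definition psum b k : R := \sum_(i < k.+1) b i.

Lemma ps_psum b s : rad1 (psum b) -> `|s| < 1 -> ps b s = (1 - s) * ps (psum b) s.
Proof.
move=> rb s1; have h := ps_cvg rb s1.
have h' : (fun n => series (fun k => psum b k * s ^+ k) n.+1
    - s * series (fun k => psum b k * s ^+ k) n) @ \oo -->
    ps (psum b) s - s * ps (psum b) s.
  apply: cvgB; last exact: cvgMl_tmp.
  by rewrite (cvg_shiftS (series (fun k => psum b k * s ^+ k))).
rewrite mulrBl mul1r; apply/cvg_lim => //; rewrite -cvg_shiftS.
rewrite /pseries (_ : (fun n => series _ n.+1) = (fun n => series (fun k => psum b k * s ^+ k) n.+1
    - s * series (fun k => psum b k * s ^+ k) n)) //.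
apply/funext => n; rewrite /series/= !big_nat_recl//= /psum big_ord1.
rewrite -addrA; congr (_ + _); rewrite big_distrr/= -sumrB; apply: eq_bigr => k _.
by rewrite big_ord_recr/= exprS; ring.
Qed.


Variables (b : nat -> R) (m : R).
Hypothesis sub : subcritical b m.

Lemma tail_cvg k : (fun N => \sum_(k.+1 <= j < N) b j) @ \oo --> - psum b k.
Proof.
case: sub => [b0 [b00 mb] bs bm _].
have : (fun N => series b N - psum b k) @ \oo --> 0 - psum b k.
  by apply: cvgB => //; exact: cvg_cst.
rewrite sub0r; apply: cvg_trans; apply: near_eq_cvg; near=> N.
rewrite /series/= (@big_cat_nat _ _ _ k.+1)//=; last by near: N; exact: nbhs_infty_ge.
rewrite /psum -(big_mkord xpredT b); ring.
Unshelve. all: by end_near. Qed.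

Lemma psum_le0 k : (0 < k)%N -> psum b k <= 0.
Proof.
move=> k0; case: sub => [b0 [b00 mb] bs bm _]; rewrite -oppr_ge0.
apply: (cvgr_to_ge (@tail_cvg k)); apply: nearW => N.
rewrite big_nat; apply: sumr_ge0 => j /andP[kj _].
by apply: b0; rewrite gtn_eqF// (leq_trans _ kj).
Qed.

Lemma sum_tail_le (n N : nat) :
  \sum_(1 <= k < n) \sum_(k.+1 <= j < N) b j <= \sum_(2 <= j < N) j.-1%:R * b j.
Proof.
case: sub => [b0 _ _ _ _].
have bj j : (2 <= j)%N -> 0 <= b j by move=> j2; apply: b0; rewrite gtn_eqF.
have -> : \sum_(1 <= k < n) \sum_(k.+1 <= j < N) b j =
    \sum_(1 <= k < n) \sum_(2 <= j < N | (k < j)%N) b j.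
  apply: eq_big_nat => k /andP[k1 _].
  by rewrite (@big_nat_widenl _ _ _ k.+1 2).
rewrite (exchange_big_dep_nat xpredT)//= !big_nat; apply: ler_sum => j /andP[j2 _].
apply: (@le_trans _ _ (\sum_(1 <= k < j) b j)); last first.
  by rewrite sumr_const_nat subn1 mulr_natl.
have [jn|/ltnW nj] := leqP j n.
  by rewrite [leRHS](@big_nat_widen _ _ _ 1 j n).
case: n nj => [|n] nj; first by rewrite big_geq// sumr_ge0// => *; exact: bj.
rewrite [leRHS](@big_cat_nat _ _ _ n.+1 1 j)//= -[leLHS]addr0; apply: lerD.
  by rewrite big_mkcond/=; apply: ler_sum => k _; case: ifP => // _; exact: bj.
by apply: sumr_ge0 => *; exact: bj.
Qed.

Lemma sum_psum_le n : \sum_(1 <= k < n) - psum b k <= m.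
Proof.
case: sub => [b0 [b00 mb] bs bm _].
have : (fun N => \sum_(1 <= k < n) \sum_(k.+1 <= j < N) b j) @ \oo -->
    \sum_(1 <= k < n) - psum b k.
  by apply: cvg_big => [|k _]; [exact: add_continuous|exact: tail_cvg].
move=> h; apply: (cvgr_to_le h); apply: nearW => N.
exact: le_trans (sum_tail_le _ _) (bm N).
Qed.


Lemma b_bounded j : `|b j| <= `|b 1%N| + b 0%N.
Proof.
case: sub => [b0 [b00 mb] bs bm _].
have [->|j1] := eqVneq j 1%N; first by rewrite lerDl ltW.
rewrite ger0_norm ?b0//; case: j j1 => [|[|j]]// _.
  by rewrite lerDr.
have : 0 <= - psum b 1 - b j.+2.
  have h := @tail_cvg 1%N; rewrite subr_ge0; apply: (cvgr_to_ge h).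
  exists j.+3 => // N /= jN.
  rewrite (bigD1_seq j.+2) ?mem_index_iota ?iota_uniq ?jN//= lerDl.
  rewrite big_seq_cond; apply: sumr_ge0 => k /andP[].
  rewrite mem_index_iota => /andP[k2 _] _.
  by apply: b0; rewrite gtn_eqF.
rewrite /psum big_ord_recl big_ord1/= => h.
have := ler_norm (- b 1%N); rewrite normrN; lra.
Qed.

Lemma rad1_b : rad1 b.
Proof. exact: bounded_rad1 b_bounded. Qed.

Lemma psum_ge (k : nat) : (0 < k)%N -> - psum b k <= m.
Proof.
move=> k0; apply: le_trans (sum_psum_le k.+1).
rewrite big_nat_recr//= lerDr big_nat; apply: sumr_ge0 => j /andP[j0 _].
by rewrite oppr_ge0 psum_le0.
Qed.

Lemma m_ge0 : 0 <= m.
Proof. by have := sum_psum_le 0; rewrite big_geq. Qed.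

Lemma psum_bounded k : `|psum b k| <= b 0%N + m.
Proof.
case: sub => [b0 [b00 mb] bs bm _]; have m0 := m_ge0.
case: k => [|k]; first by rewrite /psum big_ord1 ger0_norm ?(ltW b00)//; lra.
by rewrite ler0_norm ?psum_le0//; have := @psum_ge k.+1 isT; lra.
Qed.

Lemma rad1_psum : rad1 (psum b).
Proof. exact: bounded_rad1 psum_bounded. Qed.

Lemma ps_psum_bounds s : 0 <= s < 1 -> b 0%N - m <= ps (psum b) s <= b 0%N.
Proof.
move=> /andP[s0 s1]; case: sub => [b0 [b00 mb] bs bm _].
have x1 : `|s| < 1 by rewrite ger0_norm.
have h := ps_cvg rad1_psum x1.
have nb n : b 0%N - m <= series (fun k => psum b k * s ^+ k) n.+1 <= b 0%N.
  rewrite /series/= big_ltn// expr0 mulr1 {1 3}/psum big_ord1; apply/andP; split.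
    rewrite lerD2l lerNl -sumrN; apply: le_trans (sum_psum_le n.+1).
    rewrite !big_nat; apply: ler_sum => k /andP[k0 _]; rewrite -mulNr.
    by rewrite ler_piMr ?oppr_ge0 ?psum_le0// exprn_ile1// ltW.
  rewrite gerDl -oppr_ge0 -sumrN big_nat; apply: sumr_ge0 => k /andP[k0 _].
  by rewrite -mulNr mulr_ge0 ?exprn_ge0// oppr_ge0 psum_le0.
rewrite -cvg_shiftS in h; apply/andP; split.
- by apply: (cvgr_to_ge h); apply: nearW => n; have /andP[] := nb n.
- by apply: (cvgr_to_le h); apply: nearW => n; have /andP[] := nb n.
Qed.

(** The bounds come from factoring [1 - s] out of [B]. *)
Lemma Bgen_bounds s : 0 <= s < 1 ->
  (b 0%N - m) * (1 - s) <= Bgen b s <= b 0%N * (1 - s).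
Proof.
move=> s01; have /andP[s0 s1] := s01.
have -> : Bgen b s = ps b s by [].
rewrite ps_psum ?ger0_norm//; last exact: rad1_psum.
rewrite mulrC ![_ * (1 - s)]mulrC.
have /andP[h1 h2] := ps_psum_bounds s01.
by rewrite !ler_wpM2l// subr_ge0 ltW.
Qed.

Lemma Bgen_gt0 s : 0 <= s < 1 -> 0 < Bgen b s.
Proof.
move=> s01; have /andP[s0 s1] := s01; have /andP[h _] := Bgen_bounds s01.
by case: sub => [b0 [b00 mb] bs bm _]; apply: lt_le_trans h; rewrite mulr_gt0 ?subr_gt0.
Qed.

End rates.

Section strong_recursion.
Context {T : Type} (x0 : T) (F : nat -> (nat -> T) -> T).

(** Recursion in which a value depends on all earlier ones: the table of the first
    values is extended one entry at a time. *)
Fixpoint strong_tab n : seq T :=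
  if n is n'.+1 then rcons (strong_tab n') (F n' (nth x0 (strong_tab n'))) else [::].

Definition strong_rec n : T := nth x0 (strong_tab n.+1) n.

Lemma strong_recE :
  (forall n f g, (forall k, (k < n)%N -> f k = g k) -> F n f = F n g) ->
  forall n, strong_rec n = F n strong_rec.
Proof.
move=> Fext.
have sz n : size (strong_tab n) = n by elim: n => //= n ih; rewrite size_rcons ih.
have stab n k : (k < n)%N -> nth x0 (strong_tab n) k = strong_rec k.
  elim: n => // n ih; rewrite ltnS leq_eqVlt => /predU1P[->//|kn].
  by rewrite /= nth_rcons sz kn ih.
move=> n; rewrite {1}/strong_rec /= nth_rcons sz ltnn eqxx.
by apply: Fext => k; exact: stab.
Qed.

End strong_recursion.

(** * The weight and the radial eigenfunctions as power series *)

Section weight_coefficients.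
Context {R : realType}.
Variables (b : nat -> R) (m : R).
Hypothesis sub : subcritical b m.

(** Coefficients of [(1 - s) / B(s)], a renewal sequence. *)
Definition renew : nat -> R := strong_rec 0 (fun k f =>
  ((k == 0%N)%:R - \sum_(i < k) f i * psum b (k - i)) / b 0%N).

Lemma renewE k : renew k = ((k == 0%N)%:R - \sum_(i < k) renew i * psum b (k - i)) / b 0%N.
Proof.
rewrite {1}/renew strong_recE// => n f g fg; congr ((_ - _) / _).
by apply: eq_bigr => i _; rewrite fg.
Qed.

Let b0_gt0 : 0 < b 0%N.
Proof. by case: sub => _ []. Qed.

Lemma beta_gt0 : 0 < b 0%N - m.
Proof. by case: sub => _ [_ h] _ _ _; rewrite subr_gt0. Qed.

Lemma renew_ge0 k : 0 <= renew k.
Proof.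
elim/ltn_ind: k => k ih; rewrite renewE divr_ge0 ?(ltW b0_gt0)//.
rewrite subr_ge0; apply: (@le_trans _ _ 0) => //.
rewrite -oppr_ge0 -sumrN; apply: sumr_ge0 => i _.
by rewrite -mulrN mulr_ge0 ?ih// oppr_ge0 (psum_le0 sub)// subn_gt0.
Qed.

Lemma conv_renew k : conv renew (psum b) k = (k == 0%N)%:R.
Proof.
rewrite /conv big_ord_recr/= subnn {2}/psum big_ord1 renewE (divfK (lt0r_neq0 b0_gt0)).
by rewrite addrC subrK.
Qed.

Lemma sum_renew_le n : \sum_(0 <= k < n) renew k <= (b 0%N - m)^-1.
Proof.
have bm := beta_gt0.
case: n => [|n]; first by rewrite big_geq// invr_ge0 ltW.
rewrite -[leRHS]mul1r ler_pdivlMr//.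
set S := \sum_(0 <= k < n.+1) renew k.
suff : b 0%N * S <= 1 + m * S by lra.
have -> : b 0%N * S = 1 + \sum_(0 <= k < n.+1) \sum_(0 <= i < n.+1 | (i < k)%N)
    renew i * - psum b (k - i).
  rewrite /S big_distrr/=.
  have E k : (k < n.+1)%N -> b 0%N * renew k = (k == 0%N)%:R +
      \sum_(0 <= i < n.+1 | (i < k)%N) renew i * - psum b (k - i).
    move=> kn; rewrite renewE mulrC (divfK (lt0r_neq0 b0_gt0)); congr (_ + _).
    rewrite -(big_mkord xpredT (fun i => renew i * psum b (k - i))) -sumrN.
    rewrite (@big_nat_widen _ _ _ 0 k n.+1) 1?ltnW//=.
    by apply: eq_bigr => i _; rewrite mulrN.
  rewrite big_nat; under eq_bigr => k kn do rewrite E//.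
  rewrite -big_nat big_split/=; congr (_ + _).
  by rewrite big_nat_recl//= big1 ?addr0// => k _.
rewrite lerD2l (exchange_big_dep_nat xpredT)//= /S big_distrr/=.
rewrite !big_nat; apply: ler_sum => i /andP[_ iN].
rewrite -big_distrr/= mulrC ler_wpM2r ?renew_ge0//.
have -> : \sum_(0 <= k < n.+1 | (i < k)%N) - psum b (k - i) =
    \sum_(i.+1 <= k < n.+1) - psum b (k - i).
  by rewrite [RHS](@big_nat_widenl _ _ _ i.+1 0).
rewrite -[i.+1]add1n big_addn.
under eq_bigr do rewrite addnK.
exact: (sum_psum_le sub).
Qed.

(** Dividing the renewal series by [1 - s] turns its coefficients into their partial
    sums; these are bounded because [(1 - s) / B(s)] is at most [1 / (b 0 - m)]. *)
Definition wcoef : nat -> R := psum renew.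

Lemma wcoef_bounds k : 0 <= wcoef k <= (b 0%N - m)^-1.
Proof.
rewrite /wcoef /psum -(big_mkord xpredT renew) sum_renew_le andbT.
by apply: sumr_ge0 => i _; exact: renew_ge0.
Qed.

Lemma wcoef_norm k : `|wcoef k| <= (b 0%N - m)^-1.
Proof. by have /andP[h0 h] := wcoef_bounds k; rewrite ger0_norm. Qed.

Lemma rad1_wcoef : rad1 wcoef.
Proof. exact: bounded_rad1 wcoef_norm. Qed.

Lemma rad1_renew : rad1 renew.
Proof.
apply: (@bounded_rad1 _ _ (b 0%N - m)^-1) => k; rewrite ger0_norm ?renew_ge0//.
have /andP[_] := wcoef_bounds k; apply: le_trans.
by rewrite /wcoef /psum big_ord_recr/= lerDr sumr_ge0// => *; exact: renew_ge0.
Qed.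

Lemma weight_ps s : 0 <= s < 1 -> weight b s = ps wcoef s.
Proof.
move=> s01; have /andP[s0 s1] := s01; have x1 : `|s| < 1 by rewrite ger0_norm.
have hB : Bgen b s = (1 - s) * ps (psum b) s.
  by rewrite -ps_psum//; exact: (rad1_psum sub).
have hU : ps renew s = (1 - s) * ps wcoef s by rewrite -ps_psum//; exact: rad1_wcoef.
have hUG : ps renew s * ps (psum b) s = 1.
  rewrite -ps_conv//; [|exact: rad1_renew|exact: (rad1_psum sub)].
  rewrite (_ : conv _ _ = fun k => (k == 0%N)%:R); last by apply/funext => k; rewrite conv_renew.
  apply/cvg_lim => //; apply: cvg_near_cst; exists 1%N => // n /= n0.
  rewrite /pseries/series/= big_ltn// mul1r expr0 big_nat_cond big1 ?addr0//.
  by move=> i /andP[/andP[i0 _] _]; rewrite gtn_eqF// mul0r.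
have B0 := Bgen_gt0 sub s01.
rewrite /weight; apply: (mulIf (lt0r_neq0 B0)); rewrite mulVf ?gt_eqF//.
by rewrite hB mulrCA mulrA -hU.
Qed.

End weight_coefficients.

Section eigen_series.
Context {R : realType}.
Variables (b : nat -> R) (m : R).
Hypothesis sub : subcritical b m.
Implicit Types (l s : R).

(** Coefficients of the solution of [(s phi')' = - l w phi] that is regular at
    [0], with [phi 0 = 1]. *)
Definition ecoef l : nat -> R := strong_rec 0 (fun k f =>
  if k is k'.+1 then - l / (k%:R ^+ 2) * \sum_(i < k) f i * wcoef b (k' - i)%N else 1).

Lemma ecoefS l k :
  ecoef l k.+1 = - l / (k.+1%:R ^+ 2) * conv (ecoef l) (wcoef b) k.
Proof.
rewrite {1}/ecoef strong_recE// => -[|n] f g fg //; congr (_ * _).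
by apply: eq_bigr => i _; rewrite fg.
Qed.

Lemma ecoef0 l : ecoef l 0 = 1.
Proof.
rewrite {1}/ecoef strong_recE// => -[|n] f g fg //; congr (_ * _).
by apply: eq_bigr => i _; rewrite fg.
Qed.

Definition harm2 n : R := \sum_(k < n) (k.+1%:R ^+ 2)^-1.

Lemma harm2S n : harm2 n.+1 = harm2 n + (n.+1%:R ^+ 2)^-1.
Proof. by rewrite /harm2 big_ord_recr. Qed.

Lemma harm2_ge0 n : 0 <= harm2 n.
Proof. by apply: sumr_ge0 => i _; rewrite invr_ge0 exprn_ge0. Qed.

Lemma harm2_le2 n : harm2 n <= 2.
Proof.
suff : harm2 n.+1 <= 2 - n.+1%:R^-1.
  rewrite harm2S => h; have h1 : 0 < n.+1%:R^-1 :> R by rewrite invr_gt0 ltr0n.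
  have h2 : 0 <= (n.+1%:R ^+ 2 : R)^-1 by rewrite invr_ge0 exprn_ge0.
  apply: (@le_trans _ _ (2 - n.+1%:R^-1)); last by rewrite gerBl ltW.
  by apply: le_trans h; rewrite lerDl.
elim: n => [|n ih]; first by rewrite harm2S /harm2 big_ord0 expr1n invr1; lra.
rewrite harm2S; apply: le_trans (lerD ih (lexx _)) _.
have n1 : 0 < n.+1%:R :> R by rewrite ltr0n.
rewrite -(natr1 n.+1) -subr_ge0.
have -> : 2 - (n.+1%:R + 1)^-1 - (2 - n.+1%:R^-1 + ((n.+1%:R + 1) ^+ 2)^-1) =
  (n.+1%:R * (n.+1%:R + 1) ^+ 2)^-1 :> R.
  by field; rewrite !nat1r natr1 !pnatr_eq0.
by rewrite invr_ge0 mulr_ge0 ?exprn_ge0 ?addr_ge0.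
Qed.

Local Notation beta := (b 0%N - m).

(** The entry of rank [k + 1] is at most [|l| / (beta (k + 1)^2)] times the sum of
    the earlier ones, and [1 + x <= exp x]. *)
Lemma ecoef_sum l n :
  \sum_(k < n.+1) `|ecoef l k| <= expR (`|l| / beta * harm2 n).
Proof.
have bt := beta_gt0 sub.
elim: n => [|n ih].
  by rewrite big_ord1 ecoef0 normr1 /harm2 big_ord0 mulr0 expR0.
rewrite big_ord_recr/= harm2S mulrDr expRD.
set S := \sum_(k < n.+1) _ in ih *.
have S0 : 0 <= S by exact: sumr_ge0.
have : `|ecoef l n.+1| <= `|l| / beta * (n.+1%:R ^+ 2)^-1 * S.
  have hc : `|conv (ecoef l) (wcoef b) n| <= S / beta.
    rewrite /conv /S mulr_suml; apply: le_trans (ler_norm_sum _ _ _) _.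
    by apply: ler_sum => i _; rewrite normrM ler_wpM2l// (wcoef_norm sub).
  rewrite ecoefS normrM normrM normrN normfV (ger0_norm (exprn_ge0 _ _))//.
  rewrite (_ : `|l| / beta * _ * S = `|l| / n.+1%:R ^+ 2 * (S / beta)); last by ring.
  by rewrite ler_wpM2l// divr_ge0// exprn_ge0.
set x := `|l| / beta * _ => h.
have x0 : 0 <= x by rewrite mulr_ge0 ?divr_ge0 ?(ltW bt) ?invr_ge0 ?exprn_ge0.
apply: (@le_trans _ _ (S * (1 + x))); first by rewrite mulrDr mulr1 lerD2l mulrC.
by apply: ler_pM => //; [rewrite addr_ge0|exact: expR_ge1Dx].
Qed.

Lemma ecoef_norm_sum l n : \sum_(k < n) `|ecoef l k| <= expR (`|l| / beta * 2).
Proof.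
have bt := beta_gt0 sub.
apply: le_trans (_ : _ <= \sum_(k < n.+1) `|ecoef l k|) _.
  by rewrite big_ord_recr/= lerDl.
apply: le_trans (ecoef_sum _ _) _; rewrite ler_expR ler_wpM2l ?harm2_le2//.
by rewrite divr_ge0// ltW.
Qed.

Lemma rad1_ecoef l : rad1 (ecoef l).
Proof.
apply: (bounded_rad1 (M := expR (`|l| / beta * 2))) => k.
apply: le_trans (ecoef_norm_sum l k.+1).
by rewrite big_ord_recr/= lerDr sumr_ge0.
Qed.

(** Gronwall for the recursion of [ecoef]. *)
Lemma ecoef_lipschitz (L l l' : R) n : `|l| <= L -> `|l'| <= L ->
  \sum_(k < n) `|ecoef l k - ecoef l' k| <=
    `|l - l'| * (expR (L / beta * 2) / beta * 2 * expR (L / beta * 2)).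
Proof.
move=> lL l'L; have bt := beta_gt0 sub.
have L0 : 0 <= L by exact: le_trans lL.
set E := expR (L / beta * 2).
have E0 : 0 <= E by exact: expR_ge0.
have key k : \sum_(i < k.+1) `|ecoef l i - ecoef l' i| <=
    `|l - l'| * (E / beta * harm2 k * expR (L / beta * harm2 k)).
  elim: k => [|k ih].
    by rewrite big_ord1 !ecoef0 subrr normr0 /harm2 big_ord0 !(mulr0, mul0r).
  rewrite big_ord_recr/= harm2S mulrDr [L / beta * _]mulrDr expRD.
  set T := \sum_(i < k.+1) _ in ih *.
  have T0 : 0 <= T by exact: sumr_ge0.
  set q := (k.+1%:R ^+ 2 : R)^-1.
  have q0 : 0 <= q by rewrite invr_ge0 exprn_ge0.
  have : `|ecoef l k.+1 - ecoef l' k.+1| <= L / beta * q * T + `|l - l'| * (E / beta * q).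
    have -> : ecoef l k.+1 - ecoef l' k.+1 =
       q * (- l * (conv (ecoef l) (wcoef b) k - conv (ecoef l') (wcoef b) k) +
         (l' - l) * conv (ecoef l') (wcoef b) k).
      by rewrite !ecoefS -/q; ring.
    rewrite normrM (ger0_norm q0).
    have c1 : `|conv (ecoef l) (wcoef b) k - conv (ecoef l') (wcoef b) k| <= T / beta.
      rewrite /conv -sumrB mulr_suml; apply: le_trans (ler_norm_sum _ _ _) _.
      by apply: ler_sum => i _; rewrite -mulrBl normrM ler_wpM2l// (wcoef_norm sub).
    have c2 : `|conv (ecoef l') (wcoef b) k| <= E / beta.
      apply: (@le_trans _ _ ((\sum_(i < k.+1) `|ecoef l' i|) / beta)).
        rewrite /conv mulr_suml; apply: le_trans (ler_norm_sum _ _ _) _.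
        by apply: ler_sum => i _; rewrite normrM ler_wpM2l// (wcoef_norm sub).
      rewrite ler_wpM2r ?invr_ge0 ?(ltW bt)//; apply: le_trans (ecoef_norm_sum _ _) _.
      by rewrite ler_expR !ler_wpM2r ?invr_ge0 ?(ltW bt).
    apply: (@le_trans _ _ (q * (L * (T / beta) + `|l - l'| * (E / beta)))).
      rewrite ler_wpM2l//; apply: le_trans (ler_normD _ _) _.
      rewrite !normrM normrN (distrC l' l); apply: lerD; first exact: ler_pM.
      by rewrite ler_wpM2l.
    by rewrite le_eqVlt; apply/orP; left; apply/eqP; ring.
  set e := expR (L / beta * harm2 k) in ih *; set e' := expR (L / beta * q) => h.
  have e1 : 1 <= e by rewrite -expR0 ler_expR mulr_ge0 ?divr_ge0 ?harm2_ge0// ltW.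
  have e'1 : 1 + L / beta * q <= e' by exact: expR_ge1Dx.
  have x0 : 0 <= L / beta * q by rewrite mulr_ge0// divr_ge0// (ltW bt).
  set x := L / beta * q in e'1 x0 h *; set y := `|l - l'| * (E / beta * q) in h *.
  have y0 : 0 <= y by rewrite mulr_ge0// mulr_ge0// divr_ge0// (ltW bt).
  set z := `|l - l'| * (E / beta * harm2 k * e) in ih *.
  have z0 : 0 <= z by apply: le_trans ih.
  have -> : `|l - l'| * ((E / beta * harm2 k + E / beta * q) * (e * e')) = z * e' + y * (e * e').
    by rewrite /z /y; ring.
  have ee' : 1 <= e * e' by rewrite mulr_ege1//; lra.
  have h1 : T * (1 + x) <= z * e' by rewrite ler_pM// addr_ge0.
  have h2 : y * 1 <= y * (e * e') by rewrite ler_wpM2l.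
  lra.
apply: le_trans (_ : _ <= \sum_(k < n.+1) `|ecoef l k - ecoef l' k|) _.
  by rewrite big_ord_recr/= lerDl.
apply: le_trans (key n) _; rewrite ler_wpM2l//.
have h2 := harm2_le2 n; have h0 := harm2_ge0 n.
apply: ler_pM.
- by rewrite mulr_ge0// divr_ge0// ltW.
- exact: expR_ge0.
- by rewrite ler_wpM2l// divr_ge0// ltW.
- by rewrite ler_expR ler_wpM2l// divr_ge0// ltW.
Qed.

End eigen_series.

(** * The solutions regular at 0 *)

Section monotone.
Context {R : realType}.
Implicit Types (f df : R -> R) (a c : R).

Lemma le_of_deriv_ge0 f df a c : a <= c ->
  (forall x, a <= x <= c -> is_derive x 1 f (df x)) ->
  (forall x, a < x < c -> 0 <= df x) -> f a <= f c.
Proof.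
rewrite le_eqVlt => /predU1P[->//|ac] dfx df0.
have [||x xac] := @MVT _ f df a c ac.
- move=> x; rewrite in_itv/= => /andP[ax xc].
  by apply: dfx; rewrite !ltW.
- apply: derivable_within_continuous => x; rewrite in_itv/= => xac.
  by have [] := dfx x xac.
- move: xac; rewrite in_itv/= => xac.
  move=> h; rewrite -subr_ge0 h mulr_ge0 ?df0// subr_ge0 ltW//.
Qed.

Lemma le_of_derivs f g df dg a c : a <= c ->
  (forall x, a <= x <= c -> is_derive x 1 f (df x)) ->
  (forall x, a <= x <= c -> is_derive x 1 g (dg x)) ->
  (forall x, a < x < c -> df x <= dg x) -> f c - f a <= g c - g a.
Proof.
move=> ac hf hg h.
suff : (g - f) a <= (g - f) c by rewrite !fctE; lra.
apply: (@le_of_deriv_ge0 _ (fun x => dg x - df x)) => // x xac; last by rewrite subr_ge0 h.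
by apply: is_deriveB; [exact: hg|exact: hf].
Qed.

End monotone.

Section eigenfunction.
Context {R : realType}.
Variables (b : nat -> R) (m : R).
Hypothesis sub : subcritical b m.
Implicit Types (l s : R).

Definition phi l s : R := ps (ecoef b l) s.
Definition dphi l s : R := ps (pseries_diffs (ecoef b l)) s.
(** [flux l s] is [- s phi'(s)]; as a power series it makes sense at 0, and it is the
    quantity that the differential equation makes monotone. *)
Definition flux l s : R := ps (fun k => - (k%:R * ecoef b l k)) s.

Lemma rad1_flux l : rad1 (fun k => - (k%:R * ecoef b l k)).
Proof.
move=> r r01; have [M HM] := rad1_diffs (rad1_ecoef sub l) r01.
have /andP[r0 r1] := r01.
have M0 : 0 <= M by apply: le_trans (HM 0%N); rewrite mulr_ge0.
exists M => -[|k]; first by rewrite mul0r oppr0 normr0 mul0r.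
have := HM k; rewrite /pseries_diffs normrN => h.
rewrite exprS mulrCA; apply: le_trans (_ : r * M <= _); first by rewrite ler_pM2l.
by rewrite ler_piMl// ltW.
Qed.

Lemma psN a s : rad1 a -> `|s| < 1 -> ps (fun k => - a k) s = - ps a s.
Proof.
move=> ra s1; apply/cvg_lim => //.
rewrite /pseries (_ : series _ = fun n => - series (fun k => a k * s ^+ k) n).
  by apply: cvgN; exact: ps_cvg.
by apply/funext => n; rewrite /series/= -sumrN; apply: eq_bigr => k _; rewrite mulNr.
Qed.

Lemma psZ x a s : rad1 a -> `|s| < 1 -> ps (fun k => x * a k) s = x * ps a s.
Proof.
move=> ra s1; apply/cvg_lim => //.
rewrite /pseries (_ : series _ = fun n => x * series (fun k => a k * s ^+ k) n).
  by apply: cvgMl_tmp; exact: ps_cvg.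
by apply/funext => n; rewrite /series/= big_distrr/=; apply: eq_bigr => k _; rewrite mulrA.
Qed.

Lemma fluxE l s : `|s| < 1 -> flux l s = - (s * dphi l s).
Proof.
move=> s1; have ra := rad1_diffs (rad1_ecoef sub l).
have raN : rad1 (fun k => - pseries_diffs (ecoef b l) k).
  by move=> r /ra[M HM]; exists M => k; rewrite normrN.
rewrite /flux ps_shift//; first by rewrite mul0r oppr0 add0r psN// mulrN.
exact: rad1_flux.
Qed.

Lemma is_derive_phi l s : `|s| < 1 -> is_derive s 1 (phi l) (dphi l s).
Proof. by move=> s1; apply: is_derive_ps => //; exact: (rad1_ecoef sub). Qed.

Lemma is_derive_phi_flux l s : 0 < s < 1 -> is_derive s 1 (phi l) (- flux l s / s).
Proof.
move=> /andP[s0 s1]; have x1 : `|s| < 1 by rewrite ger0_norm// ltW.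
have -> : - flux l s / s = dphi l s.
  by rewrite fluxE// opprK mulrAC divff ?mul1r// gt_eqF.
exact: is_derive_phi.
Qed.

Lemma is_derive_flux l s : 0 <= s < 1 ->
  is_derive s 1 (flux l) (l * phi l s * weight b s).
Proof.
move=> s01; have /andP[s0 s1] := s01.
have x1 : `|s| < 1 by rewrite ger0_norm.
have rc := conv_rad1 (rad1_ecoef sub l) (rad1_wcoef sub).
have := is_derive_ps (@rad1_flux l) x1.
rewrite (_ : pseries_diffs _ = (fun k => l * conv (ecoef b l) (wcoef b) k)).
  rewrite psZ// ps_conv//; [|exact: (rad1_ecoef sub)|exact: (rad1_wcoef sub)].
  by rewrite -(weight_ps sub)// mulrA.
apply/funext => k; rewrite /pseries_diffs ecoefS; field.
by rewrite nat1r pnatr_eq0.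
Qed.

Lemma phi0 l : phi l 0 = 1.
Proof. by rewrite /phi ps0 ecoef0. Qed.

Lemma flux0 l : flux l 0 = 0.
Proof. by rewrite /flux ps0 mul0r oppr0. Qed.

Lemma phi_l0 s : phi 0 s = 1.
Proof.
apply/cvg_lim => //; apply: cvg_near_cst; exists 1%N => // n /= n0.
rewrite /pseries/series/= big_ltn// expr0 mulr1 ecoef0 big_nat_cond big1 ?addr0//.
by move=> [|i] /andP[/andP[i0 _] _] //; rewrite ecoefS oppr0 !mul0r.
Qed.

Lemma phi_lipschitz (L : R) : exists2 K, 0 < K & forall l l' s,
  `|l| <= L -> `|l'| <= L -> 0 <= s < 1 -> `|phi l s - phi l' s| <= `|l - l'| * K.
Proof.
have [L0|L0] := ltP L 0.
  by exists 1 => // l l' s h; have := le_lt_trans (le_trans (normr_ge0 _) h) L0; rewrite ltxx.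
have bt := beta_gt0 sub.
set beta := b 0%N - m in bt.
exists (expR (L / beta * 2) / beta * 2 * expR (L / beta * 2)).
  by rewrite !mulr_gt0 ?expR_gt0 ?invr_gt0.
move=> l l' s lL l'L /andP[s0 s1].
have x1 : `|s| < 1 by rewrite ger0_norm.
have h : `|series (fun k => ecoef b l k * s ^+ k) n -
    series (fun k => ecoef b l' k * s ^+ k) n| @[n --> \oo] --> `|phi l s - phi l' s|.
  by apply: cvg_norm; apply: cvgB; apply: ps_cvg => //; exact: (rad1_ecoef sub).
apply: (cvgr_to_le h); apply: nearW => n.
apply: le_trans (ecoef_lipschitz sub n lL l'L).
rewrite /series/= -sumrB big_mkord; apply: le_trans (ler_norm_sum _ _ _) _.
apply: ler_sum => k _; rewrite -mulrBl normrM ler_piMr// normrX exprn_ile1//.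
by rewrite ltW.
Qed.

(** [W] is the integral of the weight from [0]. *)
Definition W s : R := ps (fun k => if k is k'.+1 then wcoef b k' / k%:R else 0) s.

Lemma rad1_W : rad1 (fun k => if k is k'.+1 then wcoef b k' / k%:R else 0 : R).
Proof.
have bt := beta_gt0 sub.
apply: (bounded_rad1 (M := (b 0%N - m)^-1)) => -[|k].
  by rewrite normr0 invr_ge0 ltW.
rewrite normrM normfV (@ger0_norm _ k.+1%:R)// ler_pdivrMr ?ltr0n//.
apply: le_trans (wcoef_norm sub k) _; rewrite ler_pMr ?invr_gt0//.
by rewrite ler1n.
Qed.

Lemma is_derive_W s : 0 <= s < 1 -> is_derive s 1 W (weight b s).
Proof.
move=> s01; have /andP[s0 s1] := s01.
have x1 : `|s| < 1 by rewrite ger0_norm.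
have := is_derive_ps rad1_W x1.
rewrite (_ : pseries_diffs _ = wcoef b) -?(weight_ps sub)//.
by apply/funext => k; rewrite /pseries_diffs mulrC divfK// pnatr_eq0.
Qed.

Lemma W0 : W 0 = 0. Proof. by rewrite /W ps0. Qed.

Lemma weight_gt0 s : 0 <= s < 1 -> 0 < weight b s.
Proof. by move=> s01; rewrite invr_gt0; exact: (Bgen_gt0 sub). Qed.

Lemma weight_le s : 0 <= s < 1 -> weight b s <= ((b 0%N - m) * (1 - s))^-1.
Proof.
move=> s01; have /andP[s0 s1] := s01.
have /andP[h _] := Bgen_bounds sub s01; rewrite lef_pV2 ?posrE//.
  exact: (Bgen_gt0 sub).
by rewrite mulr_gt0 ?subr_gt0// -subr_gt0 (beta_gt0 sub).
Qed.

Lemma W_gt0 s : 0 < s < 1 -> 0 < W s.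
Proof.
move=> /andP[s0 s1].
have bt := beta_gt0 sub.
have b0 : 0 < b 0%N by case: sub => _ [].
have -> : W s = W s - W 0 by rewrite W0 subr0.
apply: (@lt_le_trans _ _ (s * (b 0%N)^-1 - 0 * (b 0%N)^-1)).
  by rewrite mul0r subr0 mulr_gt0 ?invr_gt0.
apply: (@le_of_derivs _ (fun x => x * (b 0%N)^-1) W (fun=> (b 0%N)^-1) (weight b)).
- exact: ltW.
- move=> x _; apply: (der_eq (derM (der_id x) (der_cst _ x))); ring.
- move=> x /andP[x0 xs]; apply: is_derive_W; rewrite x0/=; exact: le_lt_trans s1.
- move=> x /andP[x0 xs]; have x01 : 0 <= x < 1 by rewrite ltW//= (lt_trans xs).
  rewrite lef_pV2 ?posrE ?(Bgen_gt0 sub)//.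
  have /andP[_ h] := Bgen_bounds sub x01; apply: le_trans h _.
  by rewrite ger_pMr// gerBl ltW.
Qed.

End eigenfunction.

(** * The principal eigenvalue *)

Section principal.
Context {R : realType}.
Variables (b : nat -> R) (m : R).
Hypothesis sub : subcritical b m.
Implicit Types (l s t : R).

Local Notation phi := (phi b).
Local Notation flux := (flux b).
Local Notation W := (W b).
Local Notation weight := (weight b).

Lemma flux_le l s t : 0 <= l -> 0 <= s -> s <= t -> t < 1 ->
  (forall x, 0 < x < 1 -> 0 <= phi l x) -> flux l s <= flux l t.
Proof.
move=> l0 s0 st t1 ph; apply: (@le_of_deriv_ge0 _ (flux l) (fun x => l * phi l x * weight x) s t st).
- move=> x /andP[sx xt]; apply: (is_derive_flux sub).
  by rewrite (le_trans s0)//= (le_lt_trans xt).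
- move=> x /andP[sx xt].
  have x01 : 0 < x < 1 by rewrite (le_lt_trans s0)//= (lt_trans xt).
  rewrite mulr_ge0 ?mulr_ge0 ?ph//; apply/ltW/(weight_gt0 sub).
  by case/andP: x01 => /ltW -> ->.
Qed.

Lemma flux_ge0 l s : 0 <= l -> 0 <= s < 1 ->
  (forall x, 0 < x < 1 -> 0 <= phi l x) -> 0 <= flux l s.
Proof.
by move=> l0 /andP[s0 s1] ph; rewrite -(flux0 b l) flux_le.
Qed.

Lemma phi_le l s t : 0 <= l -> 0 < s -> s <= t -> t < 1 ->
  (forall x, 0 < x < 1 -> 0 <= phi l x) -> phi l t <= phi l s.
Proof.
move=> l0 s0 st t1 ph; rewrite -lerN2.
apply: (@le_of_deriv_ge0 _ (fun x => - phi l x) (fun x => - (- flux l x / x)) s t st).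
- move=> x /andP[sx xt]; apply/derN/(is_derive_phi_flux sub).
  by rewrite (lt_le_trans s0)//= (le_lt_trans xt).
- move=> x /andP[sx xt]; have x0 := lt_trans s0 sx.
  rewrite mulNr opprK divr_ge0 ?(ltW x0)//; apply: flux_ge0 => //.
  by rewrite (ltW x0)/= (lt_trans xt).
Qed.

Lemma phi_le1 l s : 0 <= l -> 0 < s < 1 ->
  (forall x, 0 < x < 1 -> 0 <= phi l x) -> phi l s <= 1.
Proof.
move=> l0 /andP[s0 s1] ph; rewrite -(phi0 b l) -lerN2.
apply: (@le_of_deriv_ge0 _ (fun x => - phi l x) (fun x => - dphi b l x) 0 s (ltW s0)).
- move=> x /andP[x0 xs]; apply/derN/(is_derive_phi sub).
  by rewrite ger0_norm// (le_lt_trans xs).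
- move=> x /andP[x0 xs]; have x1 := lt_trans xs s1.
  have h : 0 <= flux l x by apply: flux_ge0 => //; rewrite ltW.
  rewrite (fluxE sub) in h; last by rewrite ger0_norm// ltW.
  by rewrite -mulrN pmulr_rge0 in h.
Qed.

(** Since the flux increases, [phi] lies above the logarithm with the same flux
    at [s] that vanishes at [1]. *)
Lemma flux_ln_le l s : 0 <= l -> 0 < s < 1 ->
  (forall x, 0 < x < 1 -> 0 <= phi l x) -> flux l s * - ln s <= phi l s.
Proof.
move=> l0 /andP[s0 s1] ph.
have h t : s <= t -> t < 1 -> flux l s * ln t <= phi l s + flux l s * ln s.
  move=> st t1.
  suff : - (phi l s + flux l s * ln s) <= - (phi l t + flux l s * ln t).
    have t01 : 0 < t < 1 by rewrite (lt_le_trans s0 st).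
    by have := ph t t01; lra.
  apply: (@le_of_deriv_ge0 _ (fun x => - (phi l x + flux l s * ln x))
    (fun x => - (- flux l x / x + flux l s * x^-1)) s t st).
  - move=> x /andP[sx xt]; have x0 := lt_le_trans s0 sx.
    apply: derN; apply: derD.
      by apply: (is_derive_phi_flux sub); rewrite x0 (le_lt_trans xt).
    by apply: derZ; exact: is_derive1_ln.
  - move=> x /andP[sx xt]; have x0 := lt_trans s0 sx.
    have -> : - (- flux l x / x + flux l s * x^-1) = (flux l x - flux l s) / x by ring.
    rewrite divr_ge0 ?(ltW x0)// subr_ge0; apply: flux_le => //; try exact: ltW.
    exact: lt_trans xt t1.
have cv : flux l s * ln t @[t --> 1^'-] --> flux l s * ln 1.
  apply: cvgMl_tmp; apply: cvg_at_left_filter.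
  by apply: continuous_ln; rewrite ltr01.
have : flux l s * ln 1 <= phi l s + flux l s * ln s.
  apply: (cvgr_to_le cv); near=> t; apply: h; near: t.
    exact: nbhs_left_ge.
  exact: nbhs_left_lt.
by rewrite ln1 mulr0; lra.
Unshelve. all: by end_near. Qed.

Lemma flux_W_ge l s : 0 <= l -> 0 < s < 1 ->
  (forall x, 0 < x < 1 -> 0 <= phi l x) -> l * phi l s * W s <= flux l s.
Proof.
move=> l0 /andP[s0 s1] ph.
have := @le_of_derivs _ (fun x => l * phi l s * W x) (flux l)
  (fun x => l * phi l s * weight x) (fun x => l * phi l x * weight x) 0 s (ltW s0).
rewrite W0 flux0 mulr0 !subr0; apply.
- move=> x /andP[x0 xs]; apply/derZ/(is_derive_W sub).
  by rewrite x0 (le_lt_trans xs).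
- move=> x /andP[x0 xs]; apply/(is_derive_flux sub).
  by rewrite x0 (le_lt_trans xs).
- move=> x /andP[x0 xs]; have x1 := lt_trans xs s1.
  rewrite ler_wpM2r//; first by apply/ltW/(weight_gt0 sub); rewrite (ltW x0).
  by rewrite ler_wpM2l// phi_le// ltW.
Qed.

(** Two bounds for the flux at [s], one from the weight on [0, s] and one from the
    boundary value at 1, leave a bound for [l] alone. It bounds [l] from above by
    the reciprocal of [Dsq]. *)
Lemma eigen_le l s : 0 <= l -> 0 < s < 1 -> (forall x, 0 < x < 1 -> 0 < phi l x) ->
  l * (- ln s * W s) <= 1.
Proof.
move=> l0 s01 ph; have ph0 x : 0 < x < 1 -> 0 <= phi l x by move=> /ph/ltW.
have ps := ph s s01.
have h1 := flux_W_ge l0 s01 ph0; have h2 := flux_ln_le l0 s01 ph0.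
have ls : 0 <= - ln s by rewrite oppr_ge0 ln_le0// ltW//; case/andP : s01.
have h3 : l * phi l s * W s * - ln s <= flux l s * - ln s by rewrite ler_wpM2r.
rewrite -(ler_pM2r ps) mul1r.
have -> : l * (- ln s * W s) * phi l s = l * phi l s * W s * - ln s by ring.
exact: le_trans h3 h2.
Qed.

(** Positivity on (0, 1) together with the vanishing at 1 singles out the bottom of the
    spectrum; a positive decreasing function need only come close to 0. *)
Definition principal l := [/\ 0 < l, (forall s, 0 < s < 1 -> 0 < phi l s) &
  forall e, 0 < e -> exists2 s, 0 < s < 1 & phi l s < e].

(** The supremum [l0] of the parameters for which [phi] is positive. As [phi] depends
    on [l] in a uniformly Lipschitz way, [phi l0] is nonnegative, and its flux
    forbids zeros; were it bounded away from 0, it would stay positive for slightly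
    larger parameters. *)
Lemma principal_ex : exists l, principal l.
Proof.
pose P := [set l : R | 0 <= l /\ forall s, 0 < s < 1 -> 0 < phi l s].
have P0 : P 0 by split => // s _; rewrite phi_l0.
have h2 : 0 < (2^-1 : R) < 1 by apply/andP; split; lra.
have ln2 : 0 < - ln (2^-1 : R) by rewrite oppr_gt0 ln_lt0.
have K0 : 0 < - ln 2^-1 * W 2^-1 by rewrite mulr_gt0// (W_gt0 sub).
have Pub l : P l -> l <= (- ln 2^-1 * W 2^-1)^-1.
  move=> [l0 ph]; rewrite -[leRHS]mul1r ler_pdivlMr//.
  exact: eigen_le.
have hsP : has_sup P.
  by split; [exists 0|exists (- ln 2^-1 * W 2^-1)^-1 => l /Pub].
pose l0 := sup P.
have l00 : 0 <= l0 := ub_le_sup hsP.2 P0.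
have [K Kpos HK] := phi_lipschitz sub (l0 + 1).
have nP l : l0 < l -> ~ P l.
  by move=> ll Pl; have := lt_le_trans ll (ub_le_sup hsP.2 Pl); rewrite ltxx.
have ph0 s : 0 < s < 1 -> 0 <= phi l0 s.
  move=> s01; rewrite leNgt; apply/negP => neg.
  have e0 : 0 < - phi l0 s / K by rewrite divr_gt0 ?oppr_gt0.
  have [l Pl ll] := sup_adherent e0 hsP.
  have ll0 : l <= l0 := ub_le_sup hsP.2 Pl.
  have [l1 ph] := Pl.
  have s01' : 0 <= s < 1 by case/andP: s01 => /ltW -> ->.
  have nl : `|l| <= l0 + 1 by rewrite ger0_norm//; lra.
  have nl0 : `|l0| <= l0 + 1 by rewrite ger0_norm//; lra.
  have : phi l s - phi l0 s <= (l0 - l) * K.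
    apply: le_trans (ler_norm _) _; apply: le_trans (HK l l0 s nl nl0 s01') _.
    by rewrite distrC ger0_norm ?subr_ge0.
  have : (l0 - l) * K < - phi l0 s by rewrite -ltr_pdivlMr//; rewrite -/l0 in ll; lra.
  have := ph s s01; lra.
have ph1 s : 0 < s < 1 -> 0 < phi l0 s.
  move=> s01; rewrite lt_neqAle ph0// andbT; apply/negP => /eqP p0.
  have /andP[s0 s1] := s01.
  have ls : 0 < - ln s by rewrite oppr_gt0 ln_lt0.
  have := flux_ln_le l00 s01 ph0; rewrite -p0 pmulr_lle0// => fs.
  have fx x : 0 <= x -> x <= s -> flux l0 x = 0.
    move=> x0 xs; apply/eqP; rewrite eq_le.
    rewrite (le_trans (flux_le l00 x0 xs s1 ph0) fs)/=.
    by apply: flux_ge0 => //; rewrite x0 (le_lt_trans xs).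
  have : phi l0 0 <= phi l0 s.
    apply: (@le_of_deriv_ge0 _ (phi l0) (dphi b l0) 0 s (ltW s0)).
    - move=> x /andP[x0 xs]; apply/(is_derive_phi sub).
      by rewrite ger0_norm// (le_lt_trans xs).
    - move=> x /andP[x0 xs]; have x1 := lt_trans xs s1.
      have := fx x (ltW x0) (ltW xs); rewrite (fluxE sub); last by rewrite ger0_norm// ltW.
      by move=> /eqP; rewrite oppr_eq0 mulf_eq0 gt_eqF//= => /eqP ->.
  by rewrite phi0 -p0; lra.
have phZ e : 0 < e -> exists2 s, 0 < s < 1 & phi l0 s < e.
  move=> e0; apply: contrapT => H.
  have He s : 0 < s < 1 -> e <= phi l0 s.
    by move=> s01; rewrite leNgt; apply/negP => h; apply: H; exists s.
  pose d := Num.min 1 (e / (2 * K)).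
  have d0 : 0 < d by rewrite lt_min ltr01 divr_gt0// mulr_gt0.
  have d1 : d <= 1 by rewrite ge_min lexx.
  have dK : d * K <= e / 2.
    have : d <= e / (2 * K) by rewrite ge_min lexx orbT.
    rewrite ler_pdivlMr ?mulr_gt0// => h; lra.
  apply: (nP (l0 + d)); first by rewrite ltrDl.
  split=> [|s s01]; first by rewrite addr_ge0// ltW.
  have s01' : 0 <= s < 1 by case/andP: s01 => /ltW -> ->.
  have nl : `|l0 + d| <= l0 + 1 by rewrite ger0_norm ?addr_ge0 ?(ltW d0)// lerD2l.
  have nl0 : `|l0| <= l0 + 1 by rewrite ger0_norm//; lra.
  have : phi l0 s - phi (l0 + d) s <= d * K.
    apply: le_trans (ler_norm _) _; rewrite distrC.
    apply: le_trans (HK (l0 + d) l0 s nl nl0 s01') _.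
    by rewrite addrAC subrr add0r ger0_norm ?(ltW d0).
  by have := He s s01; lra.
exists l0; split => //.
rewrite lt_neqAle l00 andbT; apply/negP => /eqP l0E.
by have [s s01] := phZ 1 ltr01; rewrite -l0E phi_l0 ltxx.
Qed.

End principal.

(** * The principal eigenfunction near 1 *)

Section principal_bounds.
Context {R : realType}.
Variables (b : nat -> R) (m l : R).
Hypothesis sub : subcritical b m.
Hypothesis pl : principal b l.
Implicit Types (s t x : R).

Local Notation phi := (phi b l).
Local Notation flux := (flux b l).
Local Notation W := (W b).
Local Notation weight := (weight b).

Lemma principal_gt0 : 0 < l. Proof. by case: pl. Qed.

Lemma phi_gt0 s : 0 < s < 1 -> 0 < phi s. Proof. by case: pl => _ h _; exact: h. Qed.

Lemma phi_ge0 s : 0 < s < 1 -> 0 <= phi s. Proof. by move=> /phi_gt0/ltW. Qed.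

Lemma phi_nincr s t : 0 < s -> s <= t -> t < 1 -> phi t <= phi s.
Proof.
by move=> s0 st t1; apply: (phi_le sub (ltW principal_gt0) s0 st t1) => x; exact: phi_ge0.
Qed.

Lemma phi_le_1 s : 0 < s < 1 -> phi s <= 1.
Proof.
by move=> s01; apply: (phi_le1 sub (ltW principal_gt0) s01) => x; exact: phi_ge0.
Qed.

Lemma flux_nneg s : 0 <= s < 1 -> 0 <= flux s.
Proof.
by move=> s01; apply: (flux_ge0 sub (ltW principal_gt0) s01) => x; exact: phi_ge0.
Qed.

Lemma phi_vanish s x : 0 < s < 1 -> (forall t, s <= t < 1 -> x <= phi t) -> x <= 0.
Proof.
move=> /andP[s0 s1] H; rewrite leNgt; apply/negP => x0.
have [_ _ Z] := pl; have [t /andP[t0 t1] pt] := Z x x0.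
have [st|ts] := leP s t; first by have := H t; rewrite st t1 => /(_ isT); lra.
have := H s; rewrite lexx s1 => /(_ isT).
by have := phi_nincr t0 (ltW ts) s1; lra.
Qed.

(** If [G >= 0] decreases at least as fast as [phi] near [1], where [phi]
    vanishes, then [G] dominates [phi]. *)
Lemma phi_le_of_deriv (G dG : R -> R) s : 0 < s < 1 ->
  (forall x, s <= x < 1 -> is_derive x 1 G (dG x)) ->
  (forall x, s < x < 1 -> dG x <= - flux x / x) ->
  (forall x, s <= x < 1 -> 0 <= G x) -> phi s <= G s.
Proof.
move=> s01 hG hdG G0; have /andP[s0 s1] := s01; rewrite -subr_le0.
apply: (phi_vanish s01) => t /andP[st t1].
have := @le_of_derivs _ G phi dG (fun x => - flux x / x) s t st.
have := G0 t; rewrite st t1 => /(_ isT) Gt H.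
suff : G t - G s <= phi t - phi s by lra.
apply: H => x /andP[sx xt].
- by apply: hG; rewrite sx (le_lt_trans xt).
- by apply: (is_derive_phi_flux sub); rewrite (lt_le_trans s0) ?(le_lt_trans xt).
- by apply: hdG; rewrite sx (lt_trans xt).
Qed.

Local Notation a := (l / (b 0%N - m)).

Let a0 : 0 < a.
Proof. by rewrite divr_gt0 ?principal_gt0// (beta_gt0 sub). Qed.

Lemma eigen_weight_le x y : 0 < x < 1 -> phi x <= y ->
  l * phi x * weight x <= a * (y / (1 - x)).
Proof.
move=> /andP[x0 x1] py; have x01 : 0 <= x < 1 by rewrite ltW.
have w := weight_le sub x01; have bt := beta_gt0 sub.
have -> : a * (y / (1 - x)) = l * y * ((b 0%N - m) * (1 - x))^-1.
  by field; rewrite !gt_eqF ?subr_gt0//; move: bt; rewrite subr_gt0.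
apply: ler_pM => //.
- by rewrite mulr_ge0 ?(ltW principal_gt0)// phi_ge0// x0.
- exact/ltW/(weight_gt0 sub).
- by rewrite ler_wpM2l ?(ltW principal_gt0).
Qed.

Lemma der_ln1B x : x < 1 -> is_derive x 1 (fun y => ln (1 - y)) (- (1 - x)^-1).
Proof.
move=> x1; apply: (der_eq (der_ln (derB (der_cst 1 x) (der_id x)) _)).
  by rewrite subr_gt0.
by rewrite sub0r mulN1r.
Qed.

Lemma ln1B_le0 x : 0 <= x < 1 -> ln (1 - x) <= 0.
Proof. by move=> /andP[x0 x1]; rewrite ln_le0// gerBl. Qed.

Lemma flux_le_ln s : 0 <= s < 1 -> flux s <= a * - ln (1 - s).
Proof.
move=> /andP[s0 s1].
suff : flux s - flux 0 <= a * - ln (1 - s) - a * - ln (1 - 0).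
  by rewrite flux0 (subr0 1) ln1 oppr0 mulr0 !subr0 addr0.
apply: (@le_of_derivs _ flux (fun x => a * - ln (1 - x))
  (fun x => l * phi x * weight x) (fun x => a * (1 / (1 - x))) 0 s s0).
- move=> x /andP[x0 xs]; apply: (is_derive_flux sub).
  by rewrite x0 (le_lt_trans xs).
- move=> x /andP[x0 xs]; apply/derZ; rewrite div1r -[_^-1]opprK.
  by apply/derN/der_ln1B/(le_lt_trans xs).
- move=> x /andP[x0 xs]; have x01 : 0 < x < 1 by rewrite x0 (lt_trans xs).
  by apply: eigen_weight_le => //; exact: phi_le_1.
Qed.

Lemma phi_le_ln s : 2^-1 <= s < 1 -> phi s <= 2 * a * ((1 - s) * (1 - ln (1 - s))).
Proof.
move=> /andP[s2 s1]; have s0 : 0 < s by lra.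
apply: (@phi_le_of_deriv (fun x => 2 * a * ((1 - x) * (1 - ln (1 - x))))
  (fun x => 2 * (a * ln (1 - x)))).
- by rewrite s0.
- move=> x /andP[sx x1]; apply: (der_eq (derZ (2 * a) (derM (derB (der_cst 1 x) (der_id x))
    (derB (der_cst 1 x) (der_ln1B x1))))).
  by set A := l / _; field; rewrite gt_eqF ?subr_gt0.
- move=> x /andP[sx x1]; have x0 : 0 < x by lra.
  have := flux_le_ln; move=> /(_ x); rewrite (ltW x0) x1 => /(_ isT) h.
  have f0 : 0 <= flux x by apply: flux_nneg; rewrite (ltW x0).
  have x2 : x^-1 <= 2 by rewrite -[2]invrK lef_pV2 ?posrE ?invr_gt0//; lra.
  have : flux x * x^-1 <= flux x * 2 by rewrite ler_wpM2l.
  by rewrite mulNr; lra.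
- move=> x /andP[sx x1]; apply: mulr_ge0; first by have := a0; lra.
  apply: mulr_ge0; first by rewrite subr_ge0 ltW.
  have : ln (1 - x) <= 0 by apply: ln1B_le0; rewrite x1 andbT; lra.
  lra.
Qed.

(** A bootstrap: [phi <= 1] makes the flux at most logarithmic, hence [phi] is at most
    [(1 - s) (1 - ln (1 - s))] up to a factor, so that the derivative [l phi w] of
    the flux has a logarithmic, integrable bound. *)
Lemma flux_bounded : exists2 C, 0 < C & forall s, 2^-1 <= s < 1 -> flux s <= C.
Proof.
pose H x : R := - ((1 - x) * (2 - ln (1 - x))).
have f2 : 0 <= flux 2^-1 by apply: flux_nneg; apply/andP; split; lra.
have H0 x : 0 <= x < 1 -> H x <= 0.
  move=> x01; have /andP[x0 x1] := x01; rewrite oppr_le0.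
  apply: mulr_ge0; first by rewrite subr_ge0 ltW.
  have := ln1B_le0 x01; lra.
have H2 : H 2^-1 <= 0 by apply: H0; apply/andP; split; lra.
exists (flux 2^-1 - 2 * a ^+ 2 * H 2^-1 + 1).
  have : 0 <= a ^+ 2 * - H 2^-1 by rewrite mulr_ge0 ?oppr_ge0// sqr_ge0.
  lra.
move=> s /andP[s2 s1].
have := @le_of_derivs _ flux (fun x => 2 * a ^+ 2 * H x)
  (fun x => l * phi x * weight x) (fun x => 2 * a ^+ 2 * (1 - ln (1 - x))) 2^-1 s s2.
have Hs : 2 * a ^+ 2 * H s <= 0.
  have : 0 <= a ^+ 2 * - H s.
    by rewrite mulr_ge0 ?sqr_ge0// oppr_ge0 H0// s1 andbT; lra.
  lra.
move=> HH; suff : flux s - flux 2^-1 <= 2 * a ^+ 2 * H s - 2 * a ^+ 2 * H 2^-1 by lra.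
apply: HH.
- move=> x /andP[x0 xs]; apply: (is_derive_flux sub).
  by rewrite (le_lt_trans xs)// andbT; lra.
- move=> x /andP[x0 xs]; have x1 := le_lt_trans xs s1.
  apply: derZ; apply: (der_eq (derN (derM (derB (der_cst 1 x) (der_id x))
    (derB (der_cst 2 x) (der_ln1B x1))))).
  by field; rewrite gt_eqF ?subr_gt0.
- move=> x /andP[x0 xs]; have x1 := lt_trans xs s1.
  have x01 : 0 < x < 1 by rewrite x1 andbT; lra.
  apply: le_trans (eigen_weight_le x01 (phi_le_ln _)) _; first by rewrite (ltW x0).
  rewrite le_eqVlt; apply/orP; left; apply/eqP; set A := l / _; field.
  by rewrite gt_eqF ?subr_gt0.
Qed.

Lemma principal_bounds : exists2 C, 0 < C &
  forall s, 0 < s < 1 -> phi s <= C * (1 - s) /\ flux s <= C * s.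
Proof.
have [C C0 HC] := flux_bounded.
exists (2 * C + 2 + 2 * a); first by have := a0; lra.
move=> s /andP[s0 s1]; have aa := a0.
have s1' : 0 < 1 - s by rewrite subr_gt0.
have [s2|s2] := leP 2^-1 s.
  split.
    apply: (@le_trans _ _ (2 * C * (1 - s))); last by rewrite ler_wpM2r//; lra.
    apply: (@phi_le_of_deriv (fun x => 2 * C * (1 - x)) (fun=> - (2 * C))).
    - by rewrite s0.
    - move=> x _; apply: (der_eq (derZ (2 * C) (derB (der_cst 1 x) (der_id x)))); ring.
    - move=> x /andP[sx x1]; have x0 : 0 < x by lra.
      have f0 : 0 <= flux x by apply: flux_nneg; rewrite (ltW x0).
      have x2 : x^-1 <= 2 by rewrite -[2]invrK lef_pV2 ?posrE ?invr_gt0//; lra.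
      have fC : flux x <= C by apply: HC; rewrite x1 andbT; lra.
      have : flux x * x^-1 <= flux x * 2 by rewrite ler_wpM2l.
      by rewrite mulNr; lra.
    - by move=> x /andP[sx x1]; rewrite !mulr_ge0 ?subr_ge0 ?(ltW x1) ?(ltW C0).
  apply: (@le_trans _ _ C); first by apply: HC; rewrite s2.
  have : C * 1 <= C * (2 * s) by rewrite ler_wpM2l ?(ltW C0)//; lra.
  have : 0 <= a * s by rewrite mulr_ge0 ?(ltW a0) ?(ltW s0).
  lra.
split.
  have : phi s <= 1 by apply: phi_le_1; rewrite s0.
  have : 0 <= C * (1 - s) by rewrite mulr_ge0 ?(ltW C0) ?(ltW s1').
  have : 0 <= a * (1 - s) by rewrite mulr_ge0 ?(ltW a0) ?(ltW s1').
  lra.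
have : flux s <= a * 2 * s.
  suff : flux s - flux 0 <= a * 2 * s - a * 2 * 0 by rewrite flux0 mulr0 !subr0.
  apply: (@le_of_derivs _ flux (fun x => a * 2 * x)
    (fun x => l * phi x * weight x) (fun x => a * 2) 0 s (ltW s0)).
  - move=> x /andP[x0 xs]; apply: (is_derive_flux sub).
    by rewrite x0 (le_lt_trans xs).
  - by move=> x _; apply: (der_eq (derZ (a * 2) (der_id x))); rewrite mulr1.
  - move=> x /andP[x0 xs]; have x01 : 0 < x < 1 by rewrite x0 (lt_trans xs).
    apply: le_trans (eigen_weight_le x01 (phi_le_1 x01)) _.
    rewrite ler_wpM2l ?(ltW a0)// div1r -[2]invrK lef_pV2 ?posrE ?invr_gt0 ?subr_gt0//; lra.
have : 0 <= C * s by rewrite mulr_ge0 ?(ltW C0) ?(ltW s0).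
lra.
Qed.

End principal_bounds.

(** * The weighted Hardy inequality *)

Section hardy.
Context {R : realType}.
Variables (b : nat -> R) (m l : R).
Hypothesis sub : subcritical b m.
Hypothesis pl : principal b l.
Implicit Types (s t x : R).

Local Notation phi := (phi b l).
Local Notation flux := (flux b l).
Local Notation W := (W b).
Local Notation weight := (weight b).

(** The Riccati variable [flux / phi] of the eigenfunction stays below
    [1 / (2 L)], where [L = - ln s]: at a first crossing the integrated Riccati
    equation gives a value at most [(l D + 1/4) / L]. *)
Lemma riccati_barrier (D : R) : (forall s, 0 < s < 1 -> - ln s * W s <= D) ->
  4 * l * D < 1 -> forall s, 0 < s < 1 -> 2 * (flux s * - ln s) < phi s.
Proof.
move=> HD lD; have l0 := principal_gt0 pl.
have L0 s : 0 < s < 1 -> 0 < - ln s by move=> s01; rewrite oppr_gt0 ln_lt0.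
have w0 s : 0 < s < 1 -> 0 < W s by move=> s01; exact: (W_gt0 sub).
have ph0 x : 0 < x < 1 -> 0 < phi x by move=> x01; exact: (phi_gt0 pl).
have fl0 x : 0 < x < 1 -> 0 <= flux x.
  by move=> /andP[x0 x1]; apply: (flux_nneg sub pl); rewrite ltW.
pose h s := phi s - 2 * (flux s * - ln s).
have dh s : 0 < s < 1 -> {for s, continuous h}.
  move=> s01; have /andP[s0 s1] := s01.
  have s01' : 0 <= s < 1 by rewrite ltW.
  apply: der_continuous; apply: derB.
    exact: (is_derive_phi_flux sub l s01).
  apply: derZ; apply: derM; first exact: (is_derive_flux sub l s01').
  by apply: derN; exact: is_derive1_ln.
have fW s : 0 < s < 1 -> flux s <= l * W s.
  move=> /andP[s0 s1].
  suff : flux s - flux 0 <= l * W s - l * W 0 by rewrite flux0 W0 mulr0 !subr0.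
  apply: (@le_of_derivs _ flux (fun x => l * W x) (fun x => l * phi x * weight x)
    (fun x => l * weight x) 0 s (ltW s0)).
  - move=> x /andP[x0 xs]; apply: (is_derive_flux sub).
    by rewrite x0 (le_lt_trans xs).
  - move=> x /andP[x0 xs]; apply/derZ/(is_derive_W sub).
    by rewrite x0 (le_lt_trans xs).
  - move=> x /andP[x0 xs]; have x01 : 0 < x < 1 by rewrite x0 (lt_trans xs).
    rewrite ler_wpM2r//; first by apply/ltW/(weight_gt0 sub); case/andP: x01 => /ltW -> ->.
    rewrite -[leRHS]mulr1 ler_wpM2l ?(ltW l0)//; exact: (phi_le_1 sub pl).
have [d d0 Hd] : exists2 d, 0 < d & forall s, 0 < s < 1 -> s < d -> 2^-1 < phi s.
  have c : {for 0, continuous phi}.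
    by apply: der_continuous; apply: (is_derive_phi sub); rewrite normr0.
  have /cvgrPdist_lt/(_ 2^-1) : phi x @[x --> 0] --> phi 0 by exact: c.
  rewrite phi0 invr_gt0 ltr0n => /(_ isT)/nbhs_ballP[d /= d0 Hd].
  exists d => // s /andP[s0 s1] sd; have := Hd s.
  rewrite /ball/= sub0r normrN ger0_norm ?(ltW s0)// => /(_ sd).
  by have := ler_norm (1 - phi s); lra.
have hd s : 0 < s < 1 -> s < d -> 0 < h s.
  move=> s01 sd; rewrite /h subr_gt0; apply: le_lt_trans (Hd s s01 sd).
  have h1 : flux s * - ln s <= l * W s * - ln s by rewrite ler_wpM2r ?fW ?(ltW (L0 _ _)).
  have h2 : l * (- ln s * W s) <= l * D by rewrite ler_wpM2l ?HD ?(ltW l0).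
  lra.
move=> s s01; rewrite -subr_gt0 -/(h s) ltNge; apply/negP => hs.
pose E := [set t | 0 < t < 1 /\ h t <= 0].
have Es : E s by [].
have lbE : has_lbound E by exists 0 => t [/andP[/ltW]].
have hiE : has_inf E by split; [exists s|].
pose s1 := inf E.
have s1s : s1 <= s := ge_inf lbE Es.
have ds1 : d <= s1.
  apply: lb_le_inf; first by exists s.
  by move=> t [t01 ht]; rewrite leNgt; apply/negP => /(hd t t01); lra.
have s101 : 0 < s1 < 1.
  by case/andP: s01 => _ s01; rewrite (lt_le_trans d0)// (le_lt_trans s1s).
have hlt x : 0 < x < s1 -> 0 < h x.
  move=> /andP[x0 x1]; rewrite ltNge; apply/negP => hx.
  have xE : E x by split => //; rewrite x0 (lt_trans x1)//; case/andP: s101.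
  by have := ge_inf lbE xE; rewrite -/s1 leNgt x1.
have hs1 : h s1 <= 0.
  rewrite leNgt; apply/negP => hpos.
  have /cvgrPdist_lt/(_ _ hpos)/nbhs_ballP[e /= e0 He] : h x @[x --> s1] --> h s1 by exact: dh.
  have [t Et te] := inf_adherent e0 hiE; have st := ge_inf lbE Et.
  have := He t; rewrite /ball/= distrC ger0_norm ?subr_ge0// => HH.
  have {}HH := HH _; rewrite -/s1 in te st; have := ler_norm (h s1 - h t).
  have : t - s1 < e by lra.
  move=> /HH; case: Et => _; lra.
pose k x := flux x / phi x - l * W x - 4^-1 * (- ln x)^-1.
pose dk x := (flux x / phi x) ^+ 2 / x - 4^-1 * (x * (- ln x) ^+ 2)^-1.
have kdec x : 0 < x -> x <= s1 -> k s1 <= k x.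
  move=> x0 xs1; rewrite -lerN2.
  apply: (@le_of_deriv_ge0 _ (fun x => - k x) (fun x => - dk x) x s1 xs1).
  - move=> y /andP[xy ys]; have y0 : 0 < y by exact: lt_le_trans xy.
    have y01 : 0 < y < 1 by rewrite y0 (le_lt_trans ys)//; case/andP: s101.
    have y01' : 0 <= y < 1 by case/andP: y01 => /ltW -> ->.
    have py := ph0 y y01; have ly := L0 y y01.
    apply: derN.
    apply: (der_eq (derB (derB (derM (is_derive_flux sub l y01')
      (derV (is_derive_phi_flux sub l y01) (lt0r_neq0 py)))
      (derZ l (is_derive_W sub y01')))
      (derZ 4^-1 (derV (derN (is_derive1_ln y0)) (lt0r_neq0 ly))))).
    rewrite /dk; move: (flux y) (phi y) (weight y) (ln y) py ly => A P w Ln py ly.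
    by field; move: ly; rewrite oppr_gt0 => ly; rewrite ?(lt_eqF ly) ?gt_eqF.
  - move=> y /andP[xy ys]; have y0 : 0 < y by exact: lt_trans xy.
    have y01 : 0 < y < 1 by rewrite y0 (lt_trans ys)//; case/andP: s101.
    have py := ph0 y y01; have ly := L0 y y01; have fy := fl0 y y01.
    have hy : 0 < h y by apply: hlt; rewrite y0.
    rewrite oppr_ge0 /dk subr_le0.
    have -> : 4^-1 * (y * (- ln y) ^+ 2)^-1 = ((2 * - ln y)^-1) ^+ 2 / y.
      by field; rewrite gt_eqF//=; move: ly; rewrite oppr_gt0 => /lt_eqF ->.
    rewrite ler_pM2r ?invr_gt0//; apply: lerXn2r; rewrite ?nnegrE.
    + by rewrite divr_ge0 ?(ltW py).
    + by rewrite invr_ge0 mulr_ge0 ?(ltW ly).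
    + rewrite ler_pdivrMr// mulrC ler_pdivlMr ?mulr_gt0//.
      by move: hy; rewrite /h; lra.
have [s10 s11] := andP s101.
have k0 : k s1 <= 0.
  have [C C0 HC] := principal_bounds sub pl.
  rewrite leNgt; apply/negP => kp.
  pose x := Num.min (Num.min s1 (d / 2)) (k s1 / (4 * C)).
  have x0 : 0 < x by rewrite !lt_min s10 !divr_gt0// mulr_gt0.
  have xs1 : x <= s1 by rewrite /x !ge_min lexx.
  have xd : x < d.
    apply: (@le_lt_trans _ _ (d / 2)); first by rewrite /x !ge_min lexx orbT.
    by rewrite ltr_pdivrMr// ltr_pMr// ltr1n.
  have xk : x <= k s1 / (4 * C) by rewrite /x !ge_min lexx orbT.
  have x01 : 0 < x < 1 by rewrite x0 (le_lt_trans xs1).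
  have px := Hd x x01 xd.
  have [_ fx] := HC x x01.
  have kx : k x = flux x / phi x - l * W x - 4^-1 * (- ln x)^-1 by [].
  have H := kdec x x0 xs1; rewrite kx in H.
  have : flux x / phi x <= 2 * (C * x).
    rewrite ler_pdivrMr ?ph0//; apply: le_trans fx _.
    have : 0 < C * x by rewrite mulr_gt0.
    have : C * x * 2^-1 <= C * x * phi x.
      by rewrite ler_wpM2l ?mulr_ge0 ?(ltW C0) ?(ltW x0)// ltW.
    lra.
  have : C * x <= k s1 / 4.
    by move: xk; rewrite ler_pdivlMr ?mulr_gt0//; lra.
  have : 0 <= l * W x by rewrite mulr_ge0 ?(ltW l0) ?(ltW (w0 _ _)).
  have : 0 <= (- ln x)^-1 by rewrite invr_ge0 ltW// L0.
  move: H kp; move: (flux x / phi x) (l * W x) ((- ln x)^-1) (C * x) (k s1).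
  by move=> p q r u v; lra.
have ls := L0 s1 s101; have ps1 := ph0 s1 s101.
have : flux s1 / phi s1 * - ln s1 <= l * (- ln s1 * W s1) + 4^-1.
  have -> : l * (- ln s1 * W s1) + 4^-1 = (l * W s1 + 4^-1 * (- ln s1)^-1) * - ln s1.
    by field; move: ls; rewrite oppr_gt0 => /lt_eqF ->.
  by rewrite ler_pM2r//; move: k0; rewrite /k; lra.
have : l * (- ln s1 * W s1) <= l * D by rewrite ler_wpM2l ?HD ?(ltW l0).
have : 2^-1 <= flux s1 / phi s1 * - ln s1.
  by rewrite mulrAC ler_pdivlMr//; move: hs1; rewrite /h; lra.
lra.
Qed.

(** Otherwise [phi ^ 2 / L] would increase, while [phi] is at most of the order
    of [L] near [1]. *)
Lemma hardy_lower (D : R) : (forall s, 0 < s < 1 -> - ln s * W s <= D) ->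
  1 <= 4 * l * D.
Proof.
move=> HD; rewrite leNgt; apply/negP => lD.
have bar := riccati_barrier HD lD.
have L0 s : 0 < s < 1 -> 0 < - ln s by move=> s01; rewrite oppr_gt0 ln_lt0.
have ph0 x : 0 < x < 1 -> 0 < phi x by move=> x01; exact: (phi_gt0 pl).
have [C C0 HC] := principal_bounds sub pl.
have h2 : 0 < (2^-1 : R) < 1 by apply/andP; split; lra.
pose K := phi 2^-1 ^+ 2 / - ln 2^-1.
have K0 : 0 < K by rewrite divr_gt0 ?exprn_gt0 ?ph0 ?L0.
have : K / C <= 0.
  apply: (phi_vanish sub pl h2) => t /andP[t2 t1].
  have t01 : 0 < t < 1 by rewrite t1 andbT; lra.
  have pt := ph0 t t01; have lt0 := L0 t t01.
  rewrite ler_pdivrMr//.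
  have Kt : K <= phi t ^+ 2 / - ln t.
    apply: (@le_of_deriv_ge0 _ (fun x => phi x ^+ 2 / - ln x)
      (fun x => phi x * (phi x - 2 * (flux x * - ln x)) / (x * (- ln x) ^+ 2)) 2^-1 t t2).
    - move=> x /andP[x2 xt]; have x0 : 0 < x by lra.
      have x01 : 0 < x < 1 by rewrite x0 (le_lt_trans xt).
      have dp := is_derive_phi_flux sub l x01; have lx := L0 x x01.
      apply: (der_eq (derM (derM dp dp) (derV (derN (is_derive1_ln x0)) (lt0r_neq0 lx)))).
      move: (flux x) (phi x) (ln x) lx => A P Ln ly.
      by field; move: ly; rewrite oppr_gt0 => ly; rewrite ?(lt_eqF ly) ?gt_eqF.
    - move=> x /andP[x2 xt]; have x0 : 0 < x by lra.
      have x01 : 0 < x < 1 by rewrite x0 (lt_trans xt).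
      apply: divr_ge0; last by rewrite mulr_ge0 ?exprn_ge0 ?(ltW x0) ?(ltW (L0 x x01)).
      by apply: mulr_ge0; [exact/ltW/ph0|rewrite subr_ge0; exact/ltW/bar].
  apply: le_trans Kt _; rewrite ler_pdivrMr// expr2 -mulrA ler_pM2l//.
  have [pC _] := HC t t01; apply: le_trans pC _; rewrite ler_pM2l//.
  have := @le_ln1Dx R (t - 1); rewrite addrCA subrr addr0 => h.
  have : ln t <= t - 1 by apply: h; lra.
  lra.
by rewrite leNgt divr_gt0.
Qed.

End hardy.

Section Dsq_bounds.
Context {R : realType}.
Variables (b : nat -> R) (m l : R).
Hypothesis sub : subcritical b m.
Hypothesis pl : principal b l.
Implicit Types (s t x : R).

Local Notation leb := (@lebesgue_measure R).

Lemma weight_continuous s : 0 <= s < 1 -> {for s, continuous (weight b)}.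
Proof.
move=> s01; have /andP[s0 s1] := s01.
apply: cvgV; first by apply: lt0r_neq0; exact: (Bgen_gt0 sub).
by apply: (ps_continuous (rad1_b sub)); rewrite ger0_norm.
Qed.

Lemma within_itv_continuous (f : R -> R) (a c : R) :
  (forall x, a <= x <= c -> {for x, continuous f}) -> {within `[a, c], continuous f}.
Proof.
move=> h; apply: continuous_in_subspaceT => x; rewrite inE/= in_itv/= => xac.
exact: h.
Qed.

Lemma FTC2_closed (f F : R -> R) (a c : R) : a < c ->
  (forall x, a <= x <= c -> {for x, continuous f}) ->
  (forall x, a <= x <= c -> is_derive x 1 F (f x)) ->
  (\int[leb]_(x in `[a, c]) (f x)%:E = (F c - F a)%:E)%E.
Proof.
move=> ac cf dF; rewrite (@continuous_FTC2 _ f F a c)//.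
- exact: within_itv_continuous.
- split.
  + move=> x; rewrite in_itv/= => /andP[ax xc].
    by have [] := dF x _; rewrite ?ltW// (ltW ax) ltW.
  + apply: cvg_at_right_filter; apply: der_continuous (dF a _).
    by rewrite lexx ltW.
  + apply: cvg_at_left_filter; apply: der_continuous (dF c _).
    by rewrite lexx ltW.
- move=> x; rewrite in_itv/= => /andP[ax xc].
  by apply: der_derive1; apply: dF; rewrite !ltW.
Qed.

Lemma integral_weight s : 0 < s < 1 ->
  (\int[leb]_(r in `]0%R, s[) ((Bgen b r)^-1)%:E = (W b s)%:E)%E.
Proof.
move=> /andP[s0 s1].
have cw x : 0 <= x <= s -> {for x, continuous (weight b)}.
  by move=> /andP[x0 xs]; apply: weight_continuous; rewrite x0 (le_lt_trans xs).
have mw : measurable_fun (`[0, s] : set R) (weight b).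
  apply: measurable_realfun.subspace_continuous_measurable_fun => //.
  exact: within_itv_continuous.
rewrite integral_itv_bndo_bndc; last first.
  by apply/measurable_EFinP; apply: measurable_funS mw => //; exact: subset_itv_oo_cc.
rewrite integral_itv_obnd_cbnd; last first.
  by apply/measurable_EFinP; apply: measurable_funS mw => //; exact: subset_itv_oc_cc.
have dW x : 0 <= x <= s -> is_derive x 1 (W b) (weight b x).
  by move=> /andP[x0 xs]; apply: (is_derive_W sub); rewrite x0 (le_lt_trans xs).
by have := FTC2_closed s0 cw dW; rewrite W0 subr0.
Qed.

(** [Dsq] is the supremum of [- ln s W(s)], as [W] integrates [1 / B]. *)
Lemma Dsq_bounds :
  ((4%:R%:E * Dsq b)^-1 <= l%:E)%E /\ (l%:E <= (Dsq b)^-1)%E.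
Proof.
have l0 := principal_gt0 pl.
have HD s : 0 < s < 1 -> ((- ln s)%:E * \int[leb]_(r in `]0%R, s[) ((Bgen b r)^-1)%:E =
    (- ln s * W b s)%:E)%E.
  by move=> s01; rewrite integral_weight.
have ub : (Dsq b <= (l^-1)%:E)%E.
  apply: ge_ereal_sup => y [s]; rewrite /J/= in_itv/= => s01 <-{y}.
  rewrite HD// lee_fin -[leRHS]mul1r ler_pdivlMr// mulrC.
  by apply: (eigen_le sub (ltW l0) s01) => x; exact: (phi_gt0 pl).
have lb s : 0 < s < 1 -> ((- ln s * W b s)%:E <= Dsq b)%E.
  by move=> s01; apply: ereal_sup_ubound; exists s; rewrite ?HD// /J/= in_itv.
have h2 : 0 < (2^-1 : R) < 1 by apply/andP; split; lra.
have D0 : (0 < Dsq b)%E.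
  apply: lt_le_trans (lb _ h2); rewrite lte_fin mulr_gt0 ?(W_gt0 sub)//.
  by rewrite oppr_gt0 ln_lt0.
have Dfin : Dsq b \is a fin_num.
  by rewrite ge0_fin_numE ?(ltW D0)//; apply: le_lt_trans ub _; exact: ltry.
move: ub lb D0; rewrite -(fineK Dfin); move: (fine _) => D; rewrite lee_fin => ub lb.
rewrite lte_fin => D0; rewrite -EFinM !inver !gt_eqF ?mulr_gt0// !lee_fin; split.
  have : 1 <= 4 * l * D by apply: (hardy_lower sub pl) => s s01; rewrite -lee_fin lb.
  move=> h; rewrite -[leLHS]mul1r ler_pdivrMr ?mulr_gt0//; lra.
by rewrite -[l]invrK lef_pV2 ?posrE ?invr_gt0.
Qed.

End Dsq_bounds.

(** * A right eigenvector of the transition rates *)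

Section moments.
Context {R : realType}.
Implicit Types (s t x : R).

Local Notation leb := (@lebesgue_measure R).

Definition cut n : R := 1 - n.+2%:R^-1.

Lemma cut_itv n : 0 < cut n < 1.
Proof.
rewrite subr_gt0 gtrBl invr_gt0 ltr0n andbT.
by rewrite -[ltRHS]invr1 ltf_pV2 ?posrE ?ltr0n ?ltr01// ltr1n.
Qed.

Lemma cut_le n p : (n <= p)%N -> cut n <= cut p.
Proof.
by move=> np; rewrite lerD2l lerN2 lef_pV2 ?posrE ?ltr0n// ler_nat.
Qed.

Lemma cut_cvg : (fun n => 1 - cut n) @ \oo --> (0 : R).
Proof.
rewrite (_ : (fun n => 1 - cut n) = (fun n => n.+2%:R^-1)); last first.
  by apply/funext => n; rewrite /cut opprB addrC subrK.
rewrite (_ : (fun n => n.+2%:R^-1) = (fun n => harmonic (n + 1)%N)); last first.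
  by apply/funext => n; rewrite /harmonic/= addn1.
by rewrite (cvg_shiftn 1 (@harmonic R)); exact: cvg_harmonic.
Qed.

Lemma measurable_continuous_co (f : R -> R) (D : set R) : measurable D ->
  (forall x, D x -> {for x, continuous f}) -> measurable_fun D f.
Proof.
move=> mD cf; apply: measurable_realfun.subspace_continuous_measurable_fun => //.
by apply: continuous_in_subspaceT => x; rewrite inE; exact: cf.
Qed.

Lemma J_integral_cvg (f : R -> R) :
  (forall x, 0 <= x < 1 -> {for x, continuous f}) ->
  (forall x, 0 <= x < 1 -> 0 <= f x) ->
  (\int[leb]_(x in `[0%R, cut n]) (f x)%:E)%E @[n --> \oo] -->
    (\int[leb]_(x in @J R) (f x)%:E)%E.
Proof.
move=> cf f0.
have sub01 n : `[0, cut n]%classic `<=` `[0, 1[%classic.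
  move=> x /=; rewrite !in_itv/= => /andP[-> /le_lt_trans->//].
  by have /andP[] := cut_itv n.
have mf : measurable_fun (`[0, 1[%classic : set R) f.
  by apply: measurable_continuous_co => // x; rewrite /= in_itv; exact: cf.
have -> : (\int[leb]_(x in @J R) (f x)%:E = \int[leb]_(x in \bigcup_n `[0%R, cut n]%classic) (f x)%:E)%E.
  rewrite /J integral_itv_obnd_cbnd; last first.
    by apply/measurable_EFinP; apply: measurable_funS mf => // x /=; rewrite !in_itv/= => /andP[/ltW -> ->].
  congr (integral _ _ _); apply/seteqP; split => [x /=|x [n _]/sub01//].
  rewrite in_itv/= => /andP[x0 x1].
  have /cvgrPdist_lt/(_ (1 - x)) := cut_cvg; rewrite subr_gt0 => /(_ x1)[N _ HN].
  exists N => //=; rewrite in_itv/= x0/=; have := HN N (leqnn _).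
  rewrite /= sub0r normrN ger0_norm; first lra.
  by have /andP[_ /ltW] := cut_itv N; rewrite subr_ge0.
apply: ge0_nondecreasing_set_cvg_integral.
- move=> n p np; apply/subsetPset => x /=; rewrite !in_itv/= => /andP[-> /le_trans->//].
  exact: cut_le.
- by move=> n.
- by move=> n; apply/measurable_EFinP; exact: measurable_funS mf.
- by move=> n x /sub01/=; rewrite in_itv/= lee_fin; exact: f0.
Qed.

Variables (b : nat -> R) (m l : R).
Hypothesis sub : subcritical b m.
Hypothesis pl : principal b l.

Local Notation phi := (phi b l).
Local Notation flux := (flux b l).
Local Notation weight := (weight b).

Lemma phi_nneg s : 0 <= s < 1 -> 0 <= phi s.
Proof.
move=> /andP[]; rewrite le_eqVlt => /predU1P[<-|s0] s1; first by rewrite phi0.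
by apply: (phi_ge0 pl); rewrite s0.
Qed.

Lemma phi_cont s : 0 <= s < 1 -> {for s, continuous phi}.
Proof.
move=> /andP[s0 s1]; apply: der_continuous; apply: (is_derive_phi sub).
by rewrite ger0_norm.
Qed.

Lemma is_deriveX n s : is_derive s 1 (fun x : R => x ^+ n) (n%:R * s ^+ n.-1).
Proof.
elim: n => [|n ih]; first by rewrite mul0r; exact: der_cst.
rewrite (_ : (fun x => x ^+ n.+1) = (fun x => x * x ^+ n)); last first.
  by apply/funext => x; rewrite exprS.
apply: (der_eq (derM (der_id s) ih)); rewrite mul1r -natr1/=.
by case: n ih => [|n] ih; rewrite ?expr0 /= ?exprS; ring.
Qed.

Definition mom_weight (i : nat) s := (1 - s ^+ i) * (l * phi s * weight s).
Definition mom_phi (i : nat) s := s ^+ i.-1 * phi s.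

Lemma exprn_cont n s : {for s, continuous (fun x : R => x ^+ n)}.
Proof. exact: der_continuous (is_deriveX n s). Qed.

Lemma mom_phi_cont i s : 0 <= s < 1 -> {for s, continuous (mom_phi i)}.
Proof. by move=> s01; apply: cvgM; [exact: exprn_cont|exact: phi_cont]. Qed.

Lemma mom_weight_cont i s : 0 <= s < 1 -> {for s, continuous (mom_weight i)}.
Proof.
move=> s01; apply: cvgM; first by apply: cvgB; [exact: cvg_cst|exact: exprn_cont].
apply: cvgM; last exact: (weight_continuous sub).
by apply: cvgM; [exact: cvg_cst|exact: phi_cont].
Qed.

Lemma mom_phi_ge0 i s : 0 <= s < 1 -> 0 <= mom_phi i s.
Proof.
by move=> s01; rewrite mulr_ge0 ?phi_nneg// exprn_ge0//; case/andP: s01.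
Qed.

Lemma mom_weight_ge0 i s : 0 <= s < 1 -> 0 <= mom_weight i s.
Proof.
move=> s01; have /andP[s0 s1] := s01.
apply: mulr_ge0; first by rewrite subr_ge0 exprn_ile1// ltW.
apply: mulr_ge0; first by rewrite mulr_ge0 ?phi_nneg// ltW// (principal_gt0 pl).
exact/ltW/(weight_gt0 sub).
Qed.

Lemma bernoulli_le i s : 0 <= s <= 1 -> 1 - s ^+ i <= i%:R * (1 - s).
Proof.
move=> /andP[s0 s1]; elim: i => [|i ih]; first by rewrite expr0 subrr mul0r.
rewrite exprS -natr1.
have : s * (1 - s ^+ i) <= 1 - s ^+ i.
  by rewrite ler_piMl// subr_ge0 exprn_ile1.
lra.
Qed.

Lemma measurable_J_of_cont (f : R -> R) :
  (forall x, 0 <= x < 1 -> {for x, continuous f}) -> measurable_fun (@J R) f.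
Proof.
move=> cf; apply: measurable_continuous_co; first exact: measurable_itv.
by move=> x; rewrite /J/= in_itv/= => /andP[x0 x1]; apply: cf; rewrite ltW.
Qed.

Lemma measurable_J : measurable (@J R : set (measurableTypeR R)).
Proof. exact: (measurable_itv `]0, 1[). Qed.

Lemma lebesgue_J : leb (@J R) = 1%:E.
Proof.
have := lebesgue_measure_itv (`]0, 1[ : interval R).
by rewrite /= lte_fin ltr01 -EFinB subr0.
Qed.

Lemma emeasurable_J (f : R -> R) : (forall x, 0 <= x < 1 -> {for x, continuous f}) ->
  measurable_fun (@J R : set (measurableTypeR R)) (EFin \o f).
Proof.
move=> cf; have mf := measurable_J_of_cont cf.
have : measurable_fun (@J R : set (measurableTypeR R)) f by exact: mf.
by move=> h; apply/measurable_EFinP.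
Qed.

Lemma J_itv x : @J R x -> 0 < x < 1.
Proof. by rewrite /J/= in_itv. Qed.

Lemma J_itvW x : @J R x -> 0 <= x < 1.
Proof. by move=> /J_itv/andP[/ltW -> ->]. Qed.

Lemma mom_phi_fin i :
  (\int[leb]_(s in @J R) (mom_phi i s)%:E)%E \is a fin_num.
Proof.
rewrite ge0_fin_numE; last first.
  by apply: integral_ge0 => x /J_itvW Jx; rewrite lee_fin mom_phi_ge0.
apply: (@le_lt_trans _ _ (\int[leb]_(s in @J R) (cst 1%:E s))%E).
  apply: ge0_le_integral => //.
  - exact: measurable_J.
  - by move=> x /J_itvW Jx; rewrite lee_fin mom_phi_ge0.
  - by apply: emeasurable_J => x; exact: mom_phi_cont.
  - move=> x Jx; rewrite lee_fin /mom_phi mulr_ile1//.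
    + by apply: exprn_ge0; case/andP: (J_itvW Jx).
    + exact: phi_nneg (J_itvW Jx).
    + by case/andP: (J_itvW Jx) => x0 /ltW x1; rewrite exprn_ile1.
    + exact: (phi_le_1 sub pl (J_itv Jx)).
rewrite integral_cst; last exact: measurable_J.
rewrite mul1e; apply: (@le_lt_trans _ _ 1%:E); last exact: ltry.
by rewrite le_eqVlt; apply/orP; left; apply/eqP; exact: lebesgue_J.
Qed.

(** Green's formula for [1 - s ^ i] and [phi] on [0, 1]. *)
Lemma mom_green i : (0 < i)%N ->
  (\int[leb]_(s in @J R) (mom_weight i s)%:E =
   (i%:R ^+ 2)%:E * \int[leb]_(s in @J R) (mom_phi i s)%:E)%E.
Proof.
move=> i0.
pose F s := (1 - s ^+ i) * flux s - i%:R * (s ^+ i * phi s).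
have dF s : 0 <= s < 1 -> is_derive s 1 F (mom_weight i s - i%:R ^+ 2 * mom_phi i s).
  move=> s01; have /andP[s0 s1] := s01; have x1 : `|s| < 1 by rewrite ger0_norm.
  apply: (der_eq (derB (derM (derB (der_cst 1 s) (is_deriveX i s)) (is_derive_flux sub l s01))
     (derZ i%:R (derM (is_deriveX i s) (is_derive_phi sub l x1))))).
  rewrite (fluxE sub)// /mom_weight /mom_phi.
  by case: i i0 {F} => // i _ /=; rewrite exprS; ring.
have f0 : F 0 = 0 by rewrite /F flux0 expr0n gtn_eqF//= mul0r !mulr0 subrr.
have eqn n : (\int[leb]_(s in `[0%R, cut n]) (mom_weight i s)%:E =
    (i%:R ^+ 2)%:E * \int[leb]_(s in `[0%R, cut n]) (mom_phi i s)%:E + (F (cut n))%:E)%E.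
  have /andP[c0 c1] := cut_itv n.
  have c01 x : 0 <= x <= cut n -> 0 <= x < 1.
    by move=> /andP[-> /le_lt_trans->].
  have cont (f : R -> R) : (forall x, 0 <= x < 1 -> {for x, continuous f}) ->
      leb.-integrable `[0%R, cut n] (EFin \o f).
    move=> cf; apply: continuous_compact_integrable; first exact: segment_compact.
    by apply: within_itv_continuous => x /c01; exact: cf.
  have cw := cont _ (@mom_weight_cont i); have cp := cont _ (@mom_phi_cont i).
  have hc x : 0 <= x <= cut n -> {for x, continuous (fun s => mom_weight i s - i%:R ^+ 2 * mom_phi i s)}.
    move=> /c01 x01; apply: cvgB; first exact: mom_weight_cont.
    by apply: cvgM; [exact: cvg_cst|exact: mom_phi_cont].
  have hd x : 0 <= x <= cut n -> is_derive x 1 F (mom_weight i x - i%:R ^+ 2 * mom_phi i x).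
    by move=> /c01; exact: dF.
  have E := FTC2_closed c0 hc hd; rewrite f0 subr0 in E; rewrite -{}E.
  have mI : measurable (`[0, cut n]%classic : set (measurableTypeR R)).
    exact: (measurable_itv `[0, cut n]).
  have -> : (\int[leb]_(x in `[0%R, cut n]) (mom_weight i x - i%:R ^+ 2 * mom_phi i x)%:E =
      \int[leb]_(x in `[0%R, cut n]) (mom_weight i x)%:E -
        (i%:R ^+ 2)%:E * \int[leb]_(x in `[0%R, cut n]) (mom_phi i x)%:E)%E.
    rewrite -integralZl// -integralB//; last by apply: integrableZl.
  rewrite [RHS]addeC subeK// fin_numM//; apply: integrable_fin_num => //; exact: cp.
have cw := J_integral_cvg (@mom_weight_cont i) (@mom_weight_ge0 i).
have cp := J_integral_cvg (@mom_phi_cont i) (@mom_phi_ge0 i).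
have cF : (F (cut n))%:E @[n --> \oo] --> 0%:E.
  apply: cvg_EFin; first exact: nearW.
  have [C C0 HC] := principal_bounds sub pl.
  apply/norm_cvg0P.
  apply: (squeeze_cvgr (f := fun=> 0) (h := fun n => (2 * i%:R * C) * (1 - cut n))).
  - apply: nearW => n; rewrite normr_ge0/=.
    have c01 := cut_itv n; have /andP[c0 c1] := c01.
    have [h1 h2] := HC _ c01.
    have hb := @bernoulli_le i (cut n); rewrite (ltW c0) (ltW c1) in hb.
    have {}hb := hb isT.
    have v0 : 0 <= flux (cut n) by apply: (flux_nneg sub pl); rewrite ltW.
    have p0 := ltW (phi_gt0 pl c01).
    have e0 : 0 <= 1 - cut n ^+ i by rewrite subr_ge0 exprn_ile1 ?ltW.
    have e1 : cut n ^+ i <= 1 by rewrite exprn_ile1 ?ltW.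
    apply: le_trans (ler_normB _ _) _.
    rewrite !normrM !ger0_norm ?ler0n ?exprn_ge0 ?(ltW c0)//.
    have h3 : (1 - cut n ^+ i) * flux (cut n) <= i%:R * (1 - cut n) * C.
      apply: ler_pM => //; apply: le_trans h2 _.
      by rewrite ler_piMr ?(ltW C0) ?(ltW c1).
    have h4 : i%:R * (cut n ^+ i * phi (cut n)) <= i%:R * (1 * (C * (1 - cut n))).
      by rewrite ler_wpM2l// ler_pM// exprn_ge0// ltW.
    lra.
  - exact: cvg_cst.
  - have -> : 0 = 2 * i%:R * C * 0 :> R by rewrite mulr0.
    by apply: cvgMl_tmp; exact: cut_cvg.
rewrite (funext eqn) in cw.
have H : ((i%:R ^+ 2)%:E * \int[leb]_(s in `[0%R, cut n]) (mom_phi i s)%:E +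
    (F (cut n))%:E)%E @[n --> \oo] -->
    ((i%:R ^+ 2)%:E * \int[leb]_(s in @J R) (mom_phi i s)%:E + 0)%E.
  apply: cvgeD => //; first by rewrite fin_num_adde_defl.
  exact: cvgeZl.
by rewrite -[RHS]adde0; exact: (cvg_unique _ cw H).
Qed.

(** By [dvecE] this is the integral of [(1 - s^i) l phi w], the combination of the
    functions [1 - s^i] diagonalized by the transition rates; the present form
    shows that it is positive and bounded. *)
Definition dvec (i : nat) : R := i%:R ^+ 2 * fine (\int[leb]_(s in @J R) (mom_phi i s)%:E)%E.

Lemma dvec0 : dvec 0 = 0. Proof. by rewrite /dvec expr0n mul0r. Qed.

Lemma dvecE i : (dvec i)%:E = (\int[leb]_(s in @J R) (mom_weight i s)%:E)%E.
Proof.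
case: i => [|i].
  rewrite dvec0 integral0_eq// => x _.
  by rewrite /mom_weight expr0 subrr mul0r.
by rewrite mom_green// /dvec EFinM fineK// mom_phi_fin.
Qed.

Lemma dvec_gt0 i : (0 < i)%N -> 0 < dvec i.
Proof.
move=> i0; rewrite mulr_gt0 ?exprn_gt0 ?ltr0n// fine_gt0//.
have := mom_phi_fin i; rewrite fin_numElt => /andP[_ ->]; rewrite andbT.
pose k := 4^-1 ^+ i.-1 * phi 2^-1.
have h2 : 0 < (2^-1 : R) < 1 by apply/andP; split; lra.
have k0 : 0 < k by rewrite mulr_gt0 ?exprn_gt0 ?invr_gt0 ?(phi_gt0 pl).
pose I4 : set R := `[4^-1, 2^-1]%classic.
have mI : measurable (I4 : set (measurableTypeR R)).
  exact: (measurable_itv `[4^-1, 2^-1]).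
have IJ : I4 `<=` @J R.
  by move=> x; rewrite /I4 /J/= !in_itv/= => /andP[x4 x2]; apply/andP; split; lra.
have h4 : (4^-1 : R) < 2^-1 by lra.
have ck x : (4^-1 : R) <= x <= 2^-1 -> {for x, continuous (fun=> k)}.
  by move=> _; exact: cvg_cst.
have dk x : (4^-1 : R) <= x <= 2^-1 -> is_derive x 1 (fun y => k * y) k.
  by move=> _; apply: (der_eq (derZ k (der_id x))); rewrite mulr1.
apply: (@lt_le_trans _ _ (\int[leb]_(s in I4) k%:E)%E).
  have -> := FTC2_closed h4 ck dk; rewrite lte_fin; lra.
apply: (@le_trans _ _ (\int[leb]_(s in I4) (mom_phi i s)%:E)%E).
  apply: ge0_le_integral => //.
  - by move=> x _; rewrite lee_fin ltW.
  - apply: measurable_funS (emeasurable_J (@mom_phi_cont i)) => //; exact: measurable_J.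
  - move=> x xI; have Jx := IJ x xI; rewrite lee_fin /mom_phi.
    move: xI; rewrite /I4/= in_itv/= => /andP[x4 x2].
    apply: ler_pM; rewrite ?exprn_ge0 ?invr_ge0 ?(ltW (phi_gt0 pl h2))//.
      by apply: lerXn2r; rewrite ?nnegrE//; lra.
    by apply: (phi_nincr sub pl) => //; lra.
apply: ge0_subset_integral => //.
- exact: measurable_J.
- exact: (emeasurable_J (@mom_phi_cont i)).
- by move=> x /J_itvW Jx; rewrite lee_fin mom_phi_ge0.
Qed.

(** Since [phi <= C (1 - s)], the integral of [i^2 s^(i-1) phi] is at most that of a
    polynomial, namely [C i / (i + 1)]. *)
Lemma dvec_bounded : exists2 C : R, 0 < C & forall i, dvec i <= C.
Proof.
have [C C0 HC] := principal_bounds sub pl; exists C => // -[|i]; first by rewrite dvec0 ltW.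
pose f s : R := s ^+ i * (C * (1 - s)).
pose F s : R := C * (s ^+ i.+1 / i.+1%:R - s ^+ i.+2 / i.+2%:R).
have i1 : i.+1%:R != 0 :> R by rewrite pnatr_eq0.
have i2 : i.+2%:R != 0 :> R by rewrite pnatr_eq0.
have dF x : is_derive x 1 F (f x).
  apply: (der_eq (derZ C (derB (derM (is_deriveX i.+1 x) (der_cst (i.+1%:R^-1) x))
    (derM (is_deriveX i.+2 x) (der_cst (i.+2%:R^-1) x))))).
  rewrite /f !mulr0 !addr0 mulrAC divff// mulrAC divff// !mul1r /= exprS; ring.
have cf x : {for x, continuous f}.
  apply: cvgM; first exact: exprn_cont.
  by apply: cvgM; [exact: cvg_cst|apply: cvgB; [exact: cvg_cst|exact: cvg_id]].
have le : (\int[leb]_(s in @J R) (mom_phi i.+1 s)%:E <= (F 1 - F 0)%:E)%E.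
  rewrite -(@FTC2_closed _ f F 0 1)//.
  apply: (@le_trans _ _ (\int[leb]_(s in @J R) (f s)%:E)%E).
    apply: ge0_le_integral => //.
    - exact: measurable_J.
    - by move=> x /J_itvW Jx; rewrite lee_fin mom_phi_ge0.
    - exact: (emeasurable_J (@mom_phi_cont i.+1)).
    - by apply: emeasurable_J => x _; exact: cf.
    - move=> x Jx; rewrite lee_fin /mom_phi /f/=.
      have [h _] := HC x (J_itv Jx); apply: ler_wpM2l => //.
      by apply: exprn_ge0; case/andP: (J_itvW Jx).
  apply: ge0_subset_integral.
  - exact: measurable_J.
  - exact: (measurable_itv `[0, 1]).
  - apply/measurable_EFinP.
    have : measurable_fun (`[0, 1]%classic : set R) f.
      by apply: measurable_continuous_co => // x _; exact: cf.
    exact.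
  - move=> x /=; rewrite in_itv/= lee_fin /f => /andP[x0 x1].
    by rewrite mulr_ge0 ?exprn_ge0// mulr_ge0 ?subr_ge0// ltW.
  - by move=> x /J_itv/andP[x0 x1]; rewrite /= in_itv/= !ltW.
rewrite /dvec.
have : fine (\int[leb]_(s in @J R) (mom_phi i.+1 s)%:E)%E <= F 1 - F 0.
  by rewrite -lee_fin fineK// mom_phi_fin.
rewrite {2}/F !expr0n/= !mul0r subrr mulr0 subr0 /F !expr1n => h.
apply: (@le_trans _ _ (i.+1%:R ^+ 2 * (C * (1 / i.+1%:R - 1 / i.+2%:R)))).
  by rewrite ler_wpM2l ?exprn_ge0.
have -> : i.+1%:R ^+ 2 * (C * (1 / i.+1%:R - 1 / i.+2%:R)) = C * (i.+1%:R / i.+2%:R) :> R.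
  by rewrite -(natr1 i.+1); field; rewrite -?natr1 in i2 *; rewrite ?nat1r ?natr1 ?pnatr_eq0.
by rewrite ler_piMr ?(ltW C0)// ler_pdivrMr ?ltr0n// mul1r ler_nat.
Qed.

End moments.

Section invariant_vector.
Context {R : realType}.
Implicit Types (s t x : R).

Local Notation leb := (@lebesgue_measure R).

Variables (b : nat -> R) (m l : R).
Hypothesis sub : subcritical b m.
Hypothesis pl : principal b l.

Local Notation q := (qmat b).
Local Notation dvec := (dvec b l).

Lemma qmat_ge0 i k : k != i -> 0 <= q i k.
Proof.
move=> ki; rewrite /qmat; case: ifP => // ik; rewrite mulr_ge0//.
case: sub => [b0 _ _ _ _]; apply: b0.
by apply: contra ki => /eqP; lia.
Qed.

Lemma qmat_diag i : q i i = i%:R ^+ 2 * b 1%N.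
Proof. by rewrite /qmat leqnSn subSnn natrX. Qed.

Lemma qmat_sum_shift i N s :
  \sum_(0 <= k < N + i) q i.+1 k * s ^+ k =
  i.+1%:R ^+ 2 * (s ^+ i * \sum_(0 <= j < N) b j * s ^+ j).
Proof.
rewrite (@big_cat_nat _ _ _ i)//=; last exact: leq_addl.
rewrite big_nat big1 ?add0r; last first.
  by move=> k /andP[_ ki]; rewrite /qmat ltnS leqNgt ki mul0r.
rewrite -{1}[i]add0n big_addn addnK !big_distrr/=; apply: eq_bigr => k _.
rewrite /qmat ltnS leq_addl natrX exprD.
have -> : ((k + i).+1 - i.+1 = k)%N by lia.
ring.
Qed.

Lemma qmat_sum_cvg i s : 0 <= s < 1 ->
  (fun N => \sum_(0 <= k < N) q i.+1 k * (1 - s ^+ k)) @ \oo -->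
  - (i.+1%:R ^+ 2 * (s ^+ i * Bgen b s)).
Proof.
move=> /andP[s0 s1]; have x1 : `|s| < 1 by rewrite ger0_norm.
rewrite -(cvg_shiftn i).
rewrite (_ : (fun N => _) = (fun N => i.+1%:R ^+ 2 * (1 * series b N) -
    i.+1%:R ^+ 2 * (s ^+ i * series (fun j => b j * s ^+ j) N))); last first.
  apply/funext => N; rewrite -qmat_sum_shift.
  have := qmat_sum_shift i N 1; under eq_bigr do rewrite expr1n mulr1.
  rewrite expr1n; under [in RHS]eq_bigr do rewrite expr1n mulr1.
  rewrite /series/= => <-; rewrite -sumrB; apply: eq_bigr => k _; ring.
have := sub => -[_ _ bs _ _].
have H : i.+1%:R ^+ 2 * (1 * series b N) -
    i.+1%:R ^+ 2 * (s ^+ i * series (fun j => b j * s ^+ j) N) @[N --> \oo] -->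
    i.+1%:R ^+ 2 * (1 * 0) - i.+1%:R ^+ 2 * (s ^+ i * Bgen b s).
  apply: cvgB; do 2 apply: cvgMl_tmp; first exact: bs.
  exact: (ps_cvg (rad1_b sub)).
by rewrite !mulr0 sub0r in H.
Qed.

(** The transition rates send [k |-> 1 - s^k] to [i |-> - i^2 s^(i-1) B(s)], so the
    integral against [l phi / B] gives back [- l] times the vector. *)
Lemma dvec_invariant i : (0 < i)%N ->
  (\sum_(0 <= k <oo | k != i) (q i k * dvec k)%:E = ((- q i i - l) * dvec i)%:E)%E.
Proof.
case: i => // i _.
pose g k s := if k == i.+1 then 0 else q i.+1 k * mom_weight b l k s.
have g0 k s : 0 <= s < 1 -> 0 <= g k s.
  move=> s01; rewrite /g; case: ifPn => // ki.
  by rewrite mulr_ge0 ?qmat_ge0// (mom_weight_ge0 sub pl).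
have cg k s : 0 <= s < 1 -> {for s, continuous (g k)}.
  move=> s01; have [ki|ki] := eqVneq k i.+1.
    have -> : g k = fun=> 0 by apply/funext => y; rewrite /g ki eqxx.
    exact: cvg_cst.
  have -> : g k = fun y => q i.+1 k * mom_weight b l k y.
    by apply/funext => y; rewrite /g (negbTE ki).
  by apply: cvgM; [exact: cvg_cst|exact: (@mom_weight_cont _ _ _ l sub k s s01)].
have -> : (\sum_(0 <= k <oo | k != i.+1) (q i.+1 k * dvec k)%:E =
    \sum_(0 <= k <oo) \int[leb]_(s in @J R) (g k s)%:E)%E.
  apply: congr_lim; apply/funext => n; rewrite big_mkcond/=; apply: eq_bigr => k _.
  rewrite /g; case: eqP => [->|/eqP ki]/=.
    by rewrite integral0_eq.
  rewrite EFinM (dvecE sub pl) -ge0_integralZl_EFin ?qmat_ge0//.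
  - exact: measurable_J.
  - by move=> x /J_itvW Jx; rewrite lee_fin (mom_weight_ge0 sub pl).
  - exact: (emeasurable_J (@mom_weight_cont _ _ _ l sub k)).
rewrite -integral_nneseries; last 3 first.
- exact: measurable_J.
- by move=> k; exact: (emeasurable_J (cg k)).
- by move=> k x /J_itvW Jx; rewrite lee_fin g0.
have pt s : 0 <= s < 1 -> (\sum_(0 <= k <oo) (g k s)%:E =
    (- q i.+1 i.+1 * mom_weight b l i.+1 s - l * i.+1%:R ^+ 2 * mom_phi b l i.+1 s)%:E)%E.
  move=> s01; apply/cvg_lim => //.
  have c := @qmat_sum_cvg i s s01.
  pose y := l * phi b l s * weight b s.
  have {}c : (fun N => (\sum_(0 <= k < N) q i.+1 k * (1 - s ^+ k)) * y -
      q i.+1 i.+1 * mom_weight b l i.+1 s) @ \oo -->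
      - (i.+1%:R ^+ 2 * (s ^+ i * Bgen b s)) * y - q i.+1 i.+1 * mom_weight b l i.+1 s.
    by apply: cvgB; [exact: cvgMr_tmp|exact: cvg_cst].
  have -> : - q i.+1 i.+1 * mom_weight b l i.+1 s - l * i.+1%:R ^+ 2 * mom_phi b l i.+1 s =
     - (i.+1%:R ^+ 2 * (s ^+ i * Bgen b s)) * y - q i.+1 i.+1 * mom_weight b l i.+1 s.
    have B0 := Bgen_gt0 sub s01.
    by rewrite /y /weight /mom_phi/=; field; rewrite gt_eqF.
  apply: cvg_EFin; first by apply: nearW => n; rewrite sumEFin.
  move: c; apply: cvg_trans; apply: near_eq_cvg; near=> N; rewrite /= sumEFin/=.
  rewrite mulr_suml (bigD1_seq i.+1) ?iota_uniq//=; last first.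
    by rewrite mem_index_iota/=; near: N; exact: nbhs_infty_gt.
  rewrite [X in _ = X](bigD1_seq i.+1) ?iota_uniq//=; last first.
    by rewrite mem_index_iota/=; near: N; exact: nbhs_infty_gt.
  rewrite {1}/g eqxx add0r.
  rewrite /mom_weight -/y -mulrA addrAC subrr add0r; apply: eq_bigr => k ki.
  rewrite /g (negbTE ki) /mom_weight -/y. by rewrite -mulrA.
have iw : leb.-integrable (@J R) (EFin \o mom_weight b l i.+1).
  apply/integrableP; split; first exact: (emeasurable_J (@mom_weight_cont _ _ _ l sub i.+1)).
  under eq_integral => x /[!inE] /J_itvW Jx.
    rewrite gee0_abs ?lee_fin ?(mom_weight_ge0 sub pl)//. over.
  by rewrite -(dvecE sub pl) ltry.
have ip : leb.-integrable (@J R) (EFin \o mom_phi b l i.+1).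
  apply/integrableP; split; first exact: (emeasurable_J (@mom_phi_cont _ _ _ l sub i.+1)).
  under eq_integral => x /[!inE] /J_itvW Jx.
    rewrite gee0_abs ?lee_fin ?(mom_phi_ge0 pl)//. over.
  by have := mom_phi_fin sub pl i.+1; rewrite fin_numElt => /andP[].
transitivity (\int[leb]_(s in @J R) ((- q i.+1 i.+1)%:E * (mom_weight b l i.+1 s)%:E -
   (l * i.+1%:R ^+ 2)%:E * (mom_phi b l i.+1 s)%:E))%E.
  by apply: eq_integral => s /[!inE] /J_itvW Js; rewrite pt.
rewrite integralB//=; [|exact: measurable_J|by apply: integrableZl => //; exact: measurable_J|by apply: integrableZl => //; exact: measurable_J].
rewrite !integralZl//; try exact: measurable_J.
rewrite -(dvecE sub pl) /dvec -(fineK (mom_phi_fin sub pl i.+1)).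
by rewrite -!EFinM -EFinB; congr (_%:E) ; ring.
Unshelve. all: by end_near. Qed.

End invariant_vector.

(** * Upper bound for the transition function *)

Section unmeasured_integrals.
Context {R : realType}.
Local Notation leb := (@lebesgue_measure R).
Implicit Types (f g : R -> \bar R) (A B D : set R).

(** Integrals of nonnegative functions are suprema over simple functions below
    them, so they are monotone without any measurability. *)
Lemma le_ge0_integral f g A B : A `<=` B ->
  (forall x, A x -> 0 <= f x)%E -> (forall x, B x -> 0 <= g x)%E ->
  (forall x, A x -> f x <= g x)%E ->
  (\int[leb]_(x in A) f x <= \int[leb]_(x in B) g x)%E.
Proof.
move=> AB f0 g0 fg; rewrite !ge0_integralE//.
apply: ereal_sup_le => _ [h /= hf <-]; exists h => // x.
apply: le_trans (hf x) _; rewrite !patchE.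
case: ifPn => [/set_mem Ax|_]; first by rewrite mem_set ?fg//; exact: AB.
by case: ifPn => // /set_mem; exact: g0.
Qed.

(** A lower bound for an integrand of which no measurability is known, from
    measurable minorants on two disjoint pieces. *)
Lemma ge0_integral_superadditive g1 g2 f A B D :
  measurable (A : set (measurableTypeR R)) -> measurable (B : set (measurableTypeR R)) ->
  measurable_fun (A : set (measurableTypeR R)) g1 ->
  measurable_fun (B : set (measurableTypeR R)) g2 ->
  A `<=` D -> B `<=` D -> [disjoint A & B] ->
  (forall x, D x -> 0 <= f x)%E ->
  (forall x, A x -> 0 <= g1 x <= f x)%E -> (forall x, B x -> 0 <= g2 x <= f x)%E ->
  (\int[leb]_(x in A) g1 x + \int[leb]_(x in B) g2 x <= \int[leb]_(x in D) f x)%E.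
Proof.
move=> mA mB mg1 mg2 AD BD dAB f0 hA hB.
pose g x := if x \in A then g1 x else g2 x.
have gA : {in A, g =1 g1} by move=> x xA; rewrite /g xA.
have gB : {in B, g =1 g2}.
  move=> x xB; rewrite /g; case: ifPn => // xA.
  by have /disj_set2P/seteqP[/(_ x)] := dAB; case; split; exact: set_mem.
have -> : (\int[leb]_(x in A) g1 x = \int[leb]_(x in A) g x)%E.
  by apply: eq_integral => x /gA ->.
have -> : (\int[leb]_(x in B) g2 x = \int[leb]_(x in B) g x)%E.
  by apply: eq_integral => x /gB ->.
have g0 x : (A `|` B) x -> (0 <= g x)%E.
  move=> [Ax|Bx].
    by rewrite gA ?inE//; have /andP[] := hA x Ax.
  by rewrite gB ?inE//; have /andP[] := hB x Bx.
rewrite -ge0_integral_setU//; last first.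
  apply/measurable_funU => //; split.
    by apply: eq_measurable_fun mg1 => x /gA.
  by apply: eq_measurable_fun mg2 => x /gB.
apply: le_ge0_integral => //.
  by move=> x [/AD|/BD].
move=> x [Ax|Bx].
  by rewrite gA ?inE//; have /andP[] := hA x Ax.
by rewrite gB ?inE//; have /andP[] := hB x Bx.
Qed.

Lemma is_derive_expR_lin (a d u : R) :
  is_derive u 1 (fun u => expR (a * u + d)) (a * expR (a * u + d)).
Proof.
apply: (der_eq (der_comp (is_derive_expR _) (derD (derZ a (der_id u)) (der_cst d u)))).
by rewrite mulr1 addr0 mulrC.
Qed.

Lemma FTC2_closed_le (f F : R -> R) (a c : R) : a <= c ->
  (forall x, a <= x <= c -> {for x, continuous f}) ->
  (forall x, a <= x <= c -> is_derive x 1 F (f x)) ->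
  (\int[leb]_(x in `[a, c]) (f x)%:E = (F c - F a)%:E)%E.
Proof.
rewrite le_eqVlt => /predU1P[<- _ _|]; last exact: FTC2_closed.
by rewrite set_itv1 integral_set1 subrr.
Qed.

Lemma integral_exp (q l K t : R) : 0 <= t ->
  (\int[leb]_(u in `[0%R, t]) (expR (q * u) * ((- q - l) * K * expR (- l * (t - u))))%:E =
   (K * (expR (- l * t) - expR (q * t)))%:E)%E.
Proof.
move=> t0.
have E u : expR (q * u) * ((- q - l) * K * expR (- l * (t - u))) =
   ((- q - l) * K) * expR ((q + l) * u + - l * t).
  rewrite mulrCA -expRD; congr (_ * expR _); ring.
under eq_integral do rewrite E.
have dF (u : R) : is_derive u 1 (fun u => - K * expR ((q + l) * u + - l * t))
    (((- q - l) * K) * expR ((q + l) * u + - l * t)).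
  by apply: (der_eq (derZ (- K) (is_derive_expR_lin (q + l) (- l * t) u))); ring.
rewrite (@FTC2_closed_le _ (fun u => - K * expR ((q + l) * u + - l * t)) 0 t t0)//.
- congr (_%:E); rewrite mulr0 add0r.
  have -> : (q + l) * t + - l * t = q * t by ring.
  ring.
- move=> x _; apply: der_continuous.
Qed.

End unmeasured_integrals.

Section feller.
Context {R : realType}.
Implicit Types (s t x u : R).

Local Notation leb := (@lebesgue_measure R).

Variables (b : nat -> R) (m l : R).
Hypothesis sub : subcritical b m.
Hypothesis pl : principal b l.

Local Notation q := (qmat b).
Local Notation dvec := (dvec b l).
Local Notation fel := (feller_iter b).

Lemma feller_ge0 n i j t : (0 <= fel n i j t)%E.
Proof.
elim: n i j t => [|n ih] i j t //=.
apply: adde_ge0; first by rewrite lee_fin mulr_ge0// expR_ge0.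
apply: integral_ge0 => u _; apply: mule_ge0; first by rewrite lee_fin expR_ge0.
apply: nneseries_ge0 => k _ ki; apply: mule_ge0 => //.
by rewrite lee_fin (qmat_ge0 sub).
Qed.

Lemma feller_sum_ge0 n i j t : (0 <= \sum_(0 <= k <oo | k != i) ((q i k)%:E * fel n k j t))%E.
Proof.
apply: nneseries_ge0 => k _ ki; apply: mule_ge0; last exact: feller_ge0.
by rewrite lee_fin (qmat_ge0 sub).
Qed.

Lemma feller_integrand_ge0 n i j t u :
  (0 <= (expR (q i i * u))%:E * \sum_(0 <= k <oo | k != i) ((q i k)%:E * fel n k j t))%E.
Proof.
by apply: mule_ge0; [rewrite lee_fin expR_ge0|exact: feller_sum_ge0].
Qed.

Lemma feller_nd n i j t : (fel n i j t <= fel n.+1 i j t)%E.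
Proof.
elim: n i j t => [|n ih] i j t; first exact: feller_ge0.
rewrite [leLHS]/= [leRHS]/=; apply: leeD2l; apply: le_ge0_integral => //.
- by move=> u _; exact: feller_integrand_ge0.
- by move=> u _; exact: (@feller_integrand_ge0 n.+1).
- move=> u _; apply: lee_wpmul2l; first by rewrite lee_fin expR_ge0.
  apply: lee_nneseries => k *.
    by apply: mule_ge0; [rewrite lee_fin (qmat_ge0 sub)|exact: feller_ge0].
  by apply: lee_wpmul2l; [rewrite lee_fin (qmat_ge0 sub)|exact: ih].
Qed.

Lemma qmbp_cvg i j t : (fun n => fel n i j t) @ \oo --> qmbp b i j t.
Proof.
apply: ereal_nondecreasing_is_cvgn; apply/nondecreasing_seqP => n.
exact: feller_nd.
Qed.

Lemma dvec_ge0 i : 0 <= dvec i.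
Proof. by case: i => [|i]; [rewrite dvec0|apply/ltW/(dvec_gt0 sub pl)]. Qed.

Lemma qmat0 k : q 0 k = 0.
Proof. by rewrite /qmat mul0r. Qed.

(** A nonnegative vector with [Q x = - l x] makes [e^(- l t) x] a solution of the
    backward equation, which dominates the iterates. *)
Lemma feller_upper n i j t : (0 < j)%N -> 0 <= t ->
  (fel n i j t <= (dvec i / dvec j * expR (- l * t))%:E)%E.
Proof.
move=> j0; have dj : 0 < dvec j by exact: (dvec_gt0 sub pl).
elim: n i t => [|n ih] i t t0.
  by rewrite /= lee_fin mulr_ge0 ?expR_ge0// divr_ge0 ?dvec_ge0.
case: i => [|i].
  rewrite [leLHS]/= (_ : (0%N == j) = false) ?mul0r ?add0e; last by rewrite ltn_eqF.
  rewrite dvec0 !mul0r.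
  rewrite integral0_eq// => u _; rewrite eseries0 ?mule0// => k _ _.
  by rewrite qmat0 mul0e.
rewrite [leLHS]/=.
pose K := dvec i.+1 / dvec j.
have K0 : 0 <= K by rewrite divr_ge0 ?dvec_ge0.
have int : (\int[leb]_(u in `[0%R, t]) ((expR (q i.+1 i.+1 * u))%:E *
        \sum_(0 <= k <oo | k != i.+1) ((q i.+1 k)%:E * fel n k j (t - u)%R)) <=
    (K * (expR (- l * t) - expR (q i.+1 i.+1 * t)))%:E)%E.
  rewrite -(integral_exp (q i.+1 i.+1) l K t0).
  have pt u : `[0, t]%classic u -> (\sum_(0 <= k <oo | k != i.+1) ((q i.+1 k)%:E * fel n k j (t - u)%R) <=
      ((- q i.+1 i.+1 - l) * K * expR (- l * (t - u)))%:E)%E.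
    rewrite /= in_itv/= => /andP[u0 ut]; pose y := expR (- l * (t - u)) / dvec j.
    have y0 : 0 <= y by rewrite divr_ge0 ?expR_ge0 ?(ltW dj).
    have -> : (- q i.+1 i.+1 - l) * K * expR (- l * (t - u)) =
      y * ((- q i.+1 i.+1 - l) * dvec i.+1) by rewrite /K /y; ring.
    rewrite EFinM -(dvec_invariant sub pl)// -nneseriesZl; last first.
      by move=> k ki; rewrite lee_fin mulr_ge0 ?dvec_ge0 ?(qmat_ge0 sub).
    apply: lee_nneseries => k *.
      by apply: mule_ge0; [rewrite lee_fin (qmat_ge0 sub)|exact: feller_ge0].
    rewrite [X in (_ <= _ * X)%E]EFinM [leRHS]muleCA; apply: lee_wpmul2l; first by rewrite lee_fin (qmat_ge0 sub).
    apply: le_trans (ih k (t - u) _) _; first by rewrite subr_ge0.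
    by rewrite -EFinM lee_fin /y le_eqVlt; apply/orP; left; apply/eqP; ring.
  apply: le_ge0_integral => //.
  - by move=> u _; exact: feller_integrand_ge0.
  - move=> u tu; rewrite EFinM; apply: mule_ge0; first by rewrite lee_fin expR_ge0.
    by apply: le_trans (pt u tu); exact: feller_sum_ge0.
  - by move=> u tu; rewrite EFinM; apply: lee_wpmul2l; [rewrite lee_fin expR_ge0|exact: pt].
apply: le_trans (leeD2l _ int) _; rewrite -EFinD lee_fin.
have : (i.+1 == j)%:R * expR (q i.+1 i.+1 * t) <= K * expR (q i.+1 i.+1 * t).
  rewrite ler_wpM2r ?expR_ge0//; case: eqP => //= ij.
  by rewrite /K ij divff// gt_eqF.
rewrite -/K; lra.
Qed.

End feller.

(** * Lower bound for the transition function *)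

Section finite_uniformity.
Context {R : realType}.

Lemma fin_unif (Q : nat -> nat -> R -> Prop) N0 :
  (forall i n c c', Q i n c -> 0 < c' <= c -> Q i n c') ->
  (forall i, (i < N0)%N -> exists N, exists2 c, 0 < c & forall n, (N <= n)%N -> Q i n c) ->
  exists N, exists2 c, 0 < c & forall i, (i < N0)%N -> forall n, (N <= n)%N -> Q i n c.
Proof.
move=> Qc; elim: N0 => [|N0 ih] H; first by exists 0%N; exists 1.
have [N [c c0 HN]] := ih (fun i iN => H i (ltnW iN)).
have [N' [c' c'0 HN']] := H N0 (ltnSn _).
exists (maxn N N'); exists (Num.min c c'); first by rewrite lt_min c0.
move=> i; rewrite ltnS leq_eqVlt => /predU1P[->|iN] n; rewrite geq_max => /andP[n1 n2].
  by apply: Qc (HN' n n2) _; rewrite lt_min c0 c'0 ge_min lexx orbT.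
by apply: Qc (HN i iN n n1) _; rewrite lt_min c0 c'0 ge_min lexx.
Qed.

End finite_uniformity.

Section lower_bound.
Context {R : realType}.
Implicit Types (s t x u : R).

Local Notation leb := (@lebesgue_measure R).

Variables (b : nat -> R) (m l : R).
Hypothesis sub : subcritical b m.
Hypothesis pl : principal b l.

Local Notation q := (qmat b).
Local Notation dvec := (dvec b l).
Local Notation fel := (feller_iter b).

Lemma b1_le0 : b 1%N <= 0.
Proof.
have h := psum_le0 sub (ltn0Sn 0); rewrite /psum big_ord_recl big_ord1/= in h.
by case: sub => _ [b0 _] _ _ _; lra.
Qed.

Lemma qmat_diag_le0 i : q i i <= 0.
Proof. by rewrite qmat_diag mulr_ge0_le0 ?b1_le0// exprn_ge0. Qed.

Lemma feller_term_le n i j k t : k != i ->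
  ((q i k)%:E * fel n k j t <= \sum_(0 <= k <oo | k != i) ((q i k)%:E * fel n k j t))%E.
Proof.
move=> ki; apply: le_trans (nneseries_lim_ge k.+1 _).
  rewrite big_mkcond big_nat_recr//= ki leeDr//; apply: sume_ge0 => p _.
  case: ifPn => // pi; apply: mule_ge0; last exact: (feller_ge0 sub).
  by rewrite lee_fin (qmat_ge0 sub).
move=> p _ pi; apply: mule_ge0; last exact: (feller_ge0 sub).
by rewrite lee_fin (qmat_ge0 sub).
Qed.

Lemma integral_cst_itv (K a c : R) : a <= c ->
  (\int[leb]_(u in `[a, c]) K%:E = (K * (c - a))%:E)%E.
Proof.
move=> ac; have dK x : a <= x <= c -> is_derive x 1 (fun y => K * y) K.
  by move=> _; apply: (der_eq (derZ K (der_id x))); rewrite mulr1.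
rewrite (@FTC2_closed_le _ (fun=> K) (fun y => K * y) a c ac)//.
  by congr (_%:E); ring.
by move=> x _; exact: cvg_cst.
Qed.

(** Positivity of the transition probabilities to [j], uniform in [d <= t <= 1] with
    one [N] for all [d]; in this form it is inherited along possible jumps. *)
Definition reaches j i := exists N, forall d, 0 < d <= 1 -> exists2 c, 0 < c &
  forall n, (N <= n)%N -> forall t, d <= t <= 1 -> (c%:E <= fel n i j t)%E.

Lemma reaches_refl j : reaches j j.
Proof.
exists 1%N => d _; exists (expR (q j j)); first exact: expR_gt0.
move=> [//|n] _ t /andP[_ t1]; rewrite [leRHS]/= eqxx mul1r.
rewrite -[leLHS]adde0; apply: leeD.
  rewrite lee_fin ler_expR; have := qmat_diag_le0 j; nra.
by apply: integral_ge0 => u _; exact: (feller_integrand_ge0 sub).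
Qed.

Lemma reaches_step j i k : k != i -> 0 < q i k -> reaches j k -> reaches j i.
Proof.
move=> ki qik [N HN]; exists N.+1 => d /andP[d0 d1].
have [|c1 c10 Hc1] := HN (d / 2); first by apply/andP; split; lra.
pose K := expR (q i i) * (q i k * c1).
have K0 : 0 < K by rewrite !mulr_gt0 ?expR_gt0.
exists (K * (d / 2)); first by rewrite mulr_gt0// divr_gt0.
move=> [//|n] nN t /andP[dt t1]; rewrite [leRHS]/=.
rewrite -[leLHS]add0e; apply: leeD; first by rewrite lee_fin mulr_ge0 ?expR_ge0.
have -> : K * (d / 2) = K * (d / 2 - 0) by rewrite subr0.
rewrite -integral_cst_itv; last lra.
apply: le_ge0_integral.
- by move=> u /=; rewrite !in_itv/= => /andP[-> h]/=; lra.
- by move=> u _; rewrite lee_fin ltW.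
- by move=> u _; exact: (feller_integrand_ge0 sub).
move=> u; rewrite /= in_itv/= => /andP[u0 ud].
rewrite EFinM; apply: lee_pmul.
- by rewrite lee_fin expR_ge0.
- by rewrite lee_fin mulr_ge0 ?ltW.
- by rewrite lee_fin ler_expR; have := qmat_diag_le0 i; nra.
- apply: le_trans (feller_term_le _ _ _ ki); rewrite EFinM.
  apply: lee_wpmul2l; first by rewrite lee_fin ltW.
  by apply: Hc1 => //; apply/andP; split; lra.
Qed.

Lemma qmat_down i : 0 < q i.+1 i.
Proof.
rewrite /qmat leqnn subnn mulr_gt0 ?ltr0n ?expn_gt0//.
by case: sub => _ [].
Qed.

(** Some [b j] with [j >= 2] is positive, so every state has an upward jump of the
    same positive size. *)
Lemma qmat_up : exists2 p, (0 < p)%N & forall i, (0 < i)%N -> 0 < q i (i + p).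
Proof.
case: sub => _ _ _ _ [[|[|p]]// _ bp]; exists p.+1 => // i i0.
rewrite /qmat ifT; last lia.
have -> : ((i + p.+1).+1 - i = p.+2)%N by lia.
by rewrite mulr_gt0 ?ltr0n ?expn_gt0 ?i0.
Qed.

Lemma all_reach j i : (0 < j)%N -> (0 < i)%N -> reaches j i.
Proof.
move=> j0 i0.
have above p : reaches j (j + p).
  elim: p => [|p ih]; first by rewrite addn0; exact: reaches_refl.
  rewrite addnS; apply: reaches_step (qmat_down _) ih.
  by rewrite neq_ltn ltnSn.
have [p p0 up] := qmat_up.
have [d] := ubnP (j - i); elim: d i i0 => // d ih i i0 jid.
have [ji|ij] := leqP j i; first by rewrite -(subnKC ji).
apply: (reaches_step _ (up i i0)); first by lia.
by apply: ih; lia.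
Qed.

(** The backward equation started afresh at time 1: the part of the integral over
    [t, t + 1/2] involves transition times in [1/2, 1] only and, for [i != j],
    replaces the initial value; the part over [0, t] is the usual integral. *)
Lemma feller_restart j i : (0 < j)%N -> (0 < i)%N -> exists N, exists2 c, 0 < c &
  forall n, (N <= n)%N -> forall t (g : R -> R), 0 <= t ->
  (forall u, {for u, continuous g}) ->
  (forall u, 0 <= u <= t -> 0 <= g u /\ ((g u)%:E <= (expR (q i i * u))%:E *
     \sum_(0 <= k <oo | k != i) ((q i k)%:E * fel n k j (1 + t - u)))%E) ->
  ((c * expR (q i i * t))%:E + \int[leb]_(u in `[0%R, t]) (g u)%:E <=
    fel n.+1 i j (1 + t))%E.
Proof.
move=> j0 i0; have [<-|ij] := eqVneq i j.
  exists 0%N; exists (expR (q i i)); first exact: expR_gt0.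
  move=> n _ t g t0 cg gP; rewrite [leRHS]/= eqxx mul1r; apply: leeD.
    by rewrite lee_fin mulrDr mulr1 expRD.
  apply: le_ge0_integral.
  - by move=> u /=; rewrite !in_itv/= => /andP[-> h]/=; lra.
  - by move=> u; rewrite /= in_itv/= => /gP[h _]; rewrite lee_fin.
  - by move=> u _; exact: (feller_integrand_ge0 sub).
  - by move=> u; rewrite /= in_itv/= => /gP[].
have [k [k0 ki qik]] : exists k, [/\ (0 < k)%N, k != i & 0 < q i k].
  have [p p0 up] := qmat_up; exists (i + p)%N; split; [lia|lia|exact: up].
have [N HN] := all_reach j0 k0.
have [|c1 c10 Hc1] := HN 2^-1; first by apply/andP; split; lra.
exists N; exists (expR (q i i) * (q i k * c1) / 2).
  by rewrite !mulr_gt0 ?expR_gt0// invr_gt0.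
move=> n nN t g t0 cg gP; rewrite [leRHS]/=.
rewrite -[leLHS]add0e; apply: leeD; first by rewrite lee_fin mulr_ge0 ?expR_ge0.
pose K := expR (q i i * (1 + t)) * (q i k * c1).
have K0 : 0 <= K by rewrite mulr_ge0 ?expR_ge0// mulr_ge0 ?ltW.
have -> : expR (q i i) * (q i k * c1) / 2 * expR (q i i * t) = K * (t + 2^-1 - t).
  rewrite /K (_ : qmat b i i * (1 + t) = qmat b i i + qmat b i i * t); last by ring.
  by rewrite expRD; field.
rewrite -integral_cst_itv; last lra.
have mI a c : measurable (`[a, c]%classic : set (measurableTypeR R)).
  exact: (measurable_itv `[a, c]).
have -> : (\int[leb]_(u in `[t, (t + 2^-1)%R]) K%:E =
    \int[leb]_(u in `]t, (t + 2^-1)%R]) K%:E)%E.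
  by apply/esym; apply: integral_itv_obnd_cbnd; exact: measurable_cst.
rewrite addeC; apply: ge0_integral_superadditive.
- exact: mI.
- exact: (measurable_itv `]t, (t + 2^-1)]).
- have mg : measurable_fun (`[0, t]%classic : set R) g.
    by apply: measurable_continuous_co => // x _; exact: cg.
  have : measurable_fun (`[0, t]%classic : set (measurableTypeR R)) g by exact: mg.
  by move=> h; apply/measurable_EFinP.
- exact: measurable_cst.
- by move=> u /=; rewrite !in_itv/= => /andP[-> h]/=; lra.
- by move=> u /=; rewrite !in_itv/= => /andP[h1 h2]/=; apply/andP; split; lra.
- apply/disj_set2P; apply/seteqP; split => // u [] /=; rewrite !in_itv/=.
  by move=> /andP[_ h1] /andP[h2 _]; lra.
- by move=> u _; exact: (feller_integrand_ge0 sub).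
- by move=> u; rewrite /= in_itv/= => /gP[h h']; rewrite lee_fin h.
move=> u; rewrite /= in_itv/= => /andP[tu ut]; rewrite lee_fin K0/=.
rewrite EFinM; apply: lee_pmul.
- by rewrite lee_fin expR_ge0.
- by rewrite lee_fin mulr_ge0 ?ltW.
- by rewrite lee_fin ler_expR; have := qmat_diag_le0 i; nra.
- apply: le_trans (feller_term_le _ _ _ ki); rewrite EFinM.
  apply: lee_wpmul2l; first by rewrite lee_fin ltW.
  by apply: Hc1 => //; apply/andP; split; lra.
Qed.

Lemma qmat_sum_shift_fun i N (f : nat -> R) :
  \sum_(0 <= k < N + i) q i.+1 k * f k =
  i.+1%:R ^+ 2 * \sum_(0 <= j < N) b j * f (j + i)%N.
Proof.
rewrite (@big_cat_nat _ _ _ i)//=; last exact: leq_addl.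
rewrite big_nat big1 ?add0r; last first.
  by move=> k /andP[_ ki]; rewrite /qmat ltnS leqNgt ki mul0r.
rewrite -{1}[i]add0n big_addn addnK big_distrr/=; apply: eq_bigr => k _.
rewrite /qmat ltnS leq_addl natrX.
have -> : ((k + i).+1 - i.+1 = k)%N by lia.
by rewrite mulrA.
Qed.

(** In the limit [N -> oo], where [series b N] tends to 0, the vector [k |-> k] has
    drift at most [- (b 0 - m) i^2]. *)
Lemma drift_le i N : (2 <= N)%N ->
  \sum_(0 <= k < N + i) q i.+1 k * k%:R <=
  i.+1%:R ^+ 2 * (i.+1%:R * series b N - (b 0%N - m)).
Proof.
move=> N2; rewrite qmat_sum_shift_fun ler_wpM2l ?exprn_ge0//.
have -> : \sum_(0 <= j < N) b j * (j + i)%:R =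
    i.+1%:R * series b N + \sum_(0 <= j < N) b j * (j%:R - 1).
  rewrite /series/= big_distrr/= -big_split/=; apply: eq_bigr => j _.
  by rewrite natrD -natr1; ring.
rewrite lerD2l big_ltn; last lia.
rewrite big_ltn; last lia.
rewrite mulr0n mulr1n.
case: sub => _ _ _ bm _; have := bm N; move=> bmN.
suff : \sum_(2 <= i0 < N) b i0 * (i0%:R - 1) <= m by lra.
apply: le_trans bmN.
rewrite !big_nat; apply: ler_sum => j /andP[j2 _].
by rewrite mulrC -(natrB _ (ltnW j2)) subn1.
Qed.

Lemma dvec_mono i k : (i <= k)%N -> dvec i <= dvec k.
Proof.
move=> ik; rewrite -lee_fin !(dvecE sub pl); apply: le_ge0_integral => //.
- by move=> x /J_itvW Jx; rewrite lee_fin (mom_weight_ge0 sub pl).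
- by move=> x /J_itvW Jx; rewrite lee_fin (mom_weight_ge0 sub pl).
- move=> x /J_itvW Jx; have /andP[x0 /ltW x1] := Jx.
  rewrite lee_fin ler_wpM2r//; last by rewrite lerD2l lerN2 ler_wiXn2l.
  apply: mulr_ge0; last exact/ltW/(weight_gt0 sub).
  by rewrite mulr_ge0 ?(phi_nneg pl)// ltW// (principal_gt0 pl).
Qed.

Lemma dvec_sum_cvg i : (0 < i)%N ->
  (fun N => \sum_(0 <= k < N | k != i) q i k * dvec k) @ \oo --> (- q i i - l) * dvec i.
Proof.
move=> i0; have := dvec_invariant sub pl i0 => H.
have c : (fun N => \sum_(0 <= k < N | k != i) (q i k * dvec k)%:E)%E @ \oo -->
    ((- q i i - l) * dvec i)%:E.
  rewrite -H; apply: is_cvg_nneseries => k _ ki.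
  by rewrite lee_fin mulr_ge0 ?(dvec_ge0 sub pl)// (qmat_ge0 sub).
move/fine_cvgP : c => [_]; apply: cvg_trans; apply: near_eq_cvg.
by apply: nearW => n /=; rewrite sumEFin.
Qed.

(** The truncation [max(0, dvec i - e i)] has finite support because [dvec] is
    bounded. Where it is positive, subtracting [e i] costs [lam e i] but gains
    [e (b 0 - m) i^2] from the drift; for the finitely many [i] where the cost wins,
    [lam - l] pays for it if [e] is small. *)
Lemma finite_subinvariant (lam : R) i0 : l < lam -> (0 < i0)%N ->
  exists (y : nat -> R) (N0 : nat),
  [/\ (forall i, 0 <= y i), y 0%N = 0, 0 < y i0, (forall i, (N0 <= i)%N -> y i = 0) &
    forall i, (0 < i)%N -> 0 < y i ->
      (- q i i - lam) * y i <= \sum_(0 <= k < N0 | k != i) q i k * y k].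
Proof.
move=> llam i00; have l0 := principal_gt0 pl; have bt := beta_gt0 sub.
have [C C0 HC] := dvec_bounded sub pl.
have d1 := dvec_gt0 sub pl (ltn0Sn 0); have di0 := dvec_gt0 sub pl i00.
have lam0 : 0 < lam by exact: lt_trans llam.
(* The first bound serves the finitely many [i] below [lam / (b 0 - m)], the
   second keeps the entry at [i0] positive. *)
pose e := Num.min ((lam - l) * dvec 1 * (b 0%N - m) / lam ^+ 2) (dvec i0 / (2 * i0%:R)).
have e0 : 0 < e.
  have ll : 0 < lam - l by rewrite subr_gt0.
  rewrite lt_min; apply/andP; split; apply: divr_gt0 => //.
  - by apply: mulr_gt0 => //; apply: mulr_gt0.
  - exact: exprn_gt0.
  - by rewrite mulr_gt0// ltr0n.
have e1 : e * lam ^+ 2 <= (lam - l) * dvec 1 * (b 0%N - m).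
  by rewrite -ler_pdivlMr ?exprn_gt0// ge_min lexx.
have e2 : e * (2 * i0%:R) <= dvec i0.
  by rewrite -ler_pdivlMr ?mulr_gt0 ?ltr0n// ge_min lexx orbT.
have [N0 HN0] : exists N0, C < e * N0%:R.
  exists (Num.bound (C / e)).
  by rewrite mulrC -ltr_pdivrMr// archi_boundP// divr_ge0 ?ltW.
pose y i := Num.max 0 (dvec i - e * i%:R).
have y_ge i : dvec i - e * i%:R <= y i by rewrite le_max lexx orbT.
have y0 i : 0 <= y i by rewrite le_max lexx.
have yN i : (N0 <= i)%N -> y i = 0.
  move=> iN; apply/max_idPl; rewrite subr_le0; apply: le_trans (HC i) _.
  by apply: le_trans (ltW HN0) _; rewrite ler_pM2l// ler_nat.
exists y, N0; split => //.
- by rewrite /y (dvec0 b l) mulr0 subr0 maxxx.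
- rewrite lt_max; apply/orP; right; rewrite subr_gt0; lra.
move=> [//|i] _ yi.
have yE : y i.+1 = dvec i.+1 - e * i.+1%:R.
  by apply/max_idPr; move: yi; rewrite lt_max ltxx/= => /ltW.
have key : - q i.+1 i.+1 * (dvec i.+1 - e * i.+1%:R) - l * dvec i.+1 +
    e * (b 0%N - m) * i.+1%:R ^+ 2 <= \sum_(0 <= k < N0 | k != i.+1) q i.+1 k * y k.
  have c1 : (fun N => \sum_(0 <= k < N + i | k != i.+1) q i.+1 k * dvec k -
      e * (i.+1%:R ^+ 2 * (i.+1%:R * series b N - (b 0%N - m)) - q i.+1 i.+1 * i.+1%:R)) @ \oo -->
      (- q i.+1 i.+1 - l) * dvec i.+1 -
      e * (i.+1%:R ^+ 2 * (i.+1%:R * 0 - (b 0%N - m)) - q i.+1 i.+1 * i.+1%:R).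
    apply: cvgB.
      by rewrite (cvg_shiftn i (fun N => \sum_(0 <= k < N | k != i.+1) q i.+1 k * dvec k)); exact: dvec_sum_cvg.
    apply: cvgMl_tmp; apply: cvgB; last exact: cvg_cst.
    apply: cvgMl_tmp; apply: cvgB; last exact: cvg_cst.
    by apply: cvgMl_tmp; case: sub.
  have -> : - q i.+1 i.+1 * (dvec i.+1 - e * i.+1%:R) - l * dvec i.+1 +
      e * (b 0%N - m) * i.+1%:R ^+ 2 = (- q i.+1 i.+1 - l) * dvec i.+1 -
      e * (i.+1%:R ^+ 2 * (i.+1%:R * 0 - (b 0%N - m)) - q i.+1 i.+1 * i.+1%:R) by ring.
  apply: (cvgr_to_le c1); near=> N.
  have N2 : (2 <= N)%N by near: N; exact: nbhs_infty_ge.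
  have iN : (i.+1 < N + i)%N by move: N2; clear; lia.
  have NN : (N0 <= N + i)%N.
    by apply: leq_trans (leq_addr _ _); near: N; exact: nbhs_infty_ge.
  have -> : \sum_(0 <= k < N0 | k != i.+1) q i.+1 k * y k =
      \sum_(0 <= k < N + i | k != i.+1) q i.+1 k * y k.
    rewrite [RHS](@big_cat_nat _ _ _ N0)//= [X in _ = _ + X]big_nat_cond.
    rewrite [X in _ = _ + X]big1 ?addr0// => k /andP[/andP[kN _] _].
    by rewrite yN// mulr0.
  apply: (@le_trans _ _ (\sum_(0 <= k < N + i | k != i.+1) q i.+1 k * (dvec k - e * k%:R))); last first.
    by apply: ler_sum => k ki; rewrite ler_wpM2l ?(qmat_ge0 sub).
  under [leRHS]eq_bigr do rewrite mulrBr.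
  rewrite sumrB lerD2l lerN2.
  under eq_bigr do rewrite mulrCA.
  rewrite -big_distrr/= ler_pM2l//.
  have := drift_le i N2.
  rewrite (bigD1_seq i.+1) ?iota_uniq ?mem_index_iota//=; lra.
apply: le_trans key; rewrite yE.
have : 0 <= (lam - l) * dvec i.+1 + e * ((b 0%N - m) * i.+1%:R ^+ 2 - lam * i.+1%:R).
  have n0 : 0 < i.+1%:R :> R by rewrite ltr0n.
  have dm : dvec 1 <= dvec i.+1 by exact: dvec_mono.
  have [h|h] := leP lam ((b 0%N - m) * i.+1%:R).
    apply: addr_ge0; first by rewrite mulr_ge0 ?subr_ge0 ?ltW// (lt_le_trans d1).
    rewrite mulr_ge0 ?(ltW e0)// subr_ge0 expr2 mulrA ler_pM2r//.
  have h1 : e * (lam * i.+1%:R) * (b 0%N - m) <= e * lam ^+ 2.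
    by rewrite expr2 -!mulrA !ler_pM2l// mulrC ltW.
  have h2 : (lam - l) * dvec 1 * (b 0%N - m) <= (lam - l) * dvec i.+1 * (b 0%N - m).
    by rewrite ler_pM2r// ler_pM2l// subr_gt0.
  have h3 : e * (lam * i.+1%:R) <= (lam - l) * dvec i.+1.
    by rewrite -(ler_pM2r bt); lra.
  have h4 : 0 <= e * ((b 0%N - m) * i.+1%:R ^+ 2).
    by rewrite mulr_ge0 ?(ltW e0)// mulr_ge0 ?exprn_ge0 ?(ltW bt).
  lra.
lra.
Unshelve. all: by end_near. Qed.

End lower_bound.

Section decay.
Context {R : realType}.
Implicit Types (s t x u : R).

Local Notation leb := (@lebesgue_measure R).

Lemma le_integral_max0 (f : R -> R) a c : (forall x, {for x, continuous f}) ->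
  (\int[leb]_(x in `[a, c]) (f x)%:E <= \int[leb]_(x in `[a, c]) (Num.max 0 (f x))%:E)%E.
Proof.
move=> cf; have cm x : {for x, continuous (fun x => Num.max 0 (f x))}.
  exact: (@continuous_max _ _ (fun=> 0) f x (@cvg_cst _ _ _ _ _) (cf x)).
have int (g : R -> R) : (forall x, {for x, continuous g}) ->
    leb.-integrable `[a, c] (EFin \o g).
  move=> cg; apply: continuous_compact_integrable; first exact: segment_compact.
  by apply: continuous_subspaceT => x; exact: cg.
apply: (@le_integral _ _ _ leb _ (measurable_itv `[a, c]) _ _ (int f cf) (int _ cm)).
by move=> x _; rewrite lee_fin le_max lexx orbT.
Qed.

Variables (b : nat -> R) (m l : R).
Hypothesis sub : subcritical b m.
Hypothesis pl : principal b l.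

Local Notation q := (qmat b).
Local Notation dvec := (dvec b l).
Local Notation fel := (feller_iter b).

Lemma qmbp_ge0 i j t : (0 <= qmbp b i j t)%E.
Proof.
apply: (cvge_to_ge (@qmbp_cvg _ _ _ sub i j t)); apply: nearW => n.
exact: (feller_ge0 sub).
Qed.

Lemma qmbp_upper i j t : (0 < j)%N -> 0 <= t ->
  (qmbp b i j t <= (dvec i / dvec j * expR (- l * t))%:E)%E.
Proof.
move=> j0 t0; apply: (cvge_to_le (@qmbp_cvg _ _ _ sub i j t)); apply: nearW => n.
exact: (feller_upper sub pl).
Qed.

(** The iterates dominate [c' y e^(- lam t)] for a finitely supported [y] with
    [Q y >= - lam y] where [y > 0], up to an error halved at each iteration. The halving holds
    because the exponential [e^(2 K t)] in the error is twice as steep as the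
    total rate of jumps into the support, bounded by [K]. *)
Lemma qmbp_lower i j lam : (0 < i)%N -> (0 < j)%N -> l < lam ->
  exists2 c, 0 < c & forall t, 0 <= t ->
    ((c * expR (- lam * t))%:E <= qmbp b i j (1 + t))%E.
Proof.
move=> i_gt0 j0 llam.
have [y [N0 [y_ge0 y0 yi_gt0 yN0 sy]]] := finite_subinvariant sub pl llam i_gt0.
pose Q (i n : nat) c := (0 < i)%N -> forall t (g : R -> R), 0 <= t ->
  (forall u, {for u, continuous g}) ->
  (forall u, 0 <= u <= t -> 0 <= g u /\ ((g u)%:E <= (expR (q i i * u))%:E *
     \sum_(0 <= k <oo | k != i) ((q i k)%:E * fel n k j (1 + t - u)))%E) ->
  ((c * expR (q i i * t))%:E + \int[leb]_(u in `[0%R, t]) (g u)%:E <=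
    fel n.+1 i j (1 + t))%E.
have [N [c c0 HN]] : exists N, exists2 c, 0 < c & forall i, (i < N0)%N ->
    forall n, (N <= n)%N -> Q i n c.
  apply: fin_unif => [k n c c' Qc /andP[c'0 c'c] k0 t g t0 cg gP|k _].
    apply: le_trans (Qc k0 t g t0 cg gP); apply: leeD2r.
    by rewrite lee_fin ler_wpM2r ?expR_ge0.
  have [->|/lt0n_neq0 /eqP k0] := posnP k; first by exists 0%N; exists 1.
  have k1 : (0 < k)%N by rewrite lt0n; apply/eqP.
  have [N [c c0 H]] := feller_restart sub j0 k1.
  by exists N; exists c => // n nN _; exact: H.
pose Y := \sum_(k < N0) y k.
have Y0 : 0 <= Y by apply: sumr_ge0.
have yY k : y k <= Y.
  have [kN|Nk] := ltnP k N0; last by rewrite yN0.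
  by rewrite /Y (bigD1 (Ordinal kN))//= lerDl sumr_ge0.
pose K := 1 + \sum_(k < N0) \sum_(0 <= p < N0 | p != k :> nat) q k p.
have qp k p : p != k -> 0 <= q k p by exact: (qmat_ge0 sub).
have K0 : 0 < K.
  by rewrite ltr_pwDl// sumr_ge0// => k _; apply: sumr_ge0 => p /qp.
have SK k : (k < N0)%N -> \sum_(0 <= p < N0 | p != k) q k p <= K.
  move=> kN; rewrite /K (bigD1 (Ordinal kN))//= addrCA lerDl addr_ge0// sumr_ge0//.
  by move=> r _; apply: sumr_ge0 => p /qp.
(* [c' y <= c] starts the induction, the error at stage 0 being [c e^(2 K t)]. *)
pose c' := c / (1 + Y).
have Y1 : 0 < 1 + Y by rewrite ltr_pwDl.
have c'0 : 0 < c' by rewrite divr_gt0.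
have c'y k : c' * y k <= c.
  rewrite /c' mulrAC ler_pdivrMr// ler_pM2l//; have := yY k; lra.
pose err n t := c / 2 ^+ n * expR (2 * K * t).
have err0 n t : 0 <= err n t by rewrite mulr_ge0 ?expR_ge0// divr_ge0 ?(ltW c0)// exprn_ge0.
have claim n : forall k t, 0 <= t ->
    ((c' * y k * expR (- lam * t) - err n t)%:E <= fel (N + n) k j (1 + t))%E.
  elim: n => [|n ih] k t t0.
    apply: le_trans (feller_ge0 sub _ _ _ _).
    rewrite lee_fin subr_le0 /err expr0 divr1.
    have h0 := principal_gt0 pl.
    have h1 : expR (- lam * t) <= expR (2 * K * t).
      by rewrite ler_expR ler_wpM2r//; lra.
    apply: le_trans (ler_wpM2l _ h1) _; first by rewrite mulr_ge0 ?(ltW c'0).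
    by rewrite ler_wpM2r ?expR_ge0.
  have := y_ge0 k; rewrite le_eqVlt => /predU1P[yk|yk].
    apply: le_trans (feller_ge0 sub _ _ _ _).
    by rewrite -yk mulr0 mul0r sub0r lee_fin oppr_le0.
  have kN : (k < N0)%N by rewrite ltnNge; apply/negP => /yN0 h; rewrite h ltxx in yk.
  have k0 : (0 < k)%N by rewrite lt0n; apply/eqP => h; rewrite h y0 ltxx in yk.
  pose G u := (- q k k - lam) * (c' * y k) * expR ((q k k + lam) * u + - lam * t) -
    K * (c / 2 ^+ n) * expR (- (2 * K) * u + 2 * K * t).
  pose F u := - (c' * y k) * expR ((q k k + lam) * u + - lam * t) +
    c / 2 ^+ n.+1 * expR (- (2 * K) * u + 2 * K * t).
  have dF u : is_derive u 1 F (G u).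
    apply: (der_eq (derD (derZ (- (c' * y k)) (is_derive_expR_lin (q k k + lam) (- lam * t) u))
      (derZ (c / 2 ^+ n.+1) (is_derive_expR_lin (- (2 * K)) (2 * K * t) u)))).
    rewrite /G exprS; field.
    by rewrite expf_neq0.
  have cG u : {for u, continuous G}.
    apply: (der_continuous (derB
      (derZ ((- q k k - lam) * (c' * y k)) (is_derive_expR_lin (q k k + lam) (- lam * t) u))
      (derZ (K * (c / 2 ^+ n)) (is_derive_expR_lin (- (2 * K)) (2 * K * t) u)))).
  have cmG u : {for u, continuous (fun u => Num.max 0 (G u))}.
    exact: (@continuous_max _ _ (fun=> 0) G u (@cvg_cst _ _ _ _ _) (cG u)).
  have low u : 0 <= u <= t -> ((G u)%:E <= (expR (q k k * u))%:E *
     \sum_(0 <= p <oo | p != k) ((q k p)%:E * fel (N + n) p j (1 + t - u)))%E.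
    move=> /andP[u0 ut].
    have low1 : (((- q k k - lam) * (c' * y k) * expR (- lam * (t - u)) -
        K * err n (t - u))%:E <=
        \sum_(0 <= p <oo | p != k) ((q k p)%:E * fel (N + n) p j (1 + t - u)))%E.
      apply: (@le_trans _ _ (\sum_(0 <= p < N0 | p != k)
          ((q k p)%:E * fel (N + n) p j (1 + t - u)))%E); last first.
        apply: nneseries_lim_ge => p _ pk; apply: mule_ge0; last exact: (feller_ge0 sub).
        by rewrite lee_fin qp.
      apply: (@le_trans _ _ (\sum_(0 <= p < N0 | p != k)
          (q k p * (c' * y p * expR (- lam * (t - u)) - err n (t - u)))%:E)%E); last first.
        apply: lee_sum => p pk; rewrite EFinM; apply: lee_wpmul2l.
          by rewrite lee_fin qp.
        by rewrite -addrA; apply: ih; rewrite subr_ge0.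
      rewrite sumEFin lee_fin.
      under [leRHS]eq_bigr do rewrite mulrBr.
      rewrite sumrB; apply: lerB; last by rewrite -big_distrl/= ler_wpM2r// SK.
      apply: (@le_trans _ _ (c' * expR (- lam * (t - u)) *
          \sum_(0 <= p < N0 | p != k) q k p * y p)).
        have -> : (- q k k - lam) * (c' * y k) * expR (- lam * (t - u)) =
          c' * expR (- lam * (t - u)) * ((- q k k - lam) * y k) by ring.
        by rewrite ler_wpM2l ?sy// mulr_ge0 ?expR_ge0// ltW.
      by rewrite big_distrr/=; apply: ler_sum => p _; rewrite le_eqVlt; apply/orP; left; apply/eqP; ring.
    apply: (@le_trans _ _ ((expR (q k k * u))%:E * ((- q k k - lam) * (c' * y k) *
      expR (- lam * (t - u)) - K * err n (t - u))%:E)%E); last first.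
      by apply: lee_wpmul2l; rewrite ?lee_fin ?expR_ge0.
    rewrite -EFinM lee_fin mulrBr; apply: lerB.
      have -> : (q k k + lam) * u + - lam * t = q k k * u + - lam * (t - u) by ring.
      by rewrite expRD le_eqVlt; apply/orP; left; apply/eqP; ring.
    rewrite mulrCA -[leRHS]mulrA ler_pM2l// /err mulrCA.
    rewrite ler_wpM2l ?divr_ge0 ?(ltW c0) ?exprn_ge0//.
    have -> : - (2 * K) * u + 2 * K * t = 2 * K * (t - u) by ring.
    rewrite ler_piMl ?expR_ge0// -expR0 ler_expR.
    by rewrite mulr_le0_ge0// (qmat_diag_le0 sub).
  have gP u : 0 <= u <= t -> 0 <= Num.max 0 (G u) /\
      ((Num.max 0 (G u))%:E <= (expR (q k k * u))%:E *
     \sum_(0 <= p <oo | p != k) ((q k p)%:E * fel (N + n) p j (1 + t - u)))%E.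
    move=> ut; split; first by rewrite le_max lexx.
    rewrite EFin_max ge_max low// andbT.
    exact: (feller_integrand_ge0 sub).
  rewrite addnS.
  apply: le_trans (HN k kN (N + n)%N (leq_addr _ _) k0 t _ t0 cmG gP).
  apply: le_trans (leeD2l _ (le_integral_max0 0 t cG)).
  rewrite (FTC2_closed_le t0 (fun x _ => cG x) (fun x _ => dF x)) -EFinD lee_fin.
  rewrite /F mulr0 add0r.
  have -> : (q k k + lam) * t + - lam * t = q k k * t by ring.
  have -> : - (2 * K) * t + 2 * K * t = 0 by ring.
  rewrite expR0 mulr1 mulr0 add0r /err.
  have := ler_wpM2r (expR_ge0 (q k k * t)) (c'y k).
  have : 0 <= c / 2 ^+ n.+1 by rewrite divr_ge0 ?(ltW c0)// exprn_ge0.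
  lra.
exists (c' * y i); first by rewrite mulr_gt0.
move=> t t0.
have lim : (fun n => (c' * y i * expR (- lam * t) - err n t)%:E) @ \oo -->
    (c' * y i * expR (- lam * t) - 0)%:E.
  apply: cvg_EFin; first by apply: nearW.
  rewrite (_ : fine \o _ = fun n => c' * y i * expR (- lam * t) - err n t)//.
  apply: cvgB; first exact: cvg_cst.
  rewrite /err (_ : (fun n => _) = geometric (c * expR (2 * K * t)) 2^-1).
    by apply: cvg_geometric; rewrite ger0_norm// invf_lt1// ltr1n.
  by apply/funext => n /=; rewrite exprVn mulrAC.
rewrite -[X in X%:E]subr0; apply: (cvge_to_le lim); apply: nearW => n.
apply: le_trans (claim n i t t0) _.
have nd : {homo (fun n => fel n i j (1 + t)) : n p / (n <= p)%N >-> (n <= p)%E}.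
  by apply/nondecreasing_seqP => p; exact: (feller_nd sub).
apply: (cvge_to_ge (@qmbp_cvg _ _ _ sub i j (1 + t))); near=> p.
by apply: nd; near: p; exact: nbhs_infty_ge.
Unshelve. all: by end_near. Qed.

(** The two exponential bounds on the transition function squeeze its
    logarithmic rate of decay. *)
Lemma decay_principal : is_decay_parameter b l.
Proof.
move=> i j i0 j0; set p := qmbp b i j.
pose C := dvec i / dvec j.
have C0 : 0 < C by rewrite divr_gt0// (dvec_gt0 sub pl).
have up t : 0 <= t -> (p t <= (C * expR (- l * t))%:E)%E by exact: qmbp_upper.
have pfin t : 0 <= t -> (p t = (fine (p t))%:E)%E.
  move=> t0; rewrite fineK// fin_numE; apply/andP; split.
    by rewrite gt_eqF// (lt_le_trans _ (qmbp_ge0 i j t))// ltNyr.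
  by rewrite lt_eqF// (le_lt_trans (up t t0))// ltry.
have ppos t : 1 <= t -> 0 < fine (p t).
  have ll1 : l < l + 1 by rewrite ltrDl.
  have [c c0 low] := qmbp_lower i0 j0 ll1.
  move=> t1; rewrite -lte_fin -pfin; last exact: le_trans t1.
  have := low (t - 1); rewrite subr_ge0 (_ : 1 + (t - 1) = t); last (by ring); move=> /(_ t1); apply: lt_le_trans.
  by rewrite lte_fin mulr_gt0// expR_gt0.
pose f t := - (t^-1 * ln (fine (p t))).
have fE : (\forall t \near +oo%R, (f t)%:E = - ((t^-1)%:E * lne (p t)))%E.
  exists 1; split => // t t1; rewrite pfin; last exact: le_trans (ltW t1).
  by rewrite lne_EFin// ppos// ltW.
suff h : f t @[t --> +oo] --> l.
  apply: (cvg_trans (near_eq_cvg fE)).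
  by apply: cvg_EFin => //; exact: nearW.
apply/cvgrPdist_le => e e0.
have le2 : l < l + e / 2 by rewrite ltrDl divr_gt0.
have [c c0 low] := qmbp_lower i0 j0 le2.
pose lam := l + e / 2.
have low' t : 1 <= t -> c * expR lam * expR (- lam * t) <= fine (p t).
  move=> t1; rewrite -lee_fin -pfin; last exact: le_trans t1.
  have := low (t - 1); rewrite subr_ge0 (_ : 1 + (t - 1) = t); last (by ring); move=> /(_ t1); apply: le_trans.
  rewrite lee_fin -mulrA -expRD le_eqVlt; apply/orP; left; apply/eqP.
  by congr (_ * expR _); rewrite /lam; ring.
pose M := `|ln C| + `|ln (c * expR lam)|.
exists (Num.max 1 (2 / e * M)); split; first exact: num_real.
move=> t; rewrite gt_max => /andP[t1 tM].
have t0 : 0 < t by exact: lt_trans t1.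
have Mt : M <= e / 2 * t.
  rewrite -ler_pdivrMl; last by rewrite divr_gt0.
  by rewrite invf_div ltW.
have up1 : ln (fine (p t)) <= ln C - l * t.
  have pt : fine (p t) <= C * expR (- l * t).
    by rewrite -lee_fin -pfin ?up ?(ltW t0).
  have CE : 0 < C * expR (- l * t) by rewrite mulr_gt0 ?expR_gt0.
  apply: le_trans (_ : _ <= ln (C * expR (- l * t))) _.
    by rewrite ler_ln// posrE// ppos// ltW.
  by rewrite lnM ?posrE ?expR_gt0// expRK mulNr.
have low1 : ln (c * expR lam) - lam * t <= ln (fine (p t)).
  have cl : 0 < c * expR lam by rewrite mulr_gt0// expR_gt0.
  apply: (@le_trans _ _ (ln (c * expR lam * expR (- lam * t)))).
    by rewrite [leRHS]lnM ?posrE ?expR_gt0// expRK mulNr.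
  rewrite ler_ln ?posrE ?low' ?ppos ?(ltW t1)//.
  by rewrite mulr_gt0 ?expR_gt0.
have -> : l - f t = t^-1 * (l * t + ln (fine (p t))) by rewrite /f; field; lra.
rewrite normrM gtr0_norm ?invr_gt0// ler_pdivrMl// [leRHS]mulrC ler_norml.
have a1 := ler_norm (ln C); have a2 := ler_norm (- ln (c * expR lam)).
rewrite normrN in a2.
have a3 := normr_ge0 (ln C); have a4 := normr_ge0 (ln (c * expR lam)).
move: Mt low1; rewrite /M /lam => Mt low1.
have ht : 0 < e * t by rewrite mulr_gt0.
by apply/andP; split; lra.
Qed.

End decay.

(** * Germs of smooth functions and cut-off functions *)

Section smoothness.
Context {R : realType}.
Implicit Types (f g : R -> R) (x y : R).

(** [n] times differentiable near [x]. As a property of germs it can be transported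
    along local equalities, and all closure properties follow by induction. *)
Fixpoint Cn n f x : Prop := if n is n'.+1 then
  (\forall y \near x, derivable f y 1) /\ Cn n' (derive1 f) x else True.

Lemma Cn_near n f g x : (\forall y \near x, f y = g y) -> Cn n f x -> Cn n g x.
Proof.
elim: n f g => // n ih f g fg /= [df nf].
have e : \forall y \near x, is_derive (y:R) 1 g (derive1 f y).
  have := near_join fg; apply: filterS2 df => y dy fgy.
  by apply: (der_near fgy); apply: (DeriveDef dy); rewrite derive1E.
split; first by apply: filterS e => y [].
by apply: ih nf; apply: filterS e => y h; apply/esym/der_derive1.
Qed.

Lemma Cn_pred n f x : Cn n.+1 f x -> Cn n f x.
Proof. by elim: n f => // n ih f [df /ih]. Qed.

Lemma CnS n f df x : (\forall y \near x, is_derive (y:R) 1 f (df y)) -> Cn n df x ->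
  Cn n.+1 f x.
Proof.
move=> h ndf; split; first by apply: filterS h => y [].
by apply: Cn_near ndf; apply: filterS h => y h; apply/esym/der_derive1.
Qed.

Lemma Cn_der n f x : Cn n.+1 f x -> \forall y \near x, is_derive (y:R) 1 f (derive1 f y).
Proof.
by move=> [df _]; apply: filterS df => y dy; apply: (DeriveDef dy); rewrite derive1E.
Qed.

Lemma Cn_cst n k x : Cn n (fun=> k) x.
Proof.
elim: n k => // n ih k; apply: (@CnS _ _ (fun=> 0)) => //.
by exists 1 => //= y _; exact: der_cst.
Qed.

Lemma Cn_id n x : Cn n (fun y => y) x.
Proof.
case: n => // n; apply: (@CnS _ _ (fun=> 1)); last exact: Cn_cst.
by exists 1 => //= y _; exact: der_id.
Qed.

Lemma CnD n f g x : Cn n f x -> Cn n g x -> Cn n (fun y => f y + g y) x.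
Proof.
elim: n f g => // n ih f g hf hg.
apply: (@CnS _ _ (fun y => derive1 f y + derive1 g y)).
  have := Cn_der hf; have := Cn_der hg; apply: filterS2 => y dg df; exact: derD.
by apply: ih; [case: hf|case: hg].
Qed.

Lemma CnM n f g x : Cn n f x -> Cn n g x -> Cn n (fun y => f y * g y) x.
Proof.
elim: n f g => // n ih f g hf hg.
apply: (@CnS _ _ (fun y => derive1 f y * g y + f y * derive1 g y)).
  have := Cn_der hf; have := Cn_der hg; apply: filterS2 => y dg df; exact: derM.
apply: CnD; apply: ih.
- by case: hf.
- exact: Cn_pred.
- exact: Cn_pred.
- by case: hg.
Qed.

Lemma CnZ n k f x : Cn n f x -> Cn n (fun y => k * f y) x.
Proof. by move=> hf; apply: (CnM _ hf); exact: Cn_cst. Qed.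

Lemma CnB n f g x : Cn n f x -> Cn n g x -> Cn n (fun y => f y - g y) x.
Proof.
move=> hf /(CnZ (-1)) hg; apply: Cn_near (CnD hf hg).
by exists 1 => //= y _; rewrite mulN1r.
Qed.

Lemma CnV n f x : Cn n f x -> f x != 0 -> Cn n (fun y => (f y)^-1) x.
Proof.
elim: n => // n ih hf fx0.
apply: (@CnS _ _ (fun y => -1 * (derive1 f y * ((f y)^-1 * (f y)^-1)))).
  have [cf _] : is_derive x 1 f (derive1 f x) by exact: nbhs_singleton (Cn_der hf).
  have fx : {for x, continuous f}.
    by apply/differentiable_continuous/derivable1_diffP.
  have ne : \forall y \near x, f y != 0 by exact: (cvgr_neq0 _ fx).
  have := Cn_der hf; apply: filterS2 ne => y ne df.
  by apply: (der_eq (derV df ne)); field.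
apply: CnZ; apply: CnM; first by case: hf.
by apply: CnM; apply: ih => //; exact: Cn_pred.
Qed.

Lemma Cn_comp n f g x : Cn n f (g x) -> Cn n g x -> Cn n (fun y => f (g y)) x.
Proof.
elim: n f => // n ih f hf hg.
apply: (@CnS _ _ (fun y => derive1 f (g y) * derive1 g y)).
  have [cg _] : is_derive x 1 g (derive1 g x) by exact: nbhs_singleton (Cn_der hg).
  have gx : {for x, continuous g}.
    by apply/differentiable_continuous/derivable1_diffP.
  have nf : \forall y \near x, is_derive (g (y:R)) 1 f (derive1 f (g y)).
    exact: (gx _ (Cn_der hf)).
  by have := Cn_der hg; apply: filterS2 nf => y df dg; exact: der_comp.
apply: CnM; last by case: hg.
by apply: ih; [case: hf|exact: Cn_pred].
Qed.

Lemma Cn_ln n x : 0 < x -> Cn n (@ln R) x.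
Proof.
case: n => // n x0; apply: (@CnS _ _ (fun y => y^-1)).
  have : \forall y \near x, 0 < y by exact: lt_nbhsr.
  by apply: filterS => y y0; exact: is_derive1_ln.
by apply: CnV; [exact: Cn_id|rewrite gt_eqF].
Qed.

Lemma Cn_ps n a x : rad1 a -> `|x| < 1 -> Cn n (ps a) x.
Proof.
elim: n a => // n ih a ra x1; apply: (@CnS _ _ (ps (pseries_diffs a))).
  have : \forall y \near x, `|y| < 1.
    have h : `|y| @[y --> x] --> `|x| by exact: norm_continuous.
    by apply: (cvgr_lt _ h).
  by apply: filterS => y y1; exact: is_derive_ps.
by apply: ih => //; exact: rad1_diffs.
Qed.

Lemma smoothP f : smooth f <-> forall n x, J x -> Cn n f x.
Proof.
have nJ x : @J R x -> \forall y \near x, J y.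
  by move=> Jx; exact: (open_nbhs_nbhs (conj (interval_open _ _) Jx)).
split=> h n x Jx; last first.
  have := h n.+1 x Jx; elim: n f {h} => [|n ih] f.
    by move=> [df _]; exact: nbhs_singleton df.
  by move=> [_ hf]; rewrite derive1Sn; exact: ih.
have {}h k y : J y -> derivable (derive1n k f) y 1 by exact: h.
elim: n f h => // n ih f h; split; last first.
  by apply: ih => k y Jy; rewrite -derive1Sn; exact: h.
by have := nJ x Jx; apply: filterS => y Jy; exact: (h 0%N).
Qed.

End smoothness.

Section cutoff.
Context {R : realType}.
Implicit Types (s x y : R).

Lemma bounded_outside (f : R -> R) : (forall x, {for x, continuous f}) ->
  (forall x, ~~ (0 <= x <= 1) -> `|f x| <= 1) -> exists M, forall x, `|f x| <= M.
Proof.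
move=> cf fo; have cn : {within `[0, 1], continuous (fun x => `|f x|)}.
  apply: continuous_subspaceT => x.
  exact: (continuous_comp (cf x) (@norm_continuous _ _ _)).
have [p _ pmax] := EVT_max ler01 cn.
exists (Num.max 1 `|f p|) => x; rewrite le_max.
have [x01|/fo ->//] := boolP (0 <= x <= 1).
by apply/orP; right; apply: pmax; rewrite in_itv.
Qed.

Variables (c1 c2 : R) (v1 : R -> R).
Hypotheses (hc1 : 0 < c1) (hc12 : c1 < c2) (hc2 : c2 < 1) (hv1 : smooth v1)
  (hv1_left : forall s, 0 < s -> s < c1 -> v1 s = 1)
  (hv1_right : forall s, c2 < s -> s < 1 -> v1 s = 0).

(** Extending [v1] by its boundary values gives a cut-off function that is smooth on
    the whole line. *)
Definition eta x := if x <= 0 then 1 else if 1 <= x then 0 else v1 x.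

Lemma eta1 x : x < c1 -> eta x = 1.
Proof.
move=> xc; rewrite /eta; case: leP => // x0; rewrite leNgt (_ : x < 1)/=.
  exact: hv1_left.
by apply: lt_trans xc _; apply: lt_trans hc2.
Qed.

Lemma eta0 x : c2 < x -> eta x = 0.
Proof.
move=> cx; have x0 : 0 < x by apply: lt_trans cx; apply: lt_trans hc12.
rewrite /eta leNgt x0/=; case: leP => // x1; exact: hv1_right.
Qed.

Lemma eta_v1 x : 0 < x < 1 -> eta x = v1 x.
Proof. by move=> /andP[x0 x1]; rewrite /eta leNgt x0/= leNgt x1. Qed.

Lemma eta_germ x : [\/ \forall y \near x, eta y = 1, \forall y \near x, eta y = 0 |
  (0 < x < 1) /\ \forall y \near x, eta y = v1 y].
Proof.
have [xc|cx] := ltP x c1.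
  by apply: Or31; have := lt_nbhsl xc; apply: filterS => y; exact: eta1.
have [xc|cx'] := ltP c2 x.
  by apply: Or32; have := lt_nbhsr xc; apply: filterS => y; exact: eta0.
have x0 : 0 < x by exact: lt_le_trans cx.
have x1 : x < 1 by exact: le_lt_trans hc2.
apply: Or33; rewrite x0 x1; split => //.
have := lt_nbhsr x0; have := lt_nbhsl x1; apply: filterS2 => y y1 y0.
by rewrite eta_v1// y0.
Qed.

Lemma Cn_eta n x : Cn n eta x.
Proof.
have [h|h|[x01 h]] := eta_germ x.
- apply: (@Cn_near _ _ (fun=> 1)); last exact: Cn_cst.
  by apply: filterS h => y ->.
- apply: (@Cn_near _ _ (fun=> 0)); last exact: Cn_cst.
  by apply: filterS h => y ->.
- apply: (@Cn_near _ _ v1); first by apply: filterS h => y ->.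
  by apply: (smoothP v1).1 => //; rewrite /J/= in_itv.
Qed.

Lemma Cn_continuous (f : R -> R) x : Cn 1 f x -> {for x, continuous f}.
Proof. by move=> /Cn_der/nbhs_singleton; exact: der_continuous. Qed.

Lemma eta_flat x : (x < c1 \/ c2 < x) -> derive1 eta x = 0.
Proof.
move=> [xc|cx]; apply: der_derive1.
  by apply: (der_near _ (der_cst 1 x)); have := lt_nbhsl xc; apply: filterS => y /eta1.
by apply: (der_near _ (der_cst 0 x)); have := lt_nbhsr cx; apply: filterS => y /eta0.
Qed.

Lemma eta_flat2 x : (x < c1 \/ c2 < x) -> derive1 (derive1 eta) x = 0.
Proof.
move=> [xc|cx]; apply: der_derive1.
  apply: (der_near _ (der_cst 0 x)); have := lt_nbhsl xc; apply: filterS => y yc.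
  by rewrite eta_flat//; left.
apply: (der_near _ (der_cst 0 x)); have := lt_nbhsr cx; apply: filterS => y yc.
by rewrite eta_flat//; right.
Qed.

(** Continuous functions that are constant outside [0, 1] are bounded. *)
Lemma eta_bounds : exists2 M, 0 < M & forall x,
  [/\ `|eta x| <= M, `|derive1 eta x| <= M & `|derive1 (derive1 eta) x| <= M].
Proof.
have out x : ~~ (0 <= x <= 1) -> x < c1 \/ c2 < x.
  rewrite negb_and -!ltNge => /orP[x0|x1]; [left|right]; first exact: lt_trans hc1.
  exact: lt_trans x1.
have [M0 H0] := @bounded_outside eta (fun x => Cn_continuous (Cn_eta 1 x))
  (fun x xo => ltac:(by case: (out x xo) => [/eta1|/eta0] ->; rewrite ?normr1 ?normr0)).
have [M1 H1] := @bounded_outside (derive1 eta) (fun x => Cn_continuous (Cn_eta 2 x).2)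
  (fun x xo => ltac:(by rewrite (eta_flat (out x xo)) normr0)).
have [M2 H2] := @bounded_outside (derive1 (derive1 eta))
  (fun x => Cn_continuous (Cn_eta 3 x).2.2)
  (fun x xo => ltac:(by rewrite (eta_flat2 (out x xo)) normr0)).
exists (`|M0| + `|M1| + `|M2| + 1).
  by rewrite ltr_wpDl// !addr_ge0.
move=> x; have a := H0 x; have a1 := H1 x; have a2 := H2 x.
have := ler_norm M0; have := ler_norm M1; have := ler_norm M2.
have := normr_ge0 M0; have := normr_ge0 M1; have := normr_ge0 M2.
by move=> *; split; lra.
Qed.

(** Cutting off on the logarithmic scale makes the derivatives small: they carry a
    factor [1 / N], where [N = n + 1], and live where [s (1 - s) >= e^(- N)], a region
    on which the integrals of [1 / s] and [1 / (1 - s)] are only of order [N]. *)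
Definition chi n s := eta (- ln (s * (1 - s)) / n.+1%:R).

Let u n s := - ln (s * (1 - s)) / n.+1%:R.
Let u1 n s : R := (2 * s - 1) / (s * (1 - s)) / n.+1%:R.
Let u2 n s : R := (1 - 2 * s + 2 * s ^+ 2) / (s * (1 - s)) ^+ 2 / n.+1%:R.

Lemma hump_gt0 s : 0 < s < 1 -> 0 < s * (1 - s).
Proof. by move=> /andP[s0 s1]; rewrite mulr_gt0// subr_gt0. Qed.

Lemma near_01 s : 0 < s < 1 -> \forall y \near s, 0 < y < 1.
Proof.
move=> /andP[s0 s1]; have := lt_nbhsr s0; have := lt_nbhsl s1.
by apply: filterS2 => y -> ->.
Qed.

Lemma der_hump s : is_derive s 1 (fun s => s * (1 - s)) (1 - 2 * s).
Proof.
apply: (der_eq (derM (der_id s) (derB (der_cst 1 s) (der_id s)))); ring.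
Qed.

Lemma Cn_chi k n s : 0 < s < 1 -> Cn k (chi n) s.
Proof.
move=> s01; apply: (Cn_comp (Cn_eta k _)).
have h : Cn k (fun s => n.+1%:R^-1 * (-1 * ln (s * (1 - s)))) s.
  apply: CnZ; apply: CnZ; apply: Cn_comp; first exact/Cn_ln/hump_gt0.
  by apply: CnM; [exact: Cn_id|apply: CnB; [exact: Cn_cst|exact: Cn_id]].
by apply: Cn_near h; exists 1 => //= y _; rewrite mulN1r mulrC.
Qed.

Lemma der_u n s : 0 < s < 1 -> is_derive s 1 (u n) (u1 n s).
Proof.
move=> s01; have p0 := hump_gt0 s01.
have h := derZ (- n.+1%:R^-1) (der_ln (der_hump s) p0).
apply: (der_near _ (der_eq h _)).
  by exists 1 => //= y _; rewrite /u mulNr mulrC mulNr.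
have /andP[s0 s1] := s01.
by rewrite /u1; field; rewrite subr_eq0 !gt_eqF// addrC natr1 ltr0n.
Qed.

Lemma der_u1 n s : 0 < s < 1 -> is_derive s 1 (u1 n) (u2 n s).
Proof.
move=> s01; have p0 := hump_gt0 s01; have pn : s * (1 - s) != 0 by rewrite gt_eqF.
have h := derM (derM (derB (derZ 2 (der_id s)) (der_cst 1 s)) (derV (der_hump s) pn))
  (der_cst n.+1%:R^-1 s).
have /andP[s0 s1] := s01.
by apply: (der_eq h); rewrite /u2; field; rewrite subr_eq0 !gt_eqF// addrC natr1 ltr0n.
Qed.

Lemma derive1_chi n s : 0 < s < 1 -> derive1 (chi n) s = derive1 eta (u n s) * u1 n s.
Proof.
move=> s01; apply: der_derive1; apply: der_comp (der_u n s01).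
exact: nbhs_singleton (Cn_der (Cn_eta 1 _)).
Qed.

Lemma derive2_chi n s : 0 < s < 1 -> derive1 (derive1 (chi n)) s =
  derive1 (derive1 eta) (u n s) * u1 n s ^+ 2 + derive1 eta (u n s) * u2 n s.
Proof.
move=> s01; apply: der_derive1.
have e : \forall y \near s, derive1 eta (u n y) * u1 n y = derive1 (chi n) y.
  by apply: filterS (near_01 s01) => y y01; rewrite derive1_chi.
apply: (der_near e).
have h : is_derive (u n s) 1 (derive1 eta) (derive1 (derive1 eta) (u n s)).
  have h1 : Cn 1 (derive1 eta) (u n s) by exact: (Cn_eta 2 _).2.
  exact: nbhs_singleton (Cn_der h1).
apply: (der_eq (derM (der_comp h (der_u n s01)) (der_u1 n s01))); ring.
Qed.

Lemma chi_bounds : exists2 M, 0 < M & forall n s, 0 < s < 1 ->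
  [/\ `|chi n s| <= M, `|derive1 (chi n) s| <= M / (s * (1 - s)) / n.+1%:R &
    `|derive1 (derive1 (chi n)) s| <= M / (s * (1 - s)) ^+ 2 / n.+1%:R].
Proof.
have [M M0 HM] := eta_bounds; exists (2 * M); first by rewrite mulr_gt0.
move=> n s s01; have [a0 a1 a2] := HM (u n s).
have p0 := hump_gt0 s01; have n0 : 0 < n.+1%:R :> R by rewrite ltr0n.
have n1 : n.+1%:R^-1 <= 1 :> R by rewrite invf_le1// ler1n.
have /andP[s0 s1] := s01.
have u1b : `|u1 n s| <= 1 / (s * (1 - s)) / n.+1%:R.
  rewrite /u1 !normrM !normfV (gtr0_norm n0) (gtr0_norm p0).
  rewrite !ler_pM2r ?invr_gt0// ler_norml; apply/andP; split; lra.
have u2b : `|u2 n s| <= 1 / (s * (1 - s)) ^+ 2 / n.+1%:R.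
  rewrite /u2 !normrM !normfV (gtr0_norm n0) (gtr0_norm (exprn_gt0 2 p0)).
  rewrite !ler_pM2r ?invr_gt0 ?exprn_gt0// ler_norml.
  by apply/andP; split; nra.
split.
- by rewrite /chi -/(u n s); lra.
- rewrite derive1_chi// normrM; apply: le_trans (ler_pM _ _ a1 u1b) _ => //.
  rewrite !mulrA mulr1 !ler_pM2r ?invr_gt0//; lra.
- rewrite derive2_chi//; apply: le_trans (ler_normD _ _) _.
  have b1 : `|derive1 (derive1 eta) (u n s) * u1 n s ^+ 2| <=
      M * (1 / (s * (1 - s)) ^+ 2 / n.+1%:R).
    rewrite normrM; apply: ler_pM => //; rewrite normrX.
    apply: (@le_trans _ _ ((1 / (s * (1 - s)) / n.+1%:R) ^+ 2)).
      by rewrite ler_pXn2r ?nnegrE// divr_ge0 ?(ltW n0)// divr_ge0// ltW.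
    have -> : (1 / (s * (1 - s)) / n.+1%:R) ^+ 2 =
        1 / (s * (1 - s)) ^+ 2 / n.+1%:R * n.+1%:R^-1 :> R.
      by rewrite !expr2 !invfM; ring.
    by rewrite ler_piMr// divr_ge0 ?(ltW n0)// divr_ge0// exprn_ge0// ltW.
  have b2 : `|derive1 eta (u n s) * u2 n s| <= M * (1 / (s * (1 - s)) ^+ 2 / n.+1%:R).
    by rewrite normrM; apply: ler_pM.
  apply: le_trans (lerD b1 b2) _; rewrite le_eqVlt; apply/orP; left; apply/eqP; ring.
Qed.

Lemma chi_flat n s : 0 < s < 1 -> s * (1 - s) < expR (- n.+1%:R) ->
  [/\ chi n s = 0, derive1 (chi n) s = 0 & derive1 (derive1 (chi n)) s = 0].
Proof.
move=> s01 sn; have p0 := hump_gt0 s01.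
have n0 : 0 < n.+1%:R :> R by rewrite ltr0n.
have cu : c2 < u n s.
  apply: lt_trans hc2 _; rewrite /u ltr_pdivlMr// mul1r ltrNr.
  by rewrite -(expRK (- n.+1%:R)) ltr_ln ?posrE ?expR_gt0.
split; first exact: eta0.
- by rewrite derive1_chi// eta_flat ?mul0r//; right.
- by rewrite derive2_chi// eta_flat ?eta_flat2 ?mul0r ?addr0//; right.
Qed.

Lemma chi_eventually1 r : 0 < r -> \forall n \near \oo,
  forall s, 0 < s < 1 -> r <= s * (1 - s) -> chi n s = 1.
Proof.
move=> r0; exists (Num.bound `|- ln r / c1|) => // n /= Nn s s01 rs.
have p0 := hump_gt0 s01; have n0 : 0 < n.+1%:R :> R by rewrite ltr0n.
apply: eta1; rewrite ltr_pdivrMr//.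
have h1 : - ln (s * (1 - s)) <= - ln r by rewrite lerN2 ler_ln ?posrE.
apply: le_lt_trans h1 _; rewrite mulrC -ltr_pdivrMr//.
apply: le_lt_trans (ler_norm _) _; apply: lt_le_trans (archi_boundP (normr_ge0 _)) _.
by rewrite ler_nat ltnW.
Qed.

End cutoff.

(** * The weighted Hilbert space *)

Section weighted_L2.
Context {R : realType}.
Implicit Types (f g h : R -> R) (s : R).

Local Notation leb := (@lebesgue_measure R).

Variables (b : nat -> R) (m : R).
Hypothesis sub : subcritical b m.

Local Notation w := (weight b).
Local Notation mfunJ := (measurable_fun (@J R : set (measurableTypeR R))).
Local Notation mJ := (@measurable_J R).

Lemma weightJ_gt0 s : J s -> 0 < w s.
Proof. by move=> Js; exact: (weight_gt0 sub (J_itvW Js)). Qed.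

Lemma measurable_weight : mfunJ w.
Proof. by apply: measurable_J_of_cont => s; exact: (weight_continuous sub). Qed.

Lemma L2_measurable f : L2 b f -> mfunJ f.
Proof. by case. Qed.

Lemma ip_measurable f g : L2 b f -> L2 b g -> mfunJ (EFin \o (fun s => f s * g s * w s)).
Proof.
move=> /L2_measurable mf /L2_measurable mg; apply/measurable_EFinP.
by apply: measurable_funM; [exact: measurable_funM|exact: measurable_weight].
Qed.

Lemma sq_measurable f : L2 b f -> mfunJ (fun s => ((f s) ^+ 2 * w s)%:E).
Proof.
move=> /L2_measurable mf; apply/measurable_EFinP.
by apply: measurable_funM; [exact: measurable_funX|exact: measurable_weight].
Qed.

Lemma L2_integrable_sq f : L2 b f -> leb.-integrable (@J R) (EFin \o (fun s => f s * f s * w s)).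
Proof.
move=> Lf; apply/integrableP; split; first exact: ip_measurable.
apply: le_lt_trans Lf.2; rewrite le_eqVlt; apply/orP; left; apply/eqP.
apply: eq_integral => s; rewrite inE => Js /=.
by rewrite ger0_norm// -expr2 mulr_ge0 ?sqr_ge0// ltW// weightJ_gt0.
Qed.

Lemma L2_integrable f g : L2 b f -> L2 b g ->
  leb.-integrable (@J R) (EFin \o (fun s => f s * g s * w s)).
Proof.
move=> Lf Lg.
apply: (le_integrable mJ (ip_measurable Lf Lg) _
  (integrableD mJ (L2_integrable_sq Lf) (L2_integrable_sq Lg))).
move=> s Js; have w0 := weightJ_gt0 Js.
rewrite /= lee_fin [leRHS]ger0_norm; last first.
  by rewrite addr_ge0// -expr2 mulr_ge0 ?sqr_ge0// ltW.
rewrite -mulrDl normrM (gtr0_norm w0) ler_pM2r// ler_norml.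
have := sqr_ge0 (f s + g s); have := sqr_ge0 (f s - g s).
have := sqr_ge0 (f s); have := sqr_ge0 (g s).
by rewrite !expr2 => *; apply/andP; split; lra.
Qed.

Definition ip f g : R := \int[leb]_(s in @J R) (f s * g s * w s).

Lemma eq_ip f f' g g' : (forall s, J s -> f s = f' s) -> (forall s, J s -> g s = g' s) ->
  ip f g = ip f' g'.
Proof.
move=> ff' gg'; apply: eq_Rintegral => s; rewrite inE => Js.
by rewrite ff'// gg'.
Qed.

Lemma sqnormE f : L2 b f -> sqnorm b f = (ip f f)%:E.
Proof.
move=> Lf; rewrite /ip /Rintegral fineK; last first.
  by have := integrable_fin_num mJ (L2_integrable_sq Lf).
by apply: eq_integral => s _; rewrite expr2.
Qed.

Lemma sqnorm_ge0 f : (0 <= sqnorm b f)%E.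
Proof.
apply: integral_ge0 => s Js; rewrite lee_fin mulr_ge0 ?sqr_ge0// ltW//.
exact: weightJ_gt0.
Qed.

Lemma ip_ge0 f : 0 <= ip f f.
Proof.
apply: Rintegral_ge0 => s Js; rewrite -expr2 mulr_ge0 ?sqr_ge0// ltW//.
exact: weightJ_gt0.
Qed.

Lemma ipC f g : ip f g = ip g f.
Proof. by apply: eq_Rintegral => s _; rewrite [f s * _]mulrC. Qed.

Lemma ipZl k f g : L2 b f -> L2 b g -> ip (fun s => k * f s) g = k * ip f g.
Proof.
move=> Lf Lg; rewrite /ip -(RintegralZl _ mJ (L2_integrable Lf Lg)).
by apply: eq_Rintegral => s _; rewrite !mulrA.
Qed.

Lemma ipDl f f' g : L2 b f -> L2 b f' -> L2 b g ->
  ip (fun s => f s + f' s) g = ip f g + ip f' g.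
Proof.
move=> Lf Lf' Lg; rewrite /ip -(RintegralD mJ (L2_integrable Lf Lg) (L2_integrable Lf' Lg)).
by apply: eq_Rintegral => s _; rewrite !mulrDl.
Qed.

Lemma sqnormD_le f g : L2 b f -> L2 b g ->
  (sqnorm b (fun s => (f s + g s)%R) <= (2 * ip f f + 2 * ip g g)%:E)%E.
Proof.
move=> Lf Lg; rewrite EFinD !EFinM -!sqnormE// -!ge0_integralZl//.
all: try (move=> s Js; rewrite lee_fin mulr_ge0 ?sqr_ge0// ltW//; exact: weightJ_gt0).
all: try exact: mJ.
2,3: exact: sq_measurable.
rewrite -ge0_integralD//=.
2: exact: mJ.
2,4: move=> s Js; apply: mule_ge0 => //; rewrite lee_fin mulr_ge0 ?sqr_ge0// ltW//; exact: weightJ_gt0.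
2,3: by apply: measurable_funeM; exact: sq_measurable.
apply: le_ge0_integral => // s Js; have w0 := weightJ_gt0 Js.
- by rewrite lee_fin mulr_ge0 ?sqr_ge0// ltW.
- by rewrite -!EFinM -EFinD lee_fin addr_ge0// mulr_ge0// mulr_ge0 ?sqr_ge0// ltW.
- rewrite -!EFinM -EFinD lee_fin !mulrA -mulrDl ler_pM2r//.
  by have := sqr_ge0 (f s - g s); rewrite !expr2; lra.
Qed.

Lemma L2D f g : L2 b f -> L2 b g -> L2 b (fun s => f s + g s).
Proof.
move=> Lf Lg; split.
  have h : mfunJ (fun s => f s + g s).
    by apply: measurable_funD; exact: L2_measurable.
  exact: h.
by apply: le_lt_trans (sqnormD_le Lf Lg) _; rewrite ltry.
Qed.

Lemma sqnormZ k f : L2 b f -> sqnorm b (fun s => k * f s) = (k ^+ 2 * ip f f)%:E.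
Proof.
move=> Lf; rewrite EFinM -sqnormE// -ge0_integralZl//.
- by apply: eq_integral => s _; rewrite exprMn -mulrA EFinM.
- exact: mJ.
- exact: sq_measurable.
- by move=> s Js; rewrite lee_fin mulr_ge0 ?sqr_ge0// ltW//; exact: weightJ_gt0.
- by rewrite lee_fin sqr_ge0.
Qed.

Lemma L2Z k f : L2 b f -> L2 b (fun s => k * f s).
Proof.
move=> Lf; split.
  have h : mfunJ (fun s => k * f s).
    by apply: measurable_funM; [exact: measurable_cst|exact: L2_measurable].
  exact: h.
by rewrite (sqnormZ k Lf) ltry.
Qed.

Lemma L2B f g : L2 b f -> L2 b g -> L2 b (fun s => f s - g s).
Proof.
move=> Lf /(L2Z (-1)) Lg; have := L2D Lf Lg.
by under eq_fun do rewrite mulN1r.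
Qed.

(** A weighted form of the Cauchy-Schwarz inequality, enough for continuity. *)
Lemma ip_young e f g : 0 < e -> L2 b f -> L2 b g ->
  `|ip f g| <= (e * ip f f + ip g g / e) / 2.
Proof.
move=> e0 Lf Lg.
have expand k : ip (fun s => k * f s + g s) (fun s => k * f s + g s) =
    k ^+ 2 * ip f f + 2 * k * ip f g + ip g g.
  have Lk := L2Z k Lf.
  have Ls := L2D Lk Lg.
  rewrite (ipDl Lk Lg Ls) (ipZl k Lf Ls) [ip f _]ipC [ip g (fun s => _)]ipC.
  rewrite (ipDl Lk Lg Lf) (ipDl Lk Lg Lg) (ipZl k Lf Lf) (ipZl k Lf Lg) [ip g f]ipC.
  ring.
have h1 := ip_ge0 (fun s => e * f s + g s); have h2 := ip_ge0 (fun s => - e * f s + g s).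
rewrite !expand in h1 h2.
rewrite ler_norml -mulNr ler_pdivlMr// ler_pdivrMr// -(ler_pM2r e0) -[X in _ && X](ler_pM2r e0).
have -> : (e * ip f f + ip g g / e) * e = e ^+ 2 * ip f f + ip g g by field; rewrite gt_eqF.
have -> : - (e * ip f f + ip g g / e) * e = - (e ^+ 2 * ip f f + ip g g) by field; rewrite gt_eqF.
rewrite sqrrN in h2.
by apply/andP; split; lra.
Qed.

Lemma L2cvg_ip0 (f : nat -> R -> R) g : (forall n, L2 b (f n)) -> L2 b g ->
  L2cvg b f g <->
  ip (fun s => f n s - g s) (fun s => f n s - g s) @[n --> \oo] --> (0 : R).
Proof.
move=> Lf Lg; rewrite /L2cvg; have -> : (fun n => sqnorm b (fun s => f n s - g s)) =
    EFin \o (fun n => ip (fun s => f n s - g s) (fun s => f n s - g s)).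
  by apply/funext => n /=; rewrite sqnormE//; exact: L2B.
split; last by move=> h; apply: cvg_EFin => //; exact: nearW.
by move/fine_cvgP => [_].
Qed.

(** The product of the differences and the two mixed terms are estimated with
    [ip_young], with a weight small enough for the mixed terms. *)
Lemma L2cvg_ip (f g : nat -> R -> R) F G : (forall n, L2 b (f n)) -> (forall n, L2 b (g n)) ->
  L2 b F -> L2 b G -> L2cvg b f F -> L2cvg b g G ->
  ip (f n) (g n) @[n --> \oo] --> ip F G.
Proof.
move=> Lf Lg LF LG /(L2cvg_ip0 Lf LF) cf /(L2cvg_ip0 Lg LG) cg.
apply/cvgrPdist_le => eps eps0.
have F0 := ip_ge0 F; have G0 := ip_ge0 G.
pose e := eps / (1 + ip F F + ip G G).
have d0 : 0 < 1 + ip F F + ip G G by rewrite -addrA ltr_pwDl// addr_ge0.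
have e0 : 0 < e by rewrite divr_gt0.
have ed : e * (1 + ip F F + ip G G) = eps by rewrite /e divfK// gt_eqF.
pose d := eps / (2 * (1 + 1 / e)).
have e1 : 0 < 1 + 1 / e by rewrite ltr_pwDl// divr_ge0// ltW.
have dd0 : 0 < d by rewrite divr_gt0// mulr_gt0.
have dE : d * (2 * (1 + 1 / e)) = eps by rewrite /d divfK// gt_eqF// mulr_gt0.
move/cvgr0Pnorm_le : cf => /(_ d dd0) cf; move/cvgr0Pnorm_le : cg => /(_ d dd0) cg.
apply: filterS2 cf cg => n an bn.
rewrite ger0_norm ?ip_ge0// in an; rewrite ger0_norm ?ip_ge0// in bn.
pose df s := f n s - F s; pose dg s := g n s - G s.
have Ldf : L2 b df by exact: L2B.
have Ldg : L2 b dg by exact: L2B.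
have -> : ip (f n) (g n) = ip df dg + ip df G + ip F dg + ip F G.
  have -> : ip (f n) (g n) = ip (fun s => df s + F s) (fun s => dg s + G s).
    by apply: eq_ip => s _; rewrite /df /dg subrK.
  have Ls := L2D Ldg LG.
  rewrite (ipDl Ldf LF Ls) [ip df (fun s => _)]ipC [ip F (fun s => _)]ipC.
  rewrite (ipDl Ldg LG Ldf) (ipDl Ldg LG LF).
  rewrite [ip dg df]ipC [ip dg F]ipC [ip G df]ipC [ip G F]ipC; ring.
rewrite -/df -/dg in an bn.
have y1 := ip_young ltr01 Ldf Ldg; have y2 := ip_young e0 LG Ldf.
have y3 := ip_young e0 LF Ldg; rewrite [ip G df]ipC in y2.
have -> : ip F G - (ip df dg + ip df G + ip F dg + ip F G) =
  - (ip df dg + ip df G + ip F dg) by ring.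
rewrite normrN; apply: le_trans (ler_normD _ _) _.
apply: le_trans (lerD (ler_normD _ _) (lexx _)) _.
have q1 : ip df df / e <= d * (1 / e) by rewrite div1r ler_pM2r ?invr_gt0.
have q2 : ip dg dg / e <= d * (1 / e) by rewrite div1r ler_pM2r ?invr_gt0.
move: dE q1 q2 y1 y2 y3; rewrite mulrDr mulr1 divr1 mul1r.
move: (1 / e) => ie; move: (ip df df / e) (ip dg dg / e) => i1 i2.
move: an bn ed; rewrite !mulrDr mulr1.
move: (ip df df) (ip dg dg) => a1 a2 an bn ed dE q1 q2 y1 y2 y3.
rewrite mulrA mulr1 in dE.
lra.
Qed.

End weighted_L2.

(** * Quasi-derivatives, Green and Picone formulas *)

Section absolute_continuity.
Context {R : realType}.
Implicit Types (a c x y : R) (f g : R -> R).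

Local Notation leb := (@lebesgue_measure R).

Lemma ac_clamp_continuous a c f : a <= c -> abs_continuous a c f ->
  forall x, {for x, continuous (fun x => f (clamp a c x))}.
Proof.
move=> ac acf x; apply/cvgrPdist_lt => e e0.
have [d d0 H] := abs_continuous_uniform acf e0.
exists d => // y /= xy.
wlog le : x y xy / x <= y.
  move=> wl; have [xly|/ltW yx] := leP x y; first exact: wl.
  by rewrite distrC; apply: wl => //; rewrite distrC.
have /andP[x1 x2] := clamp_itv x ac; have /andP[y1 y2] := clamp_itv y ac.
rewrite distrC; apply: H => //; first exact: clamp_le.
apply: le_lt_trans (clamp_dist a c le) _.
by apply: le_lt_trans xy; rewrite distrC ler_norm.
Qed.

Lemma ac_bounded a c f : a <= c -> abs_continuous a c f ->
  exists2 M, 0 < M & forall x, a <= x <= c -> `|f x| <= M.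
Proof.
move=> ac acf; have cn : {within `[a, c], continuous (fun x => `|f (clamp a c x)|)}.
  apply: continuous_subspaceT => x.
  exact: (continuous_comp (ac_clamp_continuous ac acf (x := x)) (@norm_continuous _ _ _)).
have [p _ pmax] := EVT_max ac cn.
exists (`|f (clamp a c p)| + 1); first by rewrite ltr_wpDl.
move=> x /andP[ax xc]; have := pmax x; rewrite in_itv/= ax xc clamp_id// => /(_ isT) h.
by rewrite ler_wpDr.
Qed.

Lemma ac_lipschitz a c f K : (forall x y, a <= x -> x <= y -> y <= c ->
  `|f y - f x| <= K * (y - x)) -> abs_continuous a c f.
Proof.
move=> Kf e e0; have K1 : 0 < `|K| + 1 by rewrite ltr_wpDl.
exists (e / (`|K| + 1)); first by rewrite divr_gt0.
move=> n x y h _; rewrite ltr_pdivlMr// mulrC; apply: le_lt_trans.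
rewrite big_distrr/=; apply: ler_sum => k _; have [xk xyk yk] := h k.
apply: le_trans (Kf _ _ xk xyk yk) _; rewrite ler_wpM2r ?subr_ge0//.
by rewrite ler_wpDr// ler_norm.
Qed.

Lemma ac_C1 a c f df : (forall x, a <= x <= c -> is_derive x 1 f (df x)) ->
  (forall x, a <= x <= c -> {for x, continuous df}) -> abs_continuous a c f.
Proof.
move=> hf hd; have [ca|ac] := ltP c a.
  apply: (@ac_lipschitz _ _ _ 0) => x y ax xy yc.
  by have := lt_le_trans ca (le_trans ax (le_trans xy yc)); rewrite ltxx.
have cn : {within `[a, c], continuous (fun x => `|df x|)}.
  apply: within_itv_continuous => x xac.
  exact: (continuous_comp (hd x xac) (@norm_continuous _ _ _)).
have [p _ pmax] := EVT_max ac cn.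
apply: (@ac_lipschitz _ _ _ `|df p|) => x y ax.
rewrite le_eqVlt => /predU1P[->|xy] yc; first by rewrite !subrr normr0 mulr0.
have sub z : x <= z <= y -> a <= z <= c.
  by move=> /andP[xz zy]; rewrite (le_trans ax xz) (le_trans zy yc).
have [| |z zxy ->] := @MVT _ f df x y xy.
- by move=> z; rewrite in_itv/= => /andP[xz zy]; apply/hf/sub; rewrite !ltW.
- apply: within_itv_continuous => z /sub/hf; exact: der_continuous.
rewrite normrM [`|y - x|]gtr0_norm ?subr_gt0// ler_pM2r ?subr_gt0//.
move: zxy; rewrite in_itv/= => /andP[xz zy].
by apply: pmax; rewrite in_itv/=; apply: sub; rewrite !ltW.
Qed.

Lemma ac_mul a c f g : a <= c -> abs_continuous a c f -> abs_continuous a c g ->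
  abs_continuous a c (fun x => f x * g x).
Proof.
move=> ac acf acg e e0.
have [M M0 HM] := ac_bounded ac acf; have [N N0 HN] := ac_bounded ac acg.
have e1 : 0 < e / 2 / N by rewrite !divr_gt0.
have e2 : 0 < e / 2 / M by rewrite !divr_gt0.
have [d d0 H] := acf _ e1; have [d' d'0 H'] := acg _ e2.
exists (Num.min d d') => [|n x y h1 h2]; first by rewrite lt_min d0.
rewrite lt_min => /andP[h3 h4].
have {}H := H n x y h1 h2 h3; have {}H' := H' n x y h1 h2 h4.
rewrite ltr_pdivlMr// mulrC in H; rewrite ltr_pdivlMr// mulrC in H'.
rewrite [e]splitr; apply: le_lt_trans (ltrD H H').
rewrite !big_distrr/= -big_split/=; apply: ler_sum => k _.
have [xk xyk yk] := h1 k.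
have -> : f (y k) * g (y k) - f (x k) * g (x k) =
  g (y k) * (f (y k) - f (x k)) + f (x k) * (g (y k) - g (x k)) by ring.
apply: le_trans (ler_normD _ _) _; rewrite !normrM; apply: lerD; apply: ler_wpM2r => //.
  by apply: HN; rewrite yk (le_trans xk).
by apply: HM; rewrite xk (le_trans xyk).
Qed.

Lemma ae_neq a : {ae leb, forall x, x <> a}.
Proof.
exists [set a]; split => //.
- by have := lebesgue_measure_set1 a.
- by move=> x /= /contrapT.
Qed.

Lemma ae_Rintegral_ge0 (D : set (measurableTypeR R)) f : measurable D ->
  leb.-integrable D (EFin \o f) -> {ae leb, forall x, D x -> 0 <= f x} ->
  0 <= \int[leb]_(x in D) f x.
Proof.
move=> mD fi f0.
have -> : \int[leb]_(x in D) f x = \int[leb]_(x in D) `|f x|.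
  have mf := measurable_int _ fi; congr fine; apply: ae_eq_integral => //.
    by apply/measurable_EFinP; apply: measurableT_comp => //; exact/measurable_EFinP.
  apply: filterS f0; first exact: (ae_filter_ringOfSetsType leb).
  by move=> x h Dx /=; rewrite ger0_norm// h.
by apply: Rintegral_ge0.
Qed.

Lemma ae_le_Rintegral (D : set (measurableTypeR R)) f g : measurable D ->
  leb.-integrable D (EFin \o f) -> leb.-integrable D (EFin \o g) ->
  {ae leb, forall x, D x -> f x <= g x} ->
  \int[leb]_(x in D) f x <= \int[leb]_(x in D) g x.
Proof.
move=> mD fi gi fg; rewrite -subr_ge0 -RintegralB//; apply: ae_Rintegral_ge0 => //.
  by apply: eq_integrable (integrableB mD gi fi).
apply: filterS fg; first exact: (ae_filter_ringOfSetsType leb).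
by move=> x h Dx; rewrite subr_ge0 h.
Qed.

(** A function bounding minus the derivative of an absolutely continuous [G]
    from above has at least the integral given by the boundary values. *)
Lemma ac_integral_ge a c (G X : R -> R) : a < c -> abs_continuous a c G ->
  leb.-integrable (`]a, c]%classic : set (measurableTypeR R)) (EFin \o X) ->
  {ae leb, forall s, a < s < c -> exists2 g, is_derive s 1 G g & - g <= X s} ->
  G a - G c <= \int[leb]_(s in `]a, c]) X s.
Proof.
move=> ac acG Xi h; have [r [ri rE rd]] := abs_continuous_FTC ac acG.
have mI : measurable (`]a, c]%classic : set (measurableTypeR R)).
  exact: (measurable_itv `]a, c]).
have ri' : leb.-integrable (`]a, c]%classic : set (measurableTypeR R)) (EFin \o r).
  exact: integrableS ri.
have -> : G a - G c = \int[leb]_(s in `]a, c]) - r s.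
  have := rE c (ltW ac) (lexx _) => E.
  have -> : G a - G c = - (G c - G a) by rewrite opprB.
  rewrite E -mulN1r -(RintegralZl _ mI ri').
  by apply: eq_Rintegral => s _; rewrite mulN1r.
apply: ae_le_Rintegral => //.
  by apply: eq_integrable (integrableN ri').
have F := ae_filter_ringOfSetsType leb.
have := ae_neq c; apply: filterS3 rd h => s /= rd h sc.
rewrite in_itv/= => /andP[as_]; rewrite le_eqVlt => /predU1P[//|sc'].
have [|g dg gX] := h _; first by rewrite as_.
have := rd; rewrite in_itv/= as_ sc' => /(_ isT) dr.
by rewrite -(der_derive1 dr) (der_derive1 dg).
Qed.

(** The derivative of an absolutely continuous function that agrees with a
    continuous function wherever it exists, exists everywhere. *)
Lemma ac_derivable a c f q : a < c -> abs_continuous a c f ->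
  (forall x, {for x, continuous q}) ->
  (forall x d, a < x < c -> is_derive x 1 f d -> d = q x) ->
  forall x, a < x < c -> is_derive x 1 f (q x).
Proof.
move=> ac acf cq dq x /andP[ax xc].
have [r [ri rE rd]] := abs_continuous_FTC ac acf.
have qi u v : leb.-integrable (`]u, v]%classic : set (measurableTypeR R)) (EFin \o q).
  have m1 : measurable (`[u, v]%classic : set (measurableTypeR R)).
    exact: (measurable_itv `[u, v]).
  have m2 : measurable (`]u, v]%classic : set (measurableTypeR R)).
    exact: (measurable_itv `]u, v]).
  apply: (integrableS m1 m2).
    by move=> z /=; rewrite !in_itv/= => /andP[/ltW -> ->].
  apply: continuous_compact_integrable; first exact: segment_compact.
  by apply: continuous_subspaceT.
have fE y : a <= y -> y <= c -> f y = f a + \int[leb]_(z in `]a, y]) q z.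
  move=> ay yc; have := rE y ay yc => E; apply/eqP; rewrite addrC -subr_eq E; apply/eqP.
  have mI : measurable (`]a, y]%classic : set (measurableTypeR R)).
    exact: (measurable_itv `]a, y]).
  congr fine; apply: ae_eq_integral => //.
  - by apply: (measurable_int leb); apply: integrableS ri.
  - exact: (measurable_int leb) (qi a y).
  have F := ae_filter_ringOfSetsType leb.
  have := ae_neq c; apply: filterS2 rd => z /= rd zc.
  rewrite in_itv/= => /andP[az zy]; congr (_%:E).
  have zc' : z < c by rewrite lt_neqAle (le_trans zy yc) andbT; apply/eqP.
  apply: dq; first by rewrite az.
  by apply: rd; rewrite in_itv/= az.
pose F y := f a + \int[leb]_(t in `]a, y]) q t.
have dF : is_derive x 1 F (q x).
  have [dx dE] := continuous_FTC1 xc (qi a c) (ax : (BRight a < BRight x)%O) (cq x).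
  apply: (der_eq (derD (der_cst (f a) x) _)); last by rewrite add0r.
  by apply: (DeriveDef dx); rewrite -derive1E.
apply: (der_near _ dF).
have := lt_nbhsr ax; have := lt_nbhsl xc; apply: filterS2 => y yc ay.
by rewrite /F -fE// ltW.
Qed.

End absolute_continuity.

Section quasi_derivatives.
Context {R : realType}.
Implicit Types (h F D u psi : R -> R) (s a c : R).

Local Notation leb := (@lebesgue_measure R).

Lemma AC_loc_continuous F s : AC_loc F -> J s -> {for s, continuous F}.
Proof.
move=> acF /J_itv/andP[s0 s1]; pose a := s / 2; pose c := (1 + s) / 2.
have h : [/\ 0 < a, a < s, s < c & c < 1] by rewrite /a /c; split; lra.
have [a0 as_ sc c1] := h; have ac : a < c by exact: lt_trans sc.
have cl : F (clamp a c x) @[x --> s] --> F (clamp a c s).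
  exact: (ac_clamp_continuous (ltW ac) (acF a c a0 ac c1) (x := s)).
rewrite (clamp_id (ltW as_) (ltW sc)) in cl; apply: cvg_trans cl.
apply: near_eq_cvg; have := lt_nbhsr as_; have := lt_nbhsl sc.
by apply: filterS2 => y yc ay; rewrite clamp_id ?ltW.
Qed.

Lemma AC_loc_ae_derivable F : AC_loc F ->
  {ae leb, forall s, J s -> is_derive s 1 F (derive1 F s)}.
Proof.
move=> acF.
have Hn : forall n : nat, {ae leb, forall s, s \in `]n.+3%:R^-1, (1 - n.+3%:R^-1)[ ->
    is_derive s 1 F (derive1 F s)}.
  move=> n; have n0 : 0 < n.+3%:R^-1 :> R by rewrite invr_gt0.
  have n1 : n.+3%:R^-1 < 1 - n.+3%:R^-1 :> R.
    suff : n.+3%:R^-1 < 2^-1 :> R by move: (n.+3%:R^-1) => p; lra.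
    by rewrite ltf_pV2 ?posrE// ltr_nat.
  have n2 : 1 - n.+3%:R^-1 < 1 :> R by rewrite ltrBlDr ltrDl.
  have [r [_ _ rd]] := abs_continuous_FTC n1 (acF _ _ n0 n1 n2).
  apply: filterS rd; first exact: (ae_filter_ringOfSetsType leb).
  by move=> s /= h sI; have dr := h sI; rewrite (der_derive1 dr).
have H : {ae leb, forall s (n : nat), s \in `]n.+3%:R^-1, (1 - n.+3%:R^-1)[ ->
    is_derive s 1 F (derive1 F s)}.
  exact: (ae_foralln Hn).
apply: filterS H; first exact: (ae_filter_ringOfSetsType leb).
move=> s /= H /J_itv/andP[s0 s1].
have p0 : 0 < Num.min s (1 - s) by rewrite lt_min s0 subr_gt0.
pose n := Num.bound (Num.min s (1 - s))^-1.
apply: (H n); rewrite in_itv/=.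
have : n.+3%:R^-1 < Num.min s (1 - s).
  rewrite invf_plt ?posrE//; apply: lt_trans (archi_boundP _) _.
    by rewrite invr_ge0 ltW.
  by rewrite ltr_nat ltnS leqW.
by rewrite lt_min => /andP[-> h]/=; rewrite ltrBrDl -ltrBrDr.
Qed.

(** [h] has quasi-derivative [F = s h'], and [D] is the derivative of [F] almost
    everywhere. Unlike [derive1], which takes a default value at the exceptional
    points, this is stable under linear combinations. *)
Definition quasi h F D := [/\ (forall s, J s -> is_derive s 1 h (F s / s)),
  AC_loc F & {ae leb, forall s, J s -> is_derive s 1 F (D s)}].

(** Where [y] is differentiable its derivative is [qderiv y s / s], which is
    continuous; hence [y] is differentiable everywhere. *)
Lemma Dmax_quasi (b : nat -> R) y : Dmax b y -> quasi y (qderiv y) (derive1 (qderiv y)).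
Proof.
move=> [_ acy acF _]; split => //; last exact: AC_loc_ae_derivable.
move=> s /J_itv/andP[s0 s1]; pose a := s / 2; pose c := (1 + s) / 2.
have h : [/\ 0 < a, a < s, s < c & c < 1] by rewrite /a /c; split; lra.
have [a0 as_ sc c1] := h; have ac : a < c by exact: lt_trans sc.
pose q x := qderiv y (clamp a c x) / clamp a c x.
have qE x : a < x < c -> q x = qderiv y x / x.
  by move=> /andP[ax xc]; rewrite /q clamp_id ?ltW.
have sac : a < s < c by rewrite as_.
rewrite -qE//; apply: (ac_derivable ac (acy a c a0 ac c1)) sac => [x|x d xac dy].
  have := ac_clamp_continuous (ltW ac) (acF a c a0 ac c1) (x := x).
  have := @ac_clamp_continuous _ a c (fun x => x) (ltW ac) _ x.
  move=> h1 h2; have /andP[ca _] := clamp_itv x (ltW ac).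
  apply: cvgM; first exact: h2.
  apply: cvgV; first by rewrite gt_eqF// (lt_le_trans a0).
  apply: h1; apply: (@ac_lipschitz _ _ _ _ 1) => u v _ uv _.
  by rewrite mul1r ger0_norm// subr_ge0.
rewrite qE// /qderiv (der_derive1 dy) mulrC mulKf// gt_eqF//.
by case/andP : xac => ax _; exact: lt_trans ax.
Qed.

Lemma quasi_ac h F D a c : quasi h F D -> 0 < a -> c < 1 -> abs_continuous a c h.
Proof.
move=> [dh acF _] a0 c1; apply: (@ac_C1 _ _ _ _ (fun s => F s / s)).
  by move=> x /andP[ax xc]; apply: dh; rewrite /J/= in_itv/= (lt_le_trans a0)// (le_lt_trans xc).
move=> x /andP[ax xc]; apply: cvgM.
  by apply: AC_loc_continuous => //; rewrite /J/= in_itv/= (lt_le_trans a0)// (le_lt_trans xc).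
by apply: cvgV => //; rewrite gt_eqF// (lt_le_trans a0).
Qed.

Lemma quasiDZ h F D h' F' D' k : quasi h F D -> quasi h' F' D' ->
  quasi (fun s => h s + k * h' s) (fun s => F s + k * F' s) (fun s => D s + k * D' s).
Proof.
move=> [dh acF dF] [dh' acF' dF']; split.
- move=> s Js; apply: (der_eq (derD (dh s Js) (derZ k (dh' s Js)))).
  by rewrite mulrDl mulrA.
- move=> a c a0 ac c1; apply: abs_continuousD; first exact: acF.
  apply: ac_mul; [exact: ltW| |exact: acF'].
  by apply: (@ac_lipschitz _ _ _ _ 0) => x y *; rewrite subrr normr0 mul0r.
- apply: filterS2 dF dF'; first exact: (ae_filter_ringOfSetsType leb).
  by move=> s /= d d' Js; apply: derD; [exact: d|apply: derZ; exact: d'].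
Qed.

Lemma Cn_qderiv n (g : R -> R) s : Cn n.+1 g s -> Cn n (qderiv g) s.
Proof. by move=> [_ h]; apply: CnM h; exact: Cn_id. Qed.

Lemma smooth_AC_loc (g : R -> R) : smooth g -> AC_loc g.
Proof.
move=> /smoothP sg a c a0 ac c1.
have Jx x : a <= x <= c -> J x.
  by move=> /andP[ax xc]; rewrite /J/= in_itv/= (lt_le_trans a0)// (le_lt_trans xc).
apply: (@ac_C1 _ _ _ _ (derive1 g)) => x /Jx/(sg 2) h.
  exact: nbhs_singleton (Cn_der h).
have h1 : Cn 1 (derive1 g) x by case: h.
exact: der_continuous (nbhs_singleton (Cn_der h1)).
Qed.

Lemma smooth_qderiv (g : R -> R) : smooth g -> smooth (qderiv g).
Proof. by move=> /smoothP sg; apply/smoothP => n x /(sg n.+1); exact: Cn_qderiv. Qed.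

Lemma smooth_derive (g : R -> R) s : smooth g -> J s -> is_derive s 1 g (derive1 g s).
Proof. by move=> /smoothP sg /(sg 1%N) h; exact: nbhs_singleton (Cn_der h). Qed.

Lemma smooth_quasi (g : R -> R) : smooth g -> quasi g (qderiv g) (derive1 (qderiv g)).
Proof.
move=> sg; split.
- move=> s Js; have /J_itv/andP[s0 _] := Js.
  apply: (der_eq (smooth_derive sg Js)).
  by rewrite /qderiv mulrC mulKf// gt_eqF.
- exact/smooth_AC_loc/smooth_qderiv.
- apply: (@filterS _ _ (ae_filter_ringOfSetsType leb) setT); last exact: filterT.
  by move=> s _; exact: (smooth_derive (smooth_qderiv sg)).
Qed.

(** Splitting J at [a] and [c]: the boundary values of [G] account for the middle
    part, and [X] is bounded below by [x0] and by 0 on the outer ones. *)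
Lemma J_integral_ge a c (x0 X G : R -> R) : 0 < a -> a < c -> c < 1 ->
  leb.-integrable (@J R) (EFin \o X) ->
  leb.-integrable (`]0, a]%classic : set (measurableTypeR R)) (EFin \o x0) ->
  {ae leb, forall s, 0 < s < a -> x0 s <= X s} ->
  {ae leb, forall s, c < s < 1 -> 0 <= X s} ->
  abs_continuous a c G ->
  {ae leb, forall s, a < s < c -> exists2 g, is_derive s 1 G g & - g <= X s} ->
  \int[leb]_(s in `]0, a]) x0 s + (G a - G c) <= \int[leb]_(s in @J R) X s.
Proof.
move=> a0 ac c1 Xi x0i hx0 hX0 acG hG.
have FF := ae_filter_ringOfSetsType leb.
have mI (i : interval R) : measurable ([set` i] : set (measurableTypeR R)).
  exact: (measurable_itv i).
have iX (i : interval R) : [set` i] `<=` @J R -> leb.-integrable ([set` i] : set (measurableTypeR R)) (EFin \o X).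
  by move=> iJ; exact: (integrableS (@measurable_J R) (mI i) iJ Xi).
have E1 : \int[leb]_(s in @J R) X s = \int[leb]_(s in `]0, a]) X s + \int[leb]_(s in `]a, 1[) X s.
  have := @Rintegral_itvB _ X (BRight 0) (BLeft 1) a Xi.
  rewrite !bnd_simp => /(_ (ltW a0) (lt_trans ac c1)) <-.
  by rewrite addrC subrK.
have E2 : \int[leb]_(s in `]a, 1[) X s = \int[leb]_(s in `]a, c]) X s + \int[leb]_(s in `]c, 1[) X s.
  have := @Rintegral_itvB _ X (BRight a) (BLeft 1) c (iX _ _).
  rewrite !bnd_simp => <-//; first by rewrite addrC subrK.
    by move=> s; rewrite /J/= !in_itv/= => /andP[h ->]; rewrite (lt_trans a0).
  exact: ltW.
rewrite E1 E2; apply: lerD; last rewrite -[leLHS]addr0; last apply: lerD.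
- apply: (ae_le_Rintegral (mI `]0, a]) x0i).
    by apply: iX => s; rewrite /J/= !in_itv/= => /andP[-> h]; exact: (le_lt_trans h (lt_trans ac c1)).
  apply: filterS2 (ae_neq a) hx0 => s /= sa h; rewrite in_itv/= => /andP[s0 s1].
  by apply: h; rewrite s0 lt_neqAle s1 andbT; apply/eqP.
- apply: ac_integral_ge => //.
  apply: iX => s; rewrite /J/= !in_itv/= => /andP[h1 h2].
  by rewrite (lt_trans a0)// (le_lt_trans h2).
- apply: (ae_Rintegral_ge0 (mI `]c, 1[)).
    apply: iX => s; rewrite /J/= !in_itv/= => /andP[h1 ->]; rewrite andbT.
    by apply: lt_trans h1; exact: lt_trans ac.
  by apply: filterS hX0 => s /= h; rewrite in_itv/= => /h.
Qed.

End quasi_derivatives.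

Section green_picone.
Context {R : realType}.
Implicit Types (h F D u psi : R -> R) (s a c : R).

Local Notation leb := (@lebesgue_measure R).

Variables (b : nat -> R) (m l : R).
Hypothesis sub : subcritical b m.
Hypothesis pl : principal b l.

Local Notation w := (weight b).
Local Notation phi := (phi b l).
Local Notation flux := (flux b l).
Local Notation ip := (ip b).

(** The operator in terms of the derivative [D] of the quasi-derivative. *)
Definition wop D s := (w s)^-1 * - D s.

Lemma quasi_flat h F D s : quasi h F D -> (\forall y \near s, F y = 0) ->
  is_derive s 1 F (D s) -> D s = 0.
Proof.
move=> _ F0 dF; rewrite -(der_derive1 dF); apply: der_derive1.
by apply: (der_near _ (der_cst 0 s)); apply: filterS F0 => y ->.
Qed.

(** With [e = 1] and [e = -1] this is an equality; the difference of the two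
    integrands is the derivative of the Wronskian [F psi - u F'], which vanishes at
    both ends. *)
Lemma green_half (e : R) u F D psi F' D' a c :
  0 < a -> a < c -> c < 1 -> quasi u F D -> quasi psi F' D' ->
  L2 b u -> L2 b (wop D) -> L2 b psi -> L2 b (wop D') ->
  (forall s, J s -> s <= a \/ c <= s -> psi s = 0 /\ F' s = 0) ->
  0 <= e * (ip (wop D) psi - ip u (wop D')).
Proof.
move=> a0 ac c1 qu qp Lu LD Lp LD' p0.
have FF := ae_filter_ringOfSetsType leb.
have Ja s : 0 < s < a -> J s.
  by move=> /andP[s0 sa]; rewrite /J/= in_itv/= s0 (lt_trans sa (lt_trans ac c1)).
have Jc s : c < s < 1 -> J s.
  by move=> /andP[cs s1]; rewrite /J/= in_itv/= s1 andbT (lt_trans (lt_trans a0 ac) cs).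
have Jac s : a <= s <= c -> J s.
  move=> /andP[as_ sc].
  by rewrite /J/= in_itv/= (lt_le_trans a0 as_) (le_lt_trans sc c1).
pose X s := e * (wop D s * psi s * w s - u s * wop D' s * w s).
have I1 := L2_integrable sub LD Lp; have I2 := L2_integrable sub Lu LD'.
have mJ := @measurable_J R.
have Xi : leb.-integrable (@J R) (EFin \o X).
  by apply: eq_integrable (integrableZl mJ e (integrableB mJ I1 I2)).
have XE s : J s -> X s = e * (u s * D' s - D s * psi s).
  move=> Js; have w0 : w s != 0 by rewrite gt_eqF// (weightJ_gt0 sub).
  by rewrite /X /wop; field.
have -> : e * (ip (wop D) psi - ip u (wop D')) = \int[leb]_(s in @J R) X s.
  rewrite /ip -(RintegralB mJ I1 I2) -RintegralZl//.
  by apply: eq_integrable (integrableB mJ I1 I2).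
have [dp acF' dF'] := qp; have [du acF dF] := qu.
pose G s := e * (F s * psi s + (-1) * (u s * F' s)).
have Ga : G a = 0.
  have [|p1 p2] := p0 a _ (or_introl (lexx _)); first by apply: Jac; rewrite lexx ltW.
  by rewrite /G p1 p2 !mulr0 addr0 mulr0.
have Gc : G c = 0.
  have [|p1 p2] := p0 c _ (or_intror (lexx _)); first by apply: Jac; rewrite lexx ltW.
  by rewrite /G p1 p2 !mulr0 addr0 mulr0.
have acst (k : R) : abs_continuous a c (fun=> k).
  by apply: (@ac_lipschitz _ _ _ _ 0) => x y *; rewrite subrr normr0 mul0r.
have acG : abs_continuous a c G.
  have acw := ltW ac.
  apply: ac_mul => //; apply: abs_continuousD.
    by apply: ac_mul => //; [exact: acF|exact: (quasi_ac qp)].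
  by apply: ac_mul => //; apply: ac_mul => //; [exact: (quasi_ac qu)|exact: acF'].
have flat (s : R) : (\forall y \near s, J y /\ (y <= a \/ c <= y)) ->
    is_derive s 1 F' (D' s) -> X s = 0.
  move=> ns dF's; have [Js sac] := nbhs_singleton ns.
  have E := fun n => quasi_flat qp n dF's; rewrite XE// (p0 s Js sac).1 E ?mulr0 ?subrr ?mulr0//.
  by apply: filterS ns => y [Jy yac]; case: (p0 y Jy yac).
have x0i : leb.-integrable (`]0, a]%classic : set (measurableTypeR R)) (EFin \o (fun=> 0 : R)).
  exact: integrable0.
have := @J_integral_ge _ a c (fun=> 0) X G a0 ac c1 Xi x0i.
rewrite Ga Gc subrr addr0 (_ : \int[leb]_(s in `]0, a]) 0 = 0); last first.
  by rewrite /Rintegral integral0.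
apply => //.
- apply: filterS dF' => s /= d s0a; have E := fun n => flat s n (d (Ja s s0a)); rewrite E//.
  have /andP[s0 sa] := s0a; have := lt_nbhsr s0; have := lt_nbhsl sa.
  by apply: filterS2 => y ya y0; split; [apply: Ja; rewrite y0|left; exact: ltW].
- apply: filterS dF' => s /= d sc1; have E := fun n => flat s n (d (Jc s sc1)); rewrite E//.
  have /andP[cs s1] := sc1; have := lt_nbhsr cs; have := lt_nbhsl s1.
  by apply: filterS2 => y y1 yc; split; [apply: Jc; rewrite yc|right; exact: ltW].
apply: filterS2 dF dF' => s /= d d' /andP[as_ sc].
have Js : J s by apply: Jac; rewrite !ltW.
have s0 : s != 0 by rewrite gt_eqF// (lt_trans a0).
eexists.
  by apply: derZ; apply: derD; [apply: derM; [exact: d|exact: dp]|apply: derZ;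
    apply: derM; [exact: du|exact: d']].
by rewrite XE// le_eqVlt; apply/orP; left; apply/eqP; field.
Qed.

(** Green's formula: the boundary terms vanish when one of the two functions has
    compact support. *)
Lemma green u F D psi F' D' a c :
  0 < a -> a < c -> c < 1 -> quasi u F D -> quasi psi F' D' ->
  L2 b u -> L2 b (wop D) -> L2 b psi -> L2 b (wop D') ->
  (forall s, J s -> s <= a \/ c <= s -> psi s = 0 /\ F' s = 0) ->
  ip (wop D) psi = ip u (wop D').
Proof.
move=> a0 ac c1 qu qp Lu LD Lp LD' p0.
have h1 := green_half 1 a0 ac c1 qu qp Lu LD Lp LD' p0.
have h2 := green_half (-1) a0 ac c1 qu qp Lu LD Lp LD' p0.
by apply/eqP; rewrite -subr_eq0 eq_le; apply/andP; split; lra.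
Qed.

(** This is [- s phi' / phi], which solves the Riccati equation
    [rho' = l w + rho^2 / s]. *)
Definition rho s := flux s / phi s.

Lemma is_derive_rho s : 0 < s < 1 -> is_derive s 1 rho (l * w s + rho s ^+ 2 / s).
Proof.
move=> s01; have /andP[s0 s1] := s01.
have s01' : 0 <= s < 1 by rewrite ltW.
have p0 := phi_gt0 pl s01; have pn : phi s != 0 by rewrite gt_eqF.
have h := derM (is_derive_flux sub l s01') (derV (is_derive_phi_flux sub l s01) pn).
by apply: (der_eq h); rewrite /rho; field; rewrite pn gt_eqF.
Qed.

Lemma rho_continuous s : 0 < s < 1 -> {for s, continuous rho}.
Proof. by move=> /is_derive_rho; exact: der_continuous. Qed.

Lemma rho_ac a c : 0 < a -> c < 1 -> abs_continuous a c rho.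
Proof.
move=> a0 c1; have Jx x : a <= x <= c -> 0 < x < 1.
  by move=> /andP[ax xc]; rewrite (lt_le_trans a0 ax) (le_lt_trans xc c1).
apply: (@ac_C1 _ _ _ _ (fun s => l * w s + rho s ^+ 2 / s)) => x /Jx x01.
  exact: is_derive_rho.
have /andP[x0 x1] := x01; apply: cvgD.
  by apply: cvgMl_tmp; apply: (weight_continuous sub); rewrite (ltW x0).
apply: cvgM; last by apply: cvgV => //; rewrite gt_eqF.
by rewrite expr2; apply: cvgM; exact: rho_continuous.
Qed.

Lemma rho_W_ge s : 0 < s < 1 -> l * W b s <= rho s.
Proof.
move=> s01; rewrite ler_pdivlMr ?(phi_gt0 pl)//.
have := flux_W_ge sub (ltW (principal_gt0 pl)) s01 (fun x => @phi_ge0 _ b l pl x).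
by rewrite mulrAC.
Qed.

Lemma weight_integrable_left a : 0 < a < 1 ->
  leb.-integrable (`]0, a]%classic : set (measurableTypeR R)) (EFin \o w) /\
  \int[leb]_(s in `]0, a]) w s = W b a.
Proof.
move=> a01; have /andP[a0 a1] := a01.
have wi : leb.-integrable (`[0, a]%classic : set (measurableTypeR R)) (EFin \o w).
  apply: continuous_compact_integrable; first exact: segment_compact.
  apply: within_itv_continuous => x /andP[x0 xa].
  by apply: (weight_continuous sub); rewrite x0 (le_lt_trans xa).
have wi' : leb.-integrable (`]0, a]%classic : set (measurableTypeR R)) (EFin \o w).
  apply: (integrableS _ _ _ wi).
  - exact: (measurable_itv `[0, a]).
  - exact: (measurable_itv `]0, a]).
  - by move=> s /=; rewrite !in_itv/= => /andP[/ltW -> ->].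
split => //.
rewrite -Rintegral_itv_bndo_bndc.
  have := integral_weight sub a01 => E.
  by rewrite /Rintegral (_ : (\int[leb]_(x in `]0%R, a[) (w x)%:E)%E = (W b a)%:E).
apply: (integrableS _ _ _ wi').
- exact: (measurable_itv `]0, a]).
- exact: (measurable_itv `]0, a[).
- by move=> s /=; rewrite !in_itv/= => /andP[-> /ltW].
Qed.

(** Picone's identity: with [G = F h + rho h^2], the Riccati equation gives
    [- D h - l h^2 w = (F + rho h)^2 / s - G']. The boundary term at 0 is
    [rho(a) k^2], which pays for the interval (0, a) where [h] is constant. *)
Lemma picone h F D a c k : 0 < a -> a < c -> c < 1 -> quasi h F D ->
  L2 b h -> L2 b (wop D) ->
  (forall s, 0 < s <= a -> h s = k /\ F s = 0) ->
  (forall s, c <= s < 1 -> h s = 0 /\ F s = 0) ->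
  l * ip h h <= ip (wop D) h.
Proof.
move=> a0 ac c1 qh Lh LD ha hc.
have l0 := principal_gt0 pl.
have FF := ae_filter_ringOfSetsType leb.
have a01 : 0 < a < 1 by rewrite a0 (lt_trans ac).
have Ja s : 0 < s < a -> J s.
  by move=> /andP[s0 sa]; rewrite /J/= in_itv/= s0 (lt_trans sa (lt_trans ac c1)).
have Jc s : c < s < 1 -> J s.
  by move=> /andP[cs s1]; rewrite /J/= in_itv/= s1 andbT (lt_trans (lt_trans a0 ac) cs).
have Jac s : a <= s <= c -> J s.
  move=> /andP[as_ sc].
  by rewrite /J/= in_itv/= (lt_le_trans a0 as_) (le_lt_trans sc c1).
pose X s := wop D s * h s * w s - l * (h s * h s * w s).
have I1 := L2_integrable sub LD Lh; have I2 := L2_integrable sub Lh Lh.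
have mJ := @measurable_J R.
have I3 := integrableZl mJ l I2.
have Xi : leb.-integrable (@J R) (EFin \o X).
  by apply: eq_integrable (integrableB mJ I1 I3).
have XE s : J s -> X s = - (D s * h s) - l * (h s * h s * w s).
  move=> Js; have w0 : w s != 0 by rewrite gt_eqF// (weightJ_gt0 sub).
  by rewrite /X /wop; field.
rewrite -subr_ge0.
have -> : ip (wop D) h - l * ip h h = \int[leb]_(s in @J R) X s.
  by rewrite /ip -(RintegralZl _ mJ I2) -(RintegralB mJ I1 I3).
have [dh acF dF] := qh.
pose G s := F s * h s + rho s * (h s * h s).
have Ga : G a = rho a * k ^+ 2.
  have [|p1 p2] := ha a; first by rewrite a0 lexx.
  by rewrite /G p1 p2 mul0r add0r expr2.
have Gc : G c = 0.
  have [|p1 p2] := hc c; first by rewrite lexx.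
  by rewrite /G p1 p2 !mulr0 addr0.
have acG : abs_continuous a c G.
  have acw := ltW ac; have ach := quasi_ac qh a0 c1.
  apply: abs_continuousD; first by apply: ac_mul => //; exact: acF.
  by apply: ac_mul => //; [exact: rho_ac|exact: ac_mul].
have [wi wE] := weight_integrable_left a01.
have mI : measurable (`]0, a]%classic : set (measurableTypeR R)).
  exact: (measurable_itv `]0, a]).
have x0i : leb.-integrable (`]0, a]%classic : set (measurableTypeR R))
    (EFin \o (fun s => - (l * k ^+ 2) * w s)).
  by apply: eq_integrable (integrableZl mI (- (l * k ^+ 2)) wi).
have := @J_integral_ge _ a c _ X G a0 ac c1 Xi x0i.
rewrite (RintegralZl _ mI wi) wE Ga Gc subr0.
have h1 : 0 <= - (l * k ^+ 2) * W b a + rho a * k ^+ 2.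
  have -> : - (l * k ^+ 2) * W b a + rho a * k ^+ 2 = (rho a - l * W b a) * k ^+ 2 by ring.
  by rewrite mulr_ge0 ?sqr_ge0// subr_ge0 rho_W_ge.
move=> h2; apply: le_trans h1 _; apply: h2 => //.
- apply: filterS dF => s /= d s0a; have Js := Ja s s0a; have /andP[s0 sa] := s0a.
  have E := fun n => quasi_flat qh n (d Js); rewrite XE// E.
    have [|-> _] := ha s; first by rewrite s0 ltW.
    by rewrite mul0r oppr0 sub0r le_eqVlt; apply/orP; left; apply/eqP; ring.
  have := lt_nbhsr s0; have := lt_nbhsl sa.
  by apply: filterS2 => y ya y0; case: (ha y); rewrite ?y0 ?ltW.
- apply: nearW => s sc1; have Js := Jc s sc1; have /andP[cs s1] := sc1.
  have [|h0 _] := hc s; first by rewrite s1 ltW.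
  by rewrite XE// h0 !mulr0 mul0r mulr0 oppr0 addr0.
apply: filterS dF => s /= d /andP[as_ sc].
have Js : J s by apply: Jac; rewrite !ltW.
have s0 : 0 < s by rewrite (lt_trans a0).
eexists.
  by apply: derD; [apply: derM; [exact: d|exact: dh]|apply: derM;
    [exact: is_derive_rho (J_itv Js)|apply: derM; exact: dh]].
rewrite XE// -subr_ge0.
set Y := (Y in 0 <= Y).
have -> : Y = (F s + rho s * h s) ^+ 2 / s.
  by rewrite /Y; field; rewrite gt_eqF.
by rewrite divr_ge0 ?sqr_ge0// ltW.
Qed.

End green_picone.

(** * Compact supports and cutting off in the weighted space *)

Section compact_supports.
Context {R : realType}.
Implicit Types (f g D y : R -> R) (s a c : R).

Local Notation leb := (@lebesgue_measure R).

Lemma support_itv g : compact_support g -> exists a c, [/\ 0 < a, a < c, c < 1 &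
  forall s, J s -> s <= a \/ c <= s -> g s = 0].
Proof.
move=> [K [cK KJ gK]]; have [K0|/nonemptyPn K0] := pselect (K !=set0); last first.
  have {}gK s : J s -> g s = 0 by move=> Js; apply: gK => //; rewrite K0.
  clear K0; exists (1 / 4), (1 / 2); split; try lra.
  by move=> s Js _; exact: gK.
have cid_ : {within K, continuous (fun x : R => x)} by apply: continuous_subspaceT => x; exact: cvg_id.
have [p pK pmax] := compact_EVT_max K0 cK cid_.
have [q qK qmin] := compact_EVT_min K0 cK cid_.
have /J_itv/andP[p0 p1] : J p by apply: KJ; rewrite inE in pK.
have /J_itv/andP[q0 q1] : J q by apply: KJ; rewrite inE in qK.
have qp := qmin p pK.
exists (q / 2), ((1 + p) / 2); split; try lra.
move=> s Js sac; apply: gK => // Ks.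
have sK : s \in K by rewrite inE.
have := pmax s sK; have := qmin s sK.
by case: sac => *; lra.
Qed.

Definition zero_outside a c g := forall s, J s -> s <= a \/ c <= s -> g s = 0.

Lemma zero_outside_derive1 a c a' c' g : a' < a -> c < c' -> zero_outside a c g ->
  zero_outside a' c' (derive1 g).
Proof.
move=> aa cc g0 s Js sac; apply: der_derive1; apply: (der_near _ (der_cst 0 s)).
have /J_itv/andP[s0 s1] := Js.
have ns := lt_nbhsr s0; have ns1 := lt_nbhsl s1.
case: sac => h.
  have ha : s < a by exact: le_lt_trans aa.
  have := lt_nbhsl ha; apply: filterS3 ns ns1 => y y0 y1 ya.
  by rewrite g0//; [rewrite /J/= in_itv/= y0|left; exact: ltW].
have ha : c < s by exact: lt_le_trans h.
have := lt_nbhsr ha; apply: filterS3 ns ns1 => y y0 y1 ya.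
by rewrite g0//; [rewrite /J/= in_itv/= y0|right; exact: ltW].
Qed.

Variables (b : nat -> R) (m : R).
Hypothesis sub : subcritical b m.

Local Notation w := (weight b).
Local Notation mfunJ := (measurable_fun (@J R : set (measurableTypeR R))).

Lemma J_cont_measurable f : (forall s, J s -> {for s, continuous f}) ->
  measurable_fun (@J R) f.
Proof. by apply: measurable_continuous_co; exact: measurable_itv. Qed.

Lemma L2_bounded f K : (forall s, J s -> {for s, continuous f}) ->
  (forall s, J s -> f s ^+ 2 * w s <= K) -> L2 b f.
Proof.
move=> cf fK; have mf := J_cont_measurable cf; split => //.
apply: (@le_lt_trans _ _ (\int[leb]_(s in @J R) (cst K%:E s))%E).
  apply: ge0_le_integral => //.
  - exact: measurable_J.
  - move=> s Js; rewrite lee_fin mulr_ge0 ?sqr_ge0// ltW//; exact: (weightJ_gt0 sub).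
  - have mf' : mfunJ f by exact: mf.
    apply/measurable_EFinP; apply: measurable_funM; last exact: (measurable_weight sub).
    exact: measurable_funX.
rewrite integral_cst; last exact: measurable_J.
have e : leb (@J R : set (measurableTypeR R)) = 1%:E by exact: lebesgue_J.
by rewrite [X in (_ * X)%E](_ : _ = 1%:E)// mule1 ltry.
Qed.

Lemma L2_compact a c f : 0 < a -> a <= c -> c < 1 -> (forall s, J s -> {for s, continuous f}) ->
  zero_outside a c f -> L2 b f.
Proof.
move=> a0 ac c1 cf f0.
have Jx x : a <= x <= c -> J x.
  by move=> /andP[ax xc]; rewrite /J/= in_itv/= (lt_le_trans a0)// (le_lt_trans xc).
have cn : {within `[a, c], continuous (fun s => f s ^+ 2 * w s)}.
  apply: within_itv_continuous => s /Jx Js.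
  apply: cvgM; last exact: (weight_continuous sub (J_itvW Js)).
  by rewrite expr2; apply: cvgM; exact: cf.
have [p pac pmax] := EVT_max ac cn.
have pJ : J p by apply: Jx; move: pac; rewrite in_itv.
apply: (@L2_bounded _ (f p ^+ 2 * w p) cf) => s Js.
have p0 : 0 <= f p ^+ 2 * w p.
  by rewrite mulr_ge0 ?sqr_ge0// ltW// (weightJ_gt0 sub).
have [sac|] := boolP (a <= s <= c); first by apply: pmax; rewrite in_itv.
rewrite negb_and -!ltNge => h; rewrite f0//; first by rewrite expr0n/= mul0r.
by case/orP : h => /ltW h; [left|right].
Qed.

Lemma smooth_continuous g s : smooth g -> J s -> {for s, continuous g}.
Proof. by move=> sg Js; exact: der_continuous (smooth_derive sg Js). Qed.

Lemma smooth_derive1 g : smooth g -> smooth (derive1 g).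
Proof. by move=> /smoothP sg; apply/smoothP => n x /(sg n.+1) []. Qed.

Lemma Sop_continuous g s : smooth g -> J s -> {for s, continuous (Sop b g)}.
Proof.
move=> sg Js; apply: cvgM.
  apply: cvgV; first by rewrite gt_eqF// (weightJ_gt0 sub).
  exact: (weight_continuous sub (J_itvW Js)).
apply: cvgN; apply: smooth_continuous Js.
exact/smooth_derive1/smooth_qderiv.
Qed.

Lemma smooth_compact_Sop_L2 a c g : 0 < a -> a <= c -> c < 1 -> smooth g ->
  zero_outside a c (derive1 g) -> L2 b (Sop b g).
Proof.
move=> a0 ac c1 sg g0; have a2 : a / 2 < a by lra.
have c2 : c < (1 + c) / 2 by lra.
apply: (@L2_compact (a / 2) ((1 + c) / 2)); try lra.
  by move=> s Js; exact: Sop_continuous.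
have q0 : zero_outside a c (qderiv g) by move=> s Js h; rewrite /qderiv g0// mulr0.
have d0 := zero_outside_derive1 a2 c2 q0.
by move=> s Js h; rewrite /Sop d0// oppr0 mulr0.
Qed.

(** Smoothness turns all the conditions on the domain into continuity on the compact
    support. *)
Lemma test_function_Dmin' g : test_function g -> Dmin' b g.
Proof.
move=> [sg cg]; split => //; have [a [c [a0 ac c1 g0]]] := support_itv cg.
have a2 : a / 2 < a by lra.
have c2 : c < (1 + c) / 2 by lra.
split.
- apply: (L2_compact a0 (ltW ac) c1 _ g0) => s Js; exact: smooth_continuous.
- exact: smooth_AC_loc.
- exact/smooth_AC_loc/smooth_qderiv.
- apply: (@smooth_compact_Sop_L2 (a / 2) ((1 + c) / 2)) => //; try lra.
  exact: zero_outside_derive1 g0.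
Qed.

Lemma Dmin'_zero_outside y : Dmin' b y -> exists a c, [/\ 0 < a, a < c, c < 1,
  zero_outside a c y & zero_outside a c (qderiv y)].
Proof.
move=> [_ /support_itv[a [c [a0 ac c1 g0]]]].
have a2 : a / 2 < a by lra.
have c2 : c < (1 + c) / 2 by lra.
exists (a / 2), ((1 + c) / 2); split; try lra.
  by move=> s Js h; apply: g0 => //; case: h => ?; [left|right]; lra.
have d0 := zero_outside_derive1 a2 c2 g0.
by move=> s Js h; rewrite /qderiv d0// mulr0.
Qed.

End compact_supports.

Section cutoff_L2.
Context {R : realType}.
Variables (b : nat -> R) (m : R).
Hypothesis sub : subcritical b m.
Variables (c1 c2 : R) (v1 : R -> R).
Hypotheses (hc1 : 0 < c1) (hc12 : c1 < c2) (hc2 : c2 < 1) (hv1 : smooth v1)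
  (hv1_left : forall s, 0 < s -> s < c1 -> v1 s = 1)
  (hv1_right : forall s, c2 < s -> s < 1 -> v1 s = 0).

Local Notation leb := (@lebesgue_measure R).
Local Notation w := (weight b).
Local Notation mfunJ := (measurable_fun (@J R : set (measurableTypeR R))).
Local Notation chi := (chi v1).

Lemma chi_smooth n : smooth (chi n).
Proof.
by apply/smoothP => k s /J_itv; exact: (Cn_chi hc1 hc12 hc2 hv1 hv1_left hv1_right).
Qed.

Lemma chi_zero_outside n : exists2 a, 0 < a < 1 / 2 & zero_outside a (1 - a) (chi n).
Proof.
(* If [s <= a] or [1 - s <= a] then [s (1 - s) <= a < e^(- n - 1)]. *)
pose a : R := Num.min (1 / 4) (expR (- n.+1%:R) / 2).
have a0 : 0 < a by rewrite lt_min !divr_gt0 ?expR_gt0.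
have a4 : a <= 1 / 4 by rewrite ge_min lexx.
have ae : a <= expR (- n.+1%:R) / 2 by rewrite ge_min lexx orbT.
have e0 : 0 < expR (- n.+1%:R : R) by exact: expR_gt0.
exists a; first by apply/andP; split; lra.
move=> s /J_itv s01 h.
suff hump : s * (1 - s) < expR (- n.+1%:R).
  by have [] := chi_flat hc1 hc12 hc2 hv1 hv1_left hv1_right s01 hump.
have /andP[s0 s1] := s01.
move: (expR _) e0 ae => e e0 ae.
by case: h => h; nra.
Qed.

Lemma chi_compact_support n : compact_support (chi n).
Proof.
have [a /andP[a0 a2] h] := chi_zero_outside n.
exists `[a, 1 - a]%classic; split; first exact: segment_compact.
  by move=> s /=; rewrite /J/= !in_itv/= => /andP[h1 h2]; apply/andP; split; lra.
move=> s Js sK; apply: h => //.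
have [sa|sa] := leP s a; [by left|right].
by rewrite leNgt; apply/negP => sc; apply: sK; rewrite /= in_itv/= !ltW.
Qed.

Lemma chi_test (g : R -> R) n : smooth g -> test_function (fun s => chi n s * g s).
Proof.
move=> sg; split.
  have /smoothP cn := @chi_smooth n; have /smoothP gn := sg.
  by apply/smoothP => k s Js; apply: CnM; [exact: cn|exact: gn].
have [K [cK KJ h]] := chi_compact_support n.
by exists K; split => // s Js sK; rewrite h// mul0r.
Qed.

Lemma chi_pointwise s : J s -> \forall n \near \oo, chi n s = 1.
Proof.
move=> /J_itv s01.
have := chi_eventually1 hc1 hc12 hc2 hv1_left (hump_gt0 s01).
by apply: filterS => n h; exact: h.
Qed.

Lemma chi_L2 (f : R -> R) n : L2 b f -> L2 b (fun s => chi n s * f s).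
Proof.
move=> Lf; have mf := L2_measurable Lf.
have [M M0 HM] := chi_bounds hc1 hc12 hc2 hv1 hv1_left hv1_right.
have mc : mfunJ (chi n).
  by apply: J_cont_measurable => s; exact: smooth_continuous (@chi_smooth n).
have m1 : mfunJ (fun s => chi n s * f s) by exact: measurable_funM.
split; first exact: m1.
have Mi := integrableZl (@measurable_J R) (M ^+ 2) (L2_integrable_sq sub Lf).
apply: (@le_lt_trans _ _ (\int[leb]_(s in @J R) (M ^+ 2 * (f s * f s * w s))%:E)%E).
  apply: le_ge0_integral => // s Js.
  - by rewrite lee_fin mulr_ge0 ?sqr_ge0// ltW// (weightJ_gt0 sub).
  - by rewrite lee_fin mulr_ge0 ?sqr_ge0// -expr2 mulr_ge0 ?sqr_ge0// ltW// (weightJ_gt0 sub).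
  - rewrite lee_fin mulrA ler_wpM2r ?(ltW (weightJ_gt0 sub Js))//.
    rewrite exprMn -expr2 ler_wpM2r ?sqr_ge0// -(real_normK (num_real (chi n s))).
    have [h _ _] := HM n s (J_itv Js).
    by rewrite ler_pXn2r ?nnegrE// ltW.
have := integrable_fin_num (@measurable_J R) Mi => /fin_numPlt/andP[_].
by apply: le_lt_trans; rewrite le_eqVlt; apply/orP; left; apply/eqP; exact: eq_integral.
Qed.

(** Dominated convergence, as the cut-off functions are uniformly bounded and
    eventually equal to 1 at each point. *)
Lemma chi_L2cvg (f : R -> R) : L2 b f -> L2cvg b (fun n s => chi n s * f s) f.
Proof.
move=> Lf; have mf := L2_measurable Lf.
have [M M0 HM] := chi_bounds hc1 hc12 hc2 hv1 hv1_left hv1_right.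
have mJ := @measurable_J R.
have Mi := integrableZl mJ ((M + 1) ^+ 2) (L2_integrable_sq sub Lf).
have mfn n : mfunJ (fun s => ((chi n s * f s - f s) ^+ 2 * w s)%:E).
  exact: (sq_measurable sub (L2B sub (chi_L2 n Lf) Lf)).
have [] := dominated_convergence mJ mfn (measurable_cst 0%E) _ Mi.
- apply: nearW => s Js; apply: cvg_near_cst.
  by apply: filterS (chi_pointwise Js) => n ->; rewrite mul1r subrr expr0n/= mul0r.
- apply: nearW => s n Js.
  have w0 := weightJ_gt0 sub Js; have [h _ _] := HM n s (J_itv Js).
  rewrite gee0_abs ?lee_fin; last by rewrite mulr_ge0 ?sqr_ge0// ltW.
  rewrite mulrA ler_wpM2r ?(ltW w0)//.
  have -> : chi n s * f s - f s = (chi n s - 1) * f s by ring.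
  rewrite exprMn -expr2 ler_wpM2r ?sqr_ge0// -(real_normK (num_real (chi n s - 1))).
  rewrite ler_pXn2r ?nnegrE//; last by rewrite addr_ge0 ?ltW.
  by apply: le_trans (ler_normB _ _) _; rewrite normr1 lerD2r.
by move=> _ _; rewrite integral0.
Qed.

End cutoff_L2.

(** * Every eigenvalue is at least the principal one *)

Section first_eigenvalue.
Context {R : realType}.
Variables (b : nat -> R) (m l : R).
Hypothesis sub : subcritical b m.
Hypothesis pl : principal b l.
Variables (c1 c2 : R) (v1 : R -> R).
Hypotheses (hc1 : 0 < c1) (hc12 : c1 < c2) (hc2 : c2 < 1) (hv1 : smooth v1)
  (hv1_left : forall s, 0 < s -> s < c1 -> v1 s = 1)
  (hv1_right : forall s, c2 < s -> s < 1 -> v1 s = 0).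

Local Notation leb := (@lebesgue_measure R).
Local Notation w := (weight b).
Local Notation mfunJ := (measurable_fun (@J R : set (measurableTypeR R))).
Local Notation chi := (chi v1).
Local Notation ip := (ip b).

Lemma v1_flat : zero_outside (c1 / 2) ((1 + c2) / 2) (derive1 v1).
Proof.
move=> s /J_itv/andP[s0 s1] h; apply: der_derive1.
case: h => h.
  apply: (der_near _ (der_cst 1 s)); have sc : s < c1 by lra.
  have := lt_nbhsr s0; have := lt_nbhsl sc.
  by apply: filterS2 => y yc y0; rewrite hv1_left.
apply: (der_near _ (der_cst 0 s)); have sc : c2 < s by lra.
have := lt_nbhsr sc; have := lt_nbhsl s1.
by apply: filterS2 => y yc y0; rewrite hv1_right.
Qed.

Lemma v1_L2 : L2 b v1.
Proof.
have cn : {within `[0, c2], continuous (fun s => eta v1 s ^+ 2 * w s)}.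
  apply: within_itv_continuous => s /andP[s0 s1]; apply: cvgM.
    rewrite expr2; apply: cvgM; apply: Cn_continuous;
      exact: (Cn_eta hc1 hc12 hc2 hv1 hv1_left hv1_right).
  by apply: (weight_continuous sub); rewrite s0 (le_lt_trans s1).
have c20 : 0 <= c2 by rewrite ltW// (lt_trans hc1).
have [p pc pmax] := EVT_max c20 cn.
apply: (@L2_bounded _ _ _ sub _ (eta v1 p ^+ 2 * w p)) => s Js.
  exact: smooth_continuous.
have /J_itv/andP[s0 s1] := Js.
have [sc|cs] := leP s c2.
  have <- : eta v1 s = v1 s by apply: eta_v1; rewrite s0.
  by apply: pmax; rewrite in_itv/= sc (ltW s0).
rewrite hv1_right// expr0n/= mul0r mulr_ge0 ?sqr_ge0// ltW// (weight_gt0 sub)//.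
by move: pc; rewrite in_itv/= => /andP[-> h]; exact: le_lt_trans h hc2.
Qed.

Lemma v1_Sop_L2 : L2 b (Sop b v1).
Proof.
have h1 := hc1; have h12 := hc12; have h2 := hc2.
by apply: (smooth_compact_Sop_L2 sub _ _ _ hv1 v1_flat); lra.
Qed.

Lemma wopDZ (D D' : R -> R) k : wop b (fun s => D s + k * D' s) =
  fun s => wop b D s + k * wop b D' s.
Proof. by apply/funext => s; rewrite /wop; ring. Qed.

Lemma ip_ae_eq (f f' g : R -> R) : L2 b f -> L2 b f' -> L2 b g ->
  {ae leb, forall s, J s -> f s = f' s} -> ip f g = ip f' g.
Proof.
move=> Lf Lf' Lg ff'; congr fine; apply: ae_eq_integral.
- exact: measurable_J.
- exact: (ip_measurable sub Lf Lg).
- exact: (ip_measurable sub Lf' Lg).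
- apply: filterS ff'; first exact: (ae_filter_ringOfSetsType leb).
  by move=> s /= h Js; rewrite h.
Qed.

Lemma ip_gt0 (f : R -> R) : L2 b f -> ~ {ae leb, forall s, J s -> f s = 0} -> 0 < ip f f.
Proof.
move=> Lf nf; rewrite lt_neqAle (ip_ge0 sub) andbT eq_sym; apply/eqP => f0; apply: nf.
have FF := ae_filter_ringOfSetsType leb.
have mf := ip_measurable sub Lf Lf.
have : (\int[leb]_(s in @J R) `|(f s * f s * w s)%:E|)%E = 0%E.
  have <- : sqnorm b f = 0%E by rewrite (sqnormE sub Lf) f0.
  apply: eq_integral => s; rewrite inE => Js.
  by rewrite gee0_abs ?lee_fin -?expr2// mulr_ge0 ?sqr_ge0// ltW// (weightJ_gt0 sub).
move/(ae_eq_integral_abs leb (@measurable_J R) mf); apply: filterS => s /= h Js.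
have e : f s * f s * w s = 0 by apply: EFin_inj; exact: h.
move/eqP : e; rewrite mulf_eq0 (gt_eqF (weightJ_gt0 sub Js)) orbF.
by rewrite mulf_eq0 orbb => /eqP.
Qed.

Lemma L2cvg_cst (f : R -> R) : L2cvg b (fun=> f) f.
Proof.
rewrite /L2cvg; under eq_fun do rewrite /sqnorm.
have -> : (fun=> \int[leb]_(s in @J R) ((f s - f s) ^+ 2 * w s)%:E)%E = (fun=> 0%E) :> (nat -> \bar R).
  apply/funext => _; rewrite integral0_eq// => s _.
  by rewrite subrr expr0n/= mul0r.
exact: cvg_cst.
Qed.

Lemma L2cvgD_cst (fn : nat -> R -> R) (f g : R -> R) : L2cvg b fn f ->
  L2cvg b (fun n s => fn n s + g s) (fun s => f s + g s).
Proof.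
rewrite /L2cvg; apply: cvg_trans; apply: near_eq_cvg; apply: nearW => n.
by apply: eq_integral => s _; congr ((_ ^+ 2 * _)%:E); ring.
Qed.

Lemma L2cvgDZ (fn gn : nat -> R -> R) (f g : R -> R) k :
  (forall n, L2 b (fn n)) -> (forall n, L2 b (gn n)) -> L2 b f -> L2 b g ->
  L2cvg b fn f -> L2cvg b gn g ->
  L2cvg b (fun n s => fn n s + k * gn n s) (fun s => f s + k * g s).
Proof.
move=> Lfn Lgn Lf Lg cf cg.
move/(L2cvg_ip0 sub Lfn Lf) : cf => cf; move/(L2cvg_ip0 sub Lgn Lg) : cg => cg.
have Ld n : L2 b (fun s => fn n s - f s) by exact: (L2B sub).
have Le n : L2 b (fun s => gn n s - g s) by exact: (L2B sub).
pose u n : R := 2 * ip (fun s => fn n s - f s) (fun s => fn n s - f s) +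
   2 * (k ^+ 2 * ip (fun s => gn n s - g s) (fun s => gn n s - g s)).
have cu : (u n)%:E @[n --> \oo] --> 0%:E.
  apply: cvg_EFin; first exact: nearW.
  have -> : 0 = 2 * 0 + 2 * (k ^+ 2 * 0) :> R by rewrite !mulr0 addr0.
  by apply: cvgD; [exact: cvgMl_tmp|do 2 apply: cvgMl_tmp].
apply: (squeeze_cvge _ (cvg_cst 0%E) cu); apply: nearW => n.
apply/andP; split; first exact: (sqnorm_ge0 sub).
have := sqnormD_le sub (Ld n) (L2Z sub k (Le n)).
have -> : ip (fun s => k * (gn n s - g s)) (fun s => k * (gn n s - g s)) =
    k ^+ 2 * ip (fun s => gn n s - g s) (fun s => gn n s - g s).
  have Lk := L2Z sub k (Le n).
  by rewrite (ipZl sub k (Le n) Lk) ipC (ipZl sub k (Le n) (Le n)) mulrA expr2.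
apply: le_trans; rewrite le_eqVlt; apply/orP; left; apply/eqP.
by apply: eq_integral => s _; congr ((_ ^+ 2 * _)%:E); ring.
Qed.

(** An eigenfunction is [h = y + c v1] with [y] in the minimal domain. For the
    sequence [h_n] approximating it in the graph norm, [picone] gives
    [l <h_n, h_n> <= <S h_n, h_n>], which tends to [<f', h>] with [f'] the limit of
    [S h_n]. Testing with the compactly supported functions [psi k], dense enough to
    approximate [h], Green's formula identifies [<f', h>] with [l' <h, h>]. *)
Lemma eigenvalue_ge l' : eigenvalue_S b v1 l' -> l <= l'.
Proof.
have FF := ae_filter_ringOfSetsType leb; have h2 := hc2; have h1 := hc1.
move=> [g [[y [c [[Dy [f [Ly Lf [yn [Dyn cy cS]]]]] gE]]] ng eg]].
have Lv := v1_L2; have LSv := v1_Sop_L2.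
have qv := smooth_quasi hv1; have qy := Dmax_quasi Dy.
have Lyn n : L2 b (yn n) by case: (Dyn n) => -[].
have LSyn n : L2 b (Sop b (yn n)) by case: (Dyn n) => -[].
pose h s := y s + c * v1 s; pose hn n s := yn n s + c * v1 s.
have Lh : L2 b h by exact: (L2D sub Ly (L2Z sub c Lv)).
have Lhn n : L2 b (hn n) by exact: (L2D sub (Lyn n) (L2Z sub c Lv)).
pose Dh s := derive1 (qderiv y) s + c * derive1 (qderiv v1) s.
pose Dn n s := derive1 (qderiv (yn n)) s + c * derive1 (qderiv v1) s.
pose f' s := f s + c * Sop b v1 s.
have LDh : L2 b (wop b Dh).
  by rewrite wopDZ; apply: (L2D sub _ (L2Z sub c LSv)); case: Dy.
have LDn n : L2 b (wop b (Dn n)) by rewrite wopDZ; exact: (L2D sub (LSyn n) (L2Z sub c LSv)).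
have Lf' : L2 b f' by exact: (L2D sub Lf (L2Z sub c LSv)).
have qh := quasiDZ c qy qv; have qhn n := quasiDZ c (Dmax_quasi (Dyn n).1) qv.
have chn : L2cvg b hn h by exact: L2cvgD_cst.
have cDn : L2cvg b (fun n => wop b (Dn n)) f'.
  rewrite (_ : (fun n => _) = fun n s => Sop b (yn n) s + c * Sop b v1 s).
    exact: L2cvgD_cst.
  by apply/funext => n; rewrite wopDZ.
(* [v1] does not have compact support in J, so it is cut off as well. *)
pose psi k s := yn k s + c * (chi k s * v1 s).
pose Dp k s := derive1 (qderiv (yn k)) s + c * derive1 (qderiv (fun s => chi k s * v1 s)) s.
have tv k := chi_test hc1 hc12 hc2 hv1 hv1_left hv1_right k hv1.
have Dv k := test_function_Dmin' sub (tv k).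
have qp k := quasiDZ c (Dmax_quasi (Dyn k).1) (smooth_quasi (tv k).1).
have Lcv k : L2 b (fun s => chi k s * v1 s) by case: (Dv k) => -[].
have Lp k : L2 b (psi k) by exact: (L2D sub (Lyn k) (L2Z sub c (Lcv k))).
have LDp k : L2 b (wop b (Dp k)).
  by rewrite wopDZ; apply: (L2D sub (LSyn k)); apply: (L2Z sub); case: (Dv k) => -[].
have cp : L2cvg b psi h.
  apply: L2cvgDZ => //.
  exact: (chi_L2cvg sub hc1 hc12 hc2 hv1 hv1_left hv1_right Lv).
have grn k u Fu Du : quasi u Fu Du -> L2 b u -> L2 b (wop b Du) ->
    ip (wop b Du) (psi k) = ip u (wop b (Dp k)).
  move=> qu Lu LDu.
  have [a [d [a0 ad d1 y0 qy0]]] := Dmin'_zero_outside (Dyn k).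
  have [a' [d' [a0' ad' d1' y0' qy0']]] := Dmin'_zero_outside (Dv k).
  apply: (@green _ _ _ sub u Fu Du _ _ _ (Num.min a a') (Num.max d d')
    _ _ _ qu (qp k) Lu LDu (Lp k) (LDp k)).
  - by rewrite lt_min a0.
  - by rewrite gt_min; apply/orP; left; rewrite lt_max ad.
  - by rewrite gt_max d1.
  move=> s Js; rewrite le_min ge_max => sad.
  have e1 : s <= a \/ d <= s by case: sad => /andP[? ?]; [left|right].
  have e2 : s <= a' \/ d' <= s by case: sad => /andP[? ?]; [left|right].
  by rewrite /psi y0// y0'// qy0// qy0'// !mulr0 addr0.
have eh : {ae leb, forall s, J s -> wop b Dh s = l' * h s}.
  have [dh _ dF] := qh; apply: filterS2 dF eg => s /= dF eg Js.
  rewrite /h -gE// -eg// /Sop /wop; congr (_ * - _); apply/esym/der_derive1.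
  apply: (der_near _ (dF Js)).
  have nJ : \forall z \near s, J z.
    exact: (open_nbhs_nbhs (conj (interval_open _ _) Js)).
  have nnJ := near_join nJ.
  apply: filterS2 nJ nnJ => z Jz nJz; have /J_itv/andP[z0 _] := Jz.
  have dz : is_derive z 1 g ((qderiv y z + c * qderiv v1 z) / z).
    apply: (der_near _ (dh z Jz)); apply: filterS nJz => x Jx.
    by rewrite gE.
  by rewrite [RHS]/qderiv (der_derive1 dz) [RHS]mulrC divfK// gt_eqF.
have E1 k : ip f' (psi k) = l' * ip h (psi k).
  have <- : ip (wop b Dh) (psi k) = l' * ip h (psi k).
    by rewrite -(ipZl sub l' Lh (Lp k)); exact: (ip_ae_eq LDh (L2Z sub l' Lh) (Lp k) eh).
  rewrite (grn k _ _ _ qh Lh LDh).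
  have lim1 := L2cvg_ip sub LDn (fun=> Lp k) Lf' (Lp k) cDn (L2cvg_cst (psi k)).
  have lim2 := L2cvg_ip sub Lhn (fun=> LDp k) Lh (LDp k) chn (L2cvg_cst (wop b (Dp k))).
  have e : (fun n => ip (wop b (Dn n)) (psi k)) = (fun n => ip (hn n) (wop b (Dp k))).
    by apply/funext => n; exact: (grn k _ _ _ (qhn n) (Lhn n) (LDn n)).
  by rewrite e in lim1; exact: (cvg_unique _ lim1 lim2).
have E2 : ip f' h = l' * ip h h.
  have lim1 := L2cvg_ip sub (fun=> Lf') Lp Lf' Lh (L2cvg_cst f') cp.
  have lim2 := L2cvg_ip sub (fun=> Lh) Lp Lh Lh (L2cvg_cst h) cp.
  have lim3 : l' * ip h (psi n) @[n --> \oo] --> l' * ip h h by exact: cvgMl_tmp.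
  have e : (fun n => ip f' (psi n)) = (fun n => l' * ip h (psi n)).
    by apply/funext => n; exact: E1.
  by rewrite e in lim1; exact: (cvg_unique _ lim1 lim3).
have P n : l * ip (hn n) (hn n) <= ip (wop b (Dn n)) (hn n).
  have [a [d [a0 ad d1 y0 qy0]]] := Dmin'_zero_outside (Dyn n).
  have Jx x : 0 < x -> x < 1 -> J x by move=> x0 x1; rewrite /J/= in_itv/= x0.
  pose a' := Num.min a (c1 / 2); pose d' := Num.max d ((1 + c2) / 2).
  apply: (@picone _ _ _ _ sub pl _ _ _ a' d' c _ _ _ (qhn n) (Lhn n) (LDn n)).
  - by rewrite lt_min a0 divr_gt0.
  - by rewrite gt_min; apply/orP; left; rewrite lt_max ad.
  - by rewrite gt_max d1/=; lra.
  - move=> s; rewrite le_min => /and3P[s0 sa sc].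
    have Js : J s by apply: Jx => //; lra.
    have sc1 : s < c1 by lra.
    rewrite /hn y0//; last by left.
    rewrite qy0//; last by left.
    by rewrite hv1_left// {1}/qderiv v1_flat ?mulr0 ?mulr1 ?addr0 ?add0r//; left.
  - move=> s; rewrite ge_max => /andP[/andP[sd sc] s1].
    have Js : J s by apply: Jx => //; lra.
    have sc2 : c2 < s by lra.
    rewrite /hn y0//; last by right.
    rewrite qy0//; last by right.
    by rewrite hv1_right// {1}/qderiv v1_flat ?mulr0 ?addr0//; right.
have hh0 : 0 < ip h h.
  apply: ip_gt0 => // h0; apply: ng; apply: filterS h0 => s /= h0 Js.
  by rewrite gE// -[RHS](h0 Js).
rewrite -(ler_pM2r hh0) -E2.
have lim1 := L2cvg_ip sub LDn Lhn Lf' Lh cDn chn.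
have lim2 : l * ip (hn n) (hn n) @[n --> \oo] --> l * ip h h.
  by apply: cvgMl_tmp; exact: (L2cvg_ip sub Lhn Lhn Lh Lh chn chn).
apply: (ler_cvg_to lim2 lim1).
by apply: nearW => n; exact: P.
Qed.

End first_eigenvalue.

(** * The Rayleigh quotient *)

Section auxiliary_integrals.
Context {R : realType}.
Implicit Types (f g : R -> R) (s a c : R).

Local Notation leb := (@lebesgue_measure R).

Lemma le_ge0_integral_support (f g : R -> \bar R) (A B : set R) :
  (forall x, A x -> 0 <= f x)%E -> (forall x, B x -> 0 <= g x)%E ->
  (forall x, A x -> f x = 0 \/ B x /\ (f x <= g x)%E) ->
  (\int[leb]_(x in A) f x <= \int[leb]_(x in B) g x)%E.
Proof.
move=> f0 g0 fg; rewrite !ge0_integralE//.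
apply: ereal_sup_le => _ [h /= hf <-]; exists h => // x.
apply: le_trans (hf x) _; rewrite !patchE.
have gB0 : (0 <= if x \in B then g x else 0)%E by case: ifPn => //; rewrite inE => /g0.
case: ifPn => // /set_mem Ax; have [->//|[Bx h']] := fg x Ax.
by rewrite mem_set.
Qed.

Lemma integral_inv_le f q r : 0 < r < 1 -> 0 <= q -> (forall s, J s -> 0 <= f s) ->
  (forall s, J s -> s < r -> f s = 0) -> (forall s, J s -> r <= s -> f s <= q / s) ->
  (\int[leb]_(s in @J R) (f s)%:E <= (q * - ln r)%:E)%E.
Proof.
move=> /andP[r0 r1] q0 f0 fr fq.
have dF x : r <= x <= 1 -> is_derive x 1 (fun s => q * ln s) (q / x).
  move=> /andP[rx _]; have x0 : 0 < x by exact: lt_le_trans rx.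
  by apply: (der_eq (derZ q (der_ln (der_id x) x0))); rewrite div1r.
have -> : q * - ln r = q * ln 1 - q * ln r by rewrite ln1; ring.
rewrite -(@FTC2_closed _ (fun s => q / s) (fun s => q * ln s) r 1 r1 _ dF); last first.
  move=> x /andP[rx _]; apply: cvgMl_tmp; apply: cvgV => //.
  by rewrite gt_eqF// (lt_le_trans r0).
apply: le_ge0_integral_support.
- by move=> s Js; rewrite lee_fin f0.
- move=> s; rewrite /= in_itv/= => /andP[rs _].
  by rewrite lee_fin divr_ge0// ltW// (lt_le_trans r0).
move=> s Js; have /J_itv/andP[s0 s1] := Js.
have [sr|rs] := ltP s r; first by left; rewrite fr.
by right; split; [rewrite /= in_itv/= rs ltW|rewrite lee_fin fq].
Qed.

Lemma integral_invB_le f q r : 0 < r < 1 -> 0 <= q -> (forall s, J s -> 0 <= f s) ->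
  (forall s, J s -> 1 - s < r -> f s = 0) ->
  (forall s, J s -> r <= 1 - s -> f s <= q / (1 - s)) ->
  (\int[leb]_(s in @J R) (f s)%:E <= (q * - ln r)%:E)%E.
Proof.
move=> /andP[r0 r1] q0 f0 fr fq.
have dF x : 0 <= x <= 1 - r -> is_derive x 1 (fun s => - q * ln (1 - s)) (q / (1 - x)).
  move=> /andP[_ xr]; have x0 : 0 < 1 - x by lra.
  apply: (der_eq (derZ (- q) (der_ln (derB (der_cst 1 x) (der_id x)) x0))).
  by rewrite sub0r mulN1r mulrNN.
have -> : q * - ln r = - q * ln (1 - (1 - r)) - - q * ln (1 - 0).
  have -> : 1 - (1 - r) = r by ring.
  by rewrite subr0 ln1; ring.
have r10 : 0 < 1 - r by rewrite subr_gt0.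
rewrite -(@FTC2_closed _ (fun s => q / (1 - s)) (fun s => - q * ln (1 - s)) 0 (1 - r) r10 _ dF); last first.
  move=> x /andP[_ xr]; apply: cvgMl_tmp; apply: cvgV; first by rewrite gt_eqF//; lra.
  exact: der_continuous (derB (der_cst 1 x) (der_id x)).
apply: le_ge0_integral_support.
- by move=> s Js; rewrite lee_fin f0.
- move=> s; rewrite /= in_itv/= => /andP[_ sr].
  by rewrite lee_fin divr_ge0//; lra.
move=> s Js; have /J_itv/andP[s0 s1] := Js.
have [sr|rs] := ltP (1 - s) r; first by left; rewrite fr.
by right; split; [rewrite /= in_itv/= ltW//; lra|rewrite lee_fin fq].
Qed.

Lemma compact_integrable a c f : 0 < a -> a <= c -> c < 1 ->
  (forall s, J s -> {for s, continuous f}) -> zero_outside a c f ->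
  leb.-integrable (@J R) (EFin \o f).
Proof.
move=> a0 ac c1 cf f0.
have Jx x : a <= x <= c -> J x.
  by move=> /andP[ax xc]; rewrite /J/= in_itv/= (lt_le_trans a0)// (le_lt_trans xc).
have cn : {within `[a, c], continuous (fun s => `|f s|)}.
  apply: within_itv_continuous => s /Jx Js.
  exact: (continuous_comp (cf s Js) (@norm_continuous _ _ _)).
have [p pac pmax] := EVT_max ac cn.
have mf := J_cont_measurable cf.
apply: measurable_bounded_integrable.
- exact: measurable_J.
- have e : leb (@J R : set (measurableTypeR R)) = 1%:E by exact: lebesgue_J.
  by rewrite [X in (X < _)%E](_ : _ = 1%:E)// ltry.
- exact: mf.
exists `|f p|; split; first exact: num_real.
move=> M pM s Js; apply: le_trans (ltW pM).
have [sac|] := boolP (a <= s <= c); first by apply: pmax; rewrite in_itv.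
rewrite negb_and -!ltNge => h; rewrite f0 ?normr0//.
by case/orP : h => /ltW h; [left|right].
Qed.

Lemma ae_itv (P : R -> Prop) a c : a < c -> {ae leb, forall s, P s} ->
  exists2 s, a < s < c & P s.
Proof.
move=> ac [N [mN N0 PN]]; apply: contrapT => h.
have sub : `]a, c[%classic `<=` N.
  move=> s; rewrite /= in_itv/= => sac; apply: PN => Ps; apply: h.
  by exists s.
have mI : measurable (`]a, c[%classic : set (measurableTypeR R)).
  exact: (measurable_itv `]a, c[).
have le : (leb `]a, c[%classic <= leb N)%E by apply: le_measure; rewrite ?inE.
have e : leb `]a, c[%classic = (c - a)%:E.
  have := lebesgue_measure_itv (`]a, c[ : interval R).
  by rewrite /= lte_fin ac EFinB.
have : ((c - a)%:E <= 0%:E)%E.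
  apply: (@le_trans _ _ (leb N)).
    by apply: le_trans le; rewrite le_eqVlt; apply/orP; left; apply/eqP; exact: esym.
  by rewrite le_eqVlt; apply/orP; left; apply/eqP; exact: N0.
by rewrite lee_fin; apply/negP; rewrite -ltNge subr_gt0.
Qed.

Lemma continuous_not_ae0 f s : J s -> {for s, continuous f} -> f s != 0 ->
  ~ {ae leb, forall x, J x -> f x = 0}.
Proof.
move=> Js cf fs0 h; have /J_itv/andP[s0 s1] := Js.
have : \forall y \near s, f y != 0 by exact: (cvgr_neq0 _ cf).
move=> [e /= e0 He].
have ac : s < Num.min 1 (s + e) by rewrite lt_min s1 ltrDl.
have [x /andP[sx]] := ae_itv ac h.
rewrite lt_min => /andP[x1 xe] fx.
have : f x != 0.
  by apply: He; rewrite /= ltr0_norm ?subr_lt0// opprB ltrBlDl.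
by rewrite fx ?eqxx// /J/= in_itv/= x1 (lt_trans s0).
Qed.

End auxiliary_integrals.

Section rayleigh_quotient.
Context {R : realType}.
Variables (b : nat -> R) (m l : R).
Hypothesis sub : subcritical b m.
Hypothesis pl : principal b l.
Variables (c1 c2 : R) (v1 : R -> R).
Hypotheses (hc1 : 0 < c1) (hc12 : c1 < c2) (hc2 : c2 < 1) (hv1 : smooth v1)
  (hv1_left : forall s, 0 < s -> s < c1 -> v1 s = 1)
  (hv1_right : forall s, c2 < s -> s < 1 -> v1 s = 0).

Local Notation leb := (@lebesgue_measure R).
Local Notation w := (weight b).
Local Notation mJ := (@measurable_J R).
Local Notation chi := (chi v1).
Local Notation ip := (ip b).
Local Notation phi := (phi b l).
Local Notation flux := (flux b l).
Local Notation rho := (rho b l).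

Lemma phi_smooth : smooth phi.
Proof.
apply/smoothP => n s /J_itv/andP[s0 s1]; apply: Cn_ps; first exact: (rad1_ecoef sub).
by rewrite gtr0_norm.
Qed.

Lemma derive1_phi s : J s -> derive1 phi s = - flux s / s.
Proof. by move=> /J_itv s01; apply: der_derive1; exact: (is_derive_phi_flux sub). Qed.

Lemma qderiv_phi s : J s -> qderiv phi s = - flux s.
Proof.
move=> Js; have /J_itv/andP[s0 _] := Js.
by rewrite /qderiv derive1_phi// mulrC divfK// gt_eqF.
Qed.

Lemma near_J s : J s -> \forall z \near s, @J R z.
Proof. by move=> Js; exact: (open_nbhs_nbhs (conj (interval_open _ _) Js)). Qed.

Lemma Sop_phi s : J s -> Sop b phi s = l * phi s.
Proof.
move=> Js; have w0 := weightJ_gt0 sub Js.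
have -> : Sop b phi s = (w s)^-1 * - - (l * phi s * w s).
  rewrite /Sop; congr (_ * - _); apply: der_derive1.
  have d := derN (is_derive_flux sub l (J_itvW Js)).
  by apply: (der_near _ d); apply: filterS (near_J Js) => z Jz; rewrite qderiv_phi.
by rewrite opprK; field; rewrite gt_eqF.
Qed.

Lemma phi_L2 : L2 b phi.
Proof.
have [C C0 HC] := principal_bounds sub pl; have bt := beta_gt0 sub.
apply: (L2_bounded sub (K := C ^+ 2 / (b 0%N - m))).
  by move=> s Js; apply: (smooth_continuous phi_smooth).
move=> s Js; have s01 := J_itv Js; have /andP[s0 s1] := s01.
have [h _] := HC s s01; have p0 := phi_ge0 pl s01.
have hw := weight_le sub (J_itvW Js); have w0 := weightJ_gt0 sub Js.
have s1' : 0 < 1 - s by rewrite subr_gt0.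
apply: (@le_trans _ _ ((C * (1 - s)) ^+ 2 * ((b 0%N - m) * (1 - s))^-1)).
  apply: ler_pM => //; [exact: sqr_ge0|exact: ltW|].
  by rewrite ler_pXn2r ?nnegrE// mulr_ge0// ltW.
have -> : (C * (1 - s)) ^+ 2 * ((b 0%N - m) * (1 - s))^-1 = C ^+ 2 / (b 0%N - m) * (1 - s).
  by field; rewrite !gt_eqF.
rewrite ler_piMr//; last lra.
by rewrite divr_ge0 ?sqr_ge0// ltW.
Qed.

Lemma test_zero_outside (g : R -> R) : test_function g -> exists a c, [/\ 0 < a, a < c, c < 1,
  zero_outside a c g & zero_outside a c (derive1 g)].
Proof.
move=> [_ /support_itv[a [c [a0 ac c1' g0]]]].
have a2 : a / 2 < a by lra.
have c2' : c < (1 + c) / 2 by lra.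
exists (a / 2), ((1 + c) / 2); split; try lra.
  by move=> s Js h; apply: g0 => //; case: h => ?; [left|right]; lra.
exact: zero_outside_derive1 g0.
Qed.

(** Picone's identity for the Dirichlet form, where the integrated term vanishes with
    the compact support. *)
Lemma rayleigh_identity (g : R -> R) : test_function g ->
  \int[leb]_(s in @J R) (s * derive1 g s ^+ 2) - l * ip g g =
  \int[leb]_(s in @J R) ((s * derive1 g s + rho s * g s) ^+ 2 / s).
Proof.
move=> tg; have [sg _] := tg; have [a [c [a0 ac c1' g0 d0]]] := test_zero_outside tg.
have acw := ltW ac.
have cg s : J s -> {for s, continuous g} by exact: smooth_continuous.
have cdg s : J s -> {for s, continuous (derive1 g)}.
  by apply: smooth_continuous; exact: smooth_derive1.
have cr s : J s -> {for s, continuous rho} by move=> /J_itv; exact: (rho_continuous sub pl).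
have cw s : J s -> {for s, continuous w} by move=> Js; exact: (weight_continuous sub (J_itvW Js)).
have ci s : J s -> {for s, continuous (fun s : R => s^-1)}.
  by move=> /J_itv/andP[s0 _]; apply: cvgV => //; rewrite gt_eqF.
pose f1 s := s * derive1 g s ^+ 2; pose f2 s := g s * g s * w s.
pose f3 s := (s * derive1 g s + rho s * g s) ^+ 2 / s.
pose f4 s := (l * w s + rho s ^+ 2 / s) * (g s * g s) +
  rho s * (derive1 g s * g s + g s * derive1 g s).
have cX (k : R -> R) s : {for s, continuous k} -> {for s, continuous (fun s => k s ^+ 2)}.
  by move=> ck; rewrite (_ : (fun s => _) = (fun s => k s * k s)); [exact: cvgM|apply/funext => x; rewrite expr2].
have i1 : leb.-integrable (@J R) (EFin \o f1).
  apply: (compact_integrable a0 acw c1').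
    by move=> s Js; apply: cvgM => //; apply: cX; exact: cdg.
  by move=> s Js h; rewrite /f1 d0// expr0n/= mulr0.
have i2 : leb.-integrable (@J R) (EFin \o f2).
  apply: (compact_integrable a0 acw c1').
    by move=> s Js; apply: cvgM; [apply: cvgM; exact: cg|exact: cw].
  by move=> s Js h; rewrite /f2 g0// !mul0r.
have i3 : leb.-integrable (@J R) (EFin \o f3).
  apply: (compact_integrable a0 acw c1').
    move=> s Js; apply: cvgM; last exact: ci.
    apply: (cX (fun s => s * derive1 g s + rho s * g s)).
    by apply: cvgD; apply: cvgM => //; [exact: cdg|exact: cr|exact: cg].
  by move=> s Js h; rewrite /f3 d0// g0// !mulr0 addr0 expr0n/= mul0r.
have i4 : leb.-integrable (@J R) (EFin \o f4).
  apply: (compact_integrable a0 acw c1').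
    move=> s Js; apply: cvgD; apply: cvgM.
    - apply: cvgD; first by apply: cvgMl_tmp; exact: cw.
      by apply: cvgM; [apply: cX; exact: cr|exact: ci].
    - by apply: cvgM; exact: cg.
    - exact: cr.
    - by apply: cvgD; apply: cvgM; [exact: cdg|exact: cg|exact: cg|exact: cdg].
  by move=> s Js h; rewrite /f4 g0// !(mul0r, mulr0) addr0 mulr0 addr0.
have half (e : R) : 0 <= e * \int[leb]_(s in @J R) f4 s.
  rewrite -(RintegralZl _ mJ i4).
  have Xi : leb.-integrable (@J R) (EFin \o (fun s => e * f4 s)).
    have h := integrableZl mJ e i4; apply: eq_integrable h; first exact: mJ.
    by move=> s _; rewrite /= EFinM.
  have x0i : leb.-integrable (`]0, a]%classic : set (measurableTypeR R)) (EFin \o (fun=> 0 : R)).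
    exact: integrable0.
  pose G s := - e * (rho s * (g s * g s)).
  have dG s : J s -> is_derive s 1 G (- e * f4 s).
    move=> Js; have dg := smooth_derive sg Js.
    have dr := is_derive_rho sub pl (J_itv Js).
    exact: (derZ (- e) (derM dr (derM dg dg))).
  have Jx x : a <= x <= c -> J x.
    by move=> /andP[ax xc]; rewrite /J/= in_itv/= (lt_le_trans a0)// (le_lt_trans xc).
  have := @J_integral_ge _ a c (fun=> 0) _ G a0 ac c1' Xi x0i.
  have -> : \int[leb]_(s in `]0, a]) 0 = 0 :> R by rewrite /Rintegral integral0.
  have Ga : G a = 0.
    by rewrite /G g0 ?mulr0//; [apply: Jx; rewrite acw lexx|left].
  have Gc : G c = 0.
    by rewrite /G g0 ?mulr0//; [apply: Jx; rewrite acw lexx|right].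
  rewrite Ga Gc subrr addr0; apply.
  - apply: nearW => s /andP[s0 sa]; rewrite /f4 g0; last by left; exact: ltW.
      by rewrite !(mul0r, mulr0) addr0 mulr0 addr0 mulr0.
    by rewrite /J/= in_itv/= s0 (lt_trans sa (lt_trans ac c1')).
  - apply: nearW => s /andP[cs s1]; rewrite /f4 g0; last by right; exact: ltW.
      by rewrite !(mul0r, mulr0) addr0 mulr0 addr0 mulr0.
    by rewrite /J/= in_itv/= s1 andbT (lt_trans (lt_trans a0 ac) cs).
  - have acg : abs_continuous a c g by exact: smooth_AC_loc.
    apply: ac_mul => //; last by apply: ac_mul => //; [exact: (rho_ac sub pl)|exact: ac_mul].
    by apply: (@ac_lipschitz _ _ _ _ 0) => x y *; rewrite subrr normr0 mul0r.
  - apply: nearW => s /andP[as_ sc]; have Js : J s by apply: Jx; rewrite !ltW.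
    by exists (- e * f4 s); [exact: dG|rewrite mulNr opprK].
have f40 : \int[leb]_(s in @J R) f4 s = 0.
  by have := half 1; have := half (-1) => *; apply/eqP; rewrite eq_le; apply/andP; split; lra.
have il := integrableZl mJ l i2.
have i12 : leb.-integrable (@J R) (EFin \o (fun s => f1 s - l * f2 s)).
  have h := integrableB mJ i1 il; apply: eq_integrable h; first exact: mJ.
  by move=> s _; rewrite /= EFinB EFinM.
have -> : \int[leb]_(s in @J R) (s * derive1 g s ^+ 2) - l * ip g g =
    \int[leb]_(s in @J R) (f1 s - l * f2 s).
  by rewrite (RintegralB mJ i1 il) (RintegralZl _ mJ i2).
rewrite -[LHS]addr0 -f40 -(RintegralD mJ i12 i4); apply: eq_Rintegral => s.
rewrite inE => /J_itv/andP[s0 _].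
by rewrite /f1 /f2 /f4; field; rewrite gt_eqF.
Qed.

Lemma rayleighE (g : R -> R) :
  rayleigh b g = (\int[leb]_(s in @J R) (s * derive1 g s ^+ 2)) / ip g g.
Proof. by congr (_ / _); apply: eq_Rintegral => s _; rewrite expr2. Qed.

Lemma test_L2 (g : R -> R) : test_function g -> L2 b g.
Proof. by move=> /(test_function_Dmin' sub)[[]]. Qed.

Lemma test_ip_gt0 (g : R -> R) : test_function g -> (exists s, J s /\ g s != 0) -> 0 < ip g g.
Proof.
move=> tg [s [Js gs]]; apply: (ip_gt0 sub (test_L2 tg)).
by apply: (continuous_not_ae0 Js _ gs); apply: smooth_continuous Js; case: tg.
Qed.

Lemma rayleigh_ge (g : R -> R) : test_function g -> (exists s, J s /\ g s != 0) ->
  l <= rayleigh b g.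
Proof.
move=> tg gn; have ip0 := test_ip_gt0 tg gn.
rewrite rayleighE ler_pdivlMr// -subr_ge0 rayleigh_identity//.
by apply: Rintegral_ge0 => s /J_itv/andP[s0 _]; rewrite divr_ge0 ?sqr_ge0// ltW.
Qed.

(** For [g = chi n phi] the square in [rayleigh_identity] reduces to
    [s (chi n)' ^2 phi^2], and [phi <= C (1 - s)] compensates the growth of [(chi n)']
    at 1. *)
Lemma rayleigh_chi_phi : exists2 A, 0 <= A & forall n,
  \int[leb]_(s in @J R) (s * derive1 (fun s => chi n s * phi s) s ^+ 2) -
  l * ip (fun s => chi n s * phi s) (fun s => chi n s * phi s) <= A / n.+1%:R.
Proof.
have [M M0 HM] := chi_bounds hc1 hc12 hc2 hv1 hv1_left hv1_right.
have [C C0 HC] := principal_bounds sub pl.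
exists (M ^+ 2 * C ^+ 2) => [|n]; first by rewrite mulr_ge0 ?sqr_ge0.
have tg := chi_test hc1 hc12 hc2 hv1 hv1_left hv1_right n phi_smooth.
rewrite rayleigh_identity//.
have n0 : 0 < n.+1%:R :> R by rewrite ltr0n.
pose q : R := M ^+ 2 * C ^+ 2 / n.+1%:R ^+ 2.
have q0 : 0 <= q by apply: divr_ge0; [apply: mulr_ge0; exact: sqr_ge0|exact: sqr_ge0].
have r01 : 0 < expR (- n.+1%:R : R) < 1.
  by rewrite expR_gt0/= expR_lt1 oppr_lt0.
have dchi s : J s -> is_derive s 1 (chi n) (derive1 (chi n) s).
  move=> Js; apply: (smooth_derive _ Js).
  exact: (chi_smooth hc1 hc12 hc2 hv1 hv1_left hv1_right (n := n)).
have E s : J s -> (s * derive1 (fun s => chi n s * phi s) s + rho s * (chi n s * phi s)) ^+ 2 / s =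
    s * (derive1 (chi n) s * phi s) ^+ 2.
  move=> Js; have /J_itv s01 := Js; have /andP[s0 s1] := s01.
  have p0 := phi_gt0 pl s01.
  rewrite (der_derive1 (derM (dchi s Js) (is_derive_phi_flux sub l s01))) (_ : rho s = flux s / phi s)//.
  by field; rewrite !gt_eqF.
have Ei : \int[leb]_(s in @J R) ((s * derive1 (fun s => chi n s * phi s) s +
      rho s * (chi n s * phi s)) ^+ 2 / s) =
    \int[leb]_(s in @J R) (s * (derive1 (chi n) s * phi s) ^+ 2).
  by apply: eq_Rintegral => s; rewrite inE => Js; exact: E.
rewrite Ei.
have le : (\int[leb]_(s in @J R) (s * (derive1 (chi n) s * phi s) ^+ 2)%:E <= (q * - ln (expR (- n.+1%:R)))%:E)%E.
  apply: integral_inv_le => //.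
  - by move=> s /J_itv/andP[s0 _]; rewrite mulr_ge0 ?sqr_ge0// ltW.
  - move=> s /J_itv s01 sn; have /andP[s0 s1] := s01.
    have [|_ -> _] := chi_flat hc1 hc12 hc2 hv1 hv1_left hv1_right (n := n) s01.
      by apply: le_lt_trans sn; rewrite ler_piMr ?ltW//; lra.
    by rewrite mul0r expr0n/= mulr0.
  - move=> s /J_itv s01 _; have /andP[s0 s1] := s01.
    have [_ hc _] := HM n s s01; have [hp _] := HC s s01.
    have s1' : 0 < 1 - s by rewrite subr_gt0.
    have p0 := phi_ge0 pl s01.
    have h : `|derive1 (chi n) s * phi s| <= M * C / s / n.+1%:R.
      rewrite normrM (ger0_norm p0); apply: le_trans (ler_pM _ _ hc hp) _ => //.
      rewrite le_eqVlt; apply/orP; left; apply/eqP.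
      field; rewrite !gt_eqF//.
    rewrite -(real_normK (num_real (_ * phi s))).
    apply: (@le_trans _ _ (s * (M * C / s / n.+1%:R) ^+ 2)).
      rewrite ler_pM2l// ler_pXn2r ?nnegrE//.
      by rewrite divr_ge0 ?divr_ge0 ?mulr_ge0 ?ltW.
    by rewrite le_eqVlt; apply/orP; left; apply/eqP; rewrite /q; field; rewrite !gt_eqF.
rewrite /Rintegral.
apply: (@le_trans _ _ (fine (q * - ln (expR (- n.+1%:R)))%:E)).
  apply: fine_le => //.
  rewrite ge0_fin_numE.
    by apply: le_lt_trans le _; rewrite ltry.
  by apply: integral_ge0 => s /J_itv/andP[s0 _]; rewrite lee_fin mulr_ge0 ?sqr_ge0// ltW.
rewrite /= expRK opprK /q le_eqVlt; apply/orP; left; apply/eqP.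
by field; rewrite gt_eqF.
Qed.

Lemma phi_not_ae0 : ~ {ae leb, forall s, J s -> phi s = 0}.
Proof.
have J2 : @J R 2^-1 by rewrite /J/= in_itv/=; apply/andP; split; lra.
apply: (continuous_not_ae0 J2).
  by apply: smooth_continuous J2; exact: phi_smooth.
by rewrite gt_eqF// (phi_gt0 pl (J_itv J2)).
Qed.

(** The cut-off eigenfunctions [chi n phi] are a minimizing sequence. *)
Lemma rayleigh_inf : l = inf [set rayleigh b g | g in
   [set g | test_function g /\ exists s, @J R s /\ g s != 0]].
Proof.
set S := (X in inf X).
have lbS : lbound S l by move=> _ [g [tg gn] <-]; exact: rayleigh_ge.
pose u n s := chi n s * phi s.
have tu n : test_function (u n).
  exact: (chi_test hc1 hc12 hc2 hv1 hv1_left hv1_right n phi_smooth).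
have J2 : @J R 2^-1 by rewrite /J/= in_itv/=; apply/andP; split; lra.
have nu : \forall n \near \oo, S (rayleigh b (u n)).
  have := chi_pointwise hc1 hc12 hc2 hv1_left J2; apply: filterS => n c1'.
  exists (u n) => //; split => //; exists 2^-1; split => //.
  by rewrite /u c1' mul1r gt_eqF// (phi_gt0 pl (J_itv J2)).
have S0 : S !=set0.
  by have [N _ HN] := nu; exists (rayleigh b (u N)); apply: HN; exact: leqnn.
apply/eqP; rewrite eq_le; apply/andP; split; first exact: lb_le_inf.
have Lu n : L2 b (u n) by exact: test_L2.
have cu : L2cvg b u phi.
  exact: (chi_L2cvg sub hc1 hc12 hc2 hv1 hv1_left hv1_right phi_L2).
have ip0 : 0 < ip phi phi by exact: (ip_gt0 sub phi_L2 phi_not_ae0).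
have cip := L2cvg_ip sub Lu Lu phi_L2 phi_L2 cu cu.
have [A A0 HA] := rayleigh_chi_phi.
have cl : l + A / n.+1%:R / ip (u n) (u n) @[n --> \oo] --> l + A * 0 / ip phi phi.
  apply: cvgD; first exact: cvg_cst.
  apply: cvgM; last by apply: cvgV => //; rewrite gt_eqF.
  by apply: cvgMl_tmp; exact: cvg_harmonic.
rewrite mulr0 mul0r addr0 in cl.
apply: (cvgr_to_ge cl).
have ipp : \forall n \near \oo, 0 < ip (u n) (u n) by exact: (cvgr_gt _ cip).
apply: filterS2 nu ipp => n Sn ipn.
have h : inf S <= rayleigh b (u n) by apply: ge_inf => //; exists l.
apply: le_trans h _.
rewrite rayleighE ler_pdivrMr// mulrDl divfK ?gt_eqF//.
by have := HA n; rewrite -/(u n) lerBlDl.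
Qed.

End rayleigh_quotient.

(** * The principal eigenvalue is an eigenvalue *)

Section principal_eigenvalue.
Context {R : realType}.
Variables (b : nat -> R) (m l : R).
Hypothesis sub : subcritical b m.
Hypothesis pl : principal b l.
Variables (c1 c2 : R) (v1 : R -> R).
Hypotheses (hc1 : 0 < c1) (hc12 : c1 < c2) (hc2 : c2 < 1) (hv1 : smooth v1)
  (hv1_left : forall s, 0 < s -> s < c1 -> v1 s = 1)
  (hv1_right : forall s, c2 < s -> s < 1 -> v1 s = 0).

Local Notation leb := (@lebesgue_measure R).
Local Notation w := (weight b).
Local Notation chi := (chi v1).
Local Notation phi := (phi b l).
Local Notation flux := (flux b l).

Let y s := phi s - v1 s.

Lemma remainder_smooth : smooth y.
Proof.
have /smoothP sp := @phi_smooth _ _ _ l sub; have /smoothP sv := hv1.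
by apply/smoothP => n s Js; apply: CnB; [exact: sp|exact: sv].
Qed.

(** At 0 the constant 1 of [phi] is removed by [v1]; at 1 both functions vanish, and
    [phi] does so linearly. *)
Lemma remainder_bound : exists2 K, 0 < K & forall s, J s ->
  `|y s| <= K * (s * (1 - s)) /\ `|derive1 y s| <= K.
Proof.
have [M M0 HM] := eta_bounds hc1 hc12 hc2 hv1 hv1_left hv1_right.
have [C C0 HC] := principal_bounds sub pl.
have h1 := hc1; have h12 := hc12; have h2 := hc2.
have d0 : 0 < c1 * (1 - c2) by rewrite mulr_gt0 ?subr_gt0.
pose K := (C + M) / (c1 * (1 - c2)) + C / (1 - c1) + (C + M).
have k1 : 0 < (C + M) / (c1 * (1 - c2)) by rewrite divr_gt0 ?addr_gt0.
have k2 : 0 < C / (1 - c1) by rewrite divr_gt0 ?subr_gt0//; lra.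
have k3 : 0 < C + M by rewrite addr_gt0.
exists K; first by rewrite !addr_gt0.
have etaE s : J s -> eta v1 s = v1 s by move=> /J_itv; exact: eta_v1.
have dphi_le s : J s -> `|derive1 phi s| <= C.
  move=> Js; have /J_itv s01 := Js; have /andP[s0 s1] := s01.
  have [_ hf] := HC s s01.
  have f0 : 0 <= flux s by apply: (flux_nneg sub pl); rewrite (ltW s0).
  by rewrite (derive1_phi l sub Js) normrM normrN normfV (ger0_norm f0) (gtr0_norm s0) ler_pdivrMr.
move=> s Js; have /J_itv s01 := Js; have /andP[s0 s1] := s01.
have s1' : 0 < 1 - s by rewrite subr_gt0.
have p0 : 0 < s * (1 - s) by rewrite mulr_gt0.
split; last first.
  have dy := derB (smooth_derive (@phi_smooth _ _ _ l sub) Js) (smooth_derive hv1 Js).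
  rewrite (der_derive1 dy).
  have dv : derive1 v1 s = derive1 (eta v1) s.
    apply: der_derive1; have de : is_derive s 1 (eta v1) (derive1 (eta v1) s).
      exact: nbhs_singleton (Cn_der (Cn_eta hc1 hc12 hc2 hv1 hv1_left hv1_right 1 s)).
    by apply: (der_near _ de); apply: filterS (near_J Js) => z Jz; rewrite etaE.
  have [_ hd _] := HM s; rewrite dv; apply: le_trans (ler_normB _ _) _.
  by have := dphi_le s Js; rewrite /K; lra.
have [sc|cs] := ltP s c1.
  rewrite /y hv1_left//.
  have lip : 1 - phi s <= C * s.
    have hder := @le_of_deriv_ge0 _ (fun x => phi x + C * x) (fun x => dphi b l x + C) 0 s (ltW s0).
    have h : phi 0 + C * 0 <= phi s + C * s.
      apply: hder => x /andP[x0 xs].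
        have x1 : `|x| < 1 by rewrite ger0_norm// (le_lt_trans xs).
        by apply: (der_eq (derD (is_derive_phi sub l x1) (derZ C (der_id x)))); rewrite mulr1.
      have Jx : J x by rewrite /J/= in_itv/= x0 (lt_trans xs).
      have x1 : `|x| < 1 by rewrite gtr0_norm// (lt_trans xs).
      have := dphi_le x Jx; rewrite (der_derive1 (is_derive_phi sub l x1)) ler_norml.
      by move=> /andP[+ _]; rewrite -subr_ge0 opprK.
    by rewrite phi0 mulr0 addr0 in h; lra.
  have le1 := phi_le_1 sub pl s01.
  rewrite ler0_norm ?subr_le0// opprB; apply: le_trans lip _.
  apply: (@le_trans _ _ (C / (1 - c1) * (s * (1 - s)))); last first.
    by rewrite ler_pM2r// /K; lra.
  have -> : C / (1 - c1) * (s * (1 - s)) = C * s * ((1 - s) / (1 - c1)) by ring.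
  rewrite ler_peMr//; first by rewrite mulr_ge0// ltW.
  by rewrite ler_pdivlMr ?subr_gt0//; lra.
apply: (@le_trans _ _ ((C + M) / (c1 * (1 - c2)) * (s * (1 - s)))); last first.
  by rewrite ler_pM2r// /K; lra.
have hphi : `|phi s| <= C / (c1 * (1 - c2)) * (s * (1 - s)).
  rewrite ger0_norm ?(phi_ge0 pl)//; have [hp _] := HC s s01; apply: le_trans hp _.
  have -> : C / (c1 * (1 - c2)) * (s * (1 - s)) = C * (1 - s) * (s / (c1 * (1 - c2))) by ring.
  rewrite ler_peMr//; first by rewrite mulr_ge0// ltW.
  rewrite ler_pdivlMr// mul1r; apply: le_trans cs.
  by rewrite ler_piMr//; lra.
have hv : `|v1 s| <= M / (c1 * (1 - c2)) * (s * (1 - s)).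
  have [sc2|c2s] := leP s c2; last first.
    by rewrite hv1_right// normr0 mulr_ge0 ?divr_ge0 ?ltW.
  rewrite -etaE//; have [he _ _] := HM s; apply: le_trans he _.
  rewrite mulrAC ler_pdivlMr// ler_pM2l//; apply: ler_pM => //; lra.
apply: le_trans (ler_normB _ _) _; rewrite mulrDl mulrDl; exact: lerD.
Qed.

Lemma Sop_remainder s : J s -> Sop b y s = l * phi s - Sop b v1 s.
Proof.
move=> Js; rewrite -(Sop_phi l sub Js) /Sop -mulrBr opprK; congr (_ * _).
have d1 := smooth_derive (smooth_qderiv (@phi_smooth _ _ _ l sub)) Js.
have d2 := smooth_derive (smooth_qderiv hv1) Js.
suff -> : derive1 (qderiv y) s = derive1 (qderiv phi) s - derive1 (qderiv v1) s.
  by rewrite opprB addrC.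
apply: der_derive1; apply: (der_near _ (derB d1 d2)).
apply: filterS (near_J Js) => z Jz; rewrite /qderiv.
by rewrite (der_derive1 (derB (smooth_derive (@phi_smooth _ _ _ l sub) Jz) (smooth_derive hv1 Jz))) mulrBr.
Qed.

Lemma remainder_L2 : L2 b y.
Proof. exact: (L2B sub (phi_L2 sub pl) (v1_L2 sub hc1 hc12 hc2 hv1 hv1_left hv1_right)). Qed.

Lemma Sop_remainder_L2 : L2 b (Sop b y).
Proof.
have Lv := v1_Sop_L2 sub hc1 hc12 hc2 hv1 hv1_left hv1_right.
have [_ fin] := L2B sub (L2Z sub l (phi_L2 sub pl)) Lv.
split.
  by apply: J_cont_measurable => s Js; apply: (Sop_continuous sub _ Js); exact: remainder_smooth.
apply: le_lt_trans fin; rewrite le_eqVlt; apply/orP; left; apply/eqP.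
by apply: eq_integral => s; rewrite inE => Js; rewrite Sop_remainder.
Qed.

Let r n s := Sop b (fun s => chi n s * y s) s - chi n s * Sop b y s.

Lemma cutoff_error n s : J s -> r n s = - (w s)^-1 * (derive1 (chi n) s * y s +
  s * (derive1 (derive1 (chi n)) s * y s + 2 * (derive1 (chi n) s * derive1 y s))).
Proof.
move=> Js.
have sc := chi_smooth hc1 hc12 hc2 hv1 hv1_left hv1_right (n := n).
have sy := remainder_smooth.
have e z : J z -> qderiv (fun s => chi n s * y s) z =
    z * (derive1 (chi n) z * y z + chi n z * derive1 y z).
  by move=> Jz; rewrite /qderiv (der_derive1 (derM (smooth_derive sc Jz) (smooth_derive sy Jz))).
have d := derM (der_id s) (derD (derM (smooth_derive (smooth_derive1 sc) Js) (smooth_derive sy Js))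
  (derM (smooth_derive sc Js) (smooth_derive (smooth_derive1 sy) Js))).
have ne : \forall z \near s, z * (derive1 (chi n) z * y z + chi n z * derive1 y z) =
    qderiv (fun s => chi n s * y s) z.
  by apply: filterS (near_J Js) => z Jz; rewrite e.
have D1 := der_near ne d.
have D2 := derM (der_id s) (smooth_derive (smooth_derive1 sy) Js).
rewrite /r /Sop (der_derive1 D1) (der_derive1 D2).
move: (derive1 (derive1 (chi n)) s) (derive1 (chi n) s) (chi n s) => k2 k1 k0.
by move: (derive1 (derive1 y) s) (derive1 y s) (y s) (w s)^-1 => y2 y1 y0 w1; ring.
Qed.

(** The remainder vanishes linearly at both ends, which leaves an error of order
    [1 / (N (1 - s))] in the operator, with [N = n + 1]. Its weighted square is at most
    [Q / (N^2 (1 - s))] for [1 - s >= e^(- N)], with integral [Q / N]. *)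
Lemma cutoff_error_bound : exists2 Q, 0 <= Q & forall n, (sqnorm b (r n) <= (Q / n.+1%:R)%:E)%E.
Proof.
have [M M0 HM] := chi_bounds hc1 hc12 hc2 hv1 hv1_left hv1_right.
have [K K0 HK] := remainder_bound.
have b00 : 0 < b 0%N by case: sub => _ [].
exists (b 0%N * (4 * M * K) ^+ 2) => [|n]; first by rewrite mulr_ge0 ?sqr_ge0// ltW.
have n0 : 0 < n.+1%:R :> R by rewrite ltr0n.
pose q : R := b 0%N * (4 * M * K) ^+ 2 / n.+1%:R ^+ 2.
have q0 : 0 <= q.
  by apply: divr_ge0; [apply: mulr_ge0; [exact: ltW|exact: sqr_ge0]|exact: sqr_ge0].
have r01 : 0 < expR (- n.+1%:R : R) < 1.
  by rewrite expR_gt0/= expR_lt1 oppr_lt0.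
have -> : b 0%N * (4 * M * K) ^+ 2 / n.+1%:R = q * - ln (expR (- n.+1%:R)).
  by rewrite expRK opprK /q; field; rewrite gt_eqF.
apply: integral_invB_le => //.
- by move=> s Js; rewrite mulr_ge0 ?sqr_ge0// ltW// (weightJ_gt0 sub).
- move=> s Js sn; have /J_itv s01 := Js; have /andP[s0 s1] := s01.
  have [|_ e1 e2] := chi_flat hc1 hc12 hc2 hv1 hv1_left hv1_right (n := n) s01.
    by apply: le_lt_trans sn; rewrite ler_piMl// ?subr_ge0 ltW.
  by rewrite cutoff_error// e1 e2 !mul0r !(mulr0, addr0) expr0n/= mul0r.
move=> s Js _; have /J_itv s01 := Js; have /andP[s0 s1] := s01.
have s1' : 0 < 1 - s by rewrite subr_gt0.
have w0 := weightJ_gt0 sub Js.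
have [_ h1 h2] := HM n s s01; have [y0 y1] := HK s Js.
set E := derive1 (chi n) s * y s +
  s * (derive1 (derive1 (chi n)) s * y s + 2 * (derive1 (chi n) s * derive1 y s)).
have hE : `|E| <= 4 * M * K / (1 - s) / n.+1%:R.
  have a1 : `|derive1 (chi n) s * y s| <= M * K / n.+1%:R.
    rewrite normrM; apply: le_trans (ler_pM _ _ h1 y0) _ => //.
    by rewrite le_eqVlt; apply/orP; left; apply/eqP; field; rewrite !gt_eqF.
  have a2 : `|derive1 (derive1 (chi n)) s * y s| <= M * K / (s * (1 - s)) / n.+1%:R.
    rewrite normrM; apply: le_trans (ler_pM _ _ h2 y0) _ => //.
    by rewrite le_eqVlt; apply/orP; left; apply/eqP; field; rewrite !gt_eqF.
  have a3 : `|derive1 (chi n) s * derive1 y s| <= M * K / (s * (1 - s)) / n.+1%:R.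
    rewrite normrM; apply: le_trans (ler_pM _ _ h1 y1) _ => //.
    by rewrite le_eqVlt; apply/orP; left; apply/eqP; field; rewrite !gt_eqF.
  apply: le_trans (ler_normD _ _) _; rewrite [X in _ + X <= _]normrM (gtr0_norm s0).
  have a4 : `|derive1 (derive1 (chi n)) s * y s + 2 * (derive1 (chi n) s * derive1 y s)| <=
      3 * (M * K / (s * (1 - s)) / n.+1%:R).
    apply: le_trans (ler_normD _ _) _; rewrite [X in _ + X <= _]normrM (ger0_norm (ler0n _ 2)).
    by move: a2 a3; move: (_ / n.+1%:R) => t; lra.
  apply: le_trans (lerD a1 (ler_wpM2l (ltW s0) a4)) _.
  have -> : s * (3 * (M * K / (s * (1 - s)) / n.+1%:R)) = 3 * (M * K / (1 - s) / n.+1%:R).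
    by field; rewrite !gt_eqF.
  have le : M * K / n.+1%:R <= M * K / (1 - s) / n.+1%:R.
    rewrite ler_pM2r ?invr_gt0// ler_peMr//; first by rewrite mulr_ge0 ?ltW.
    by rewrite invf_ge1//; lra.
  have -> : 4 * M * K / (1 - s) / n.+1%:R = 4 * (M * K / (1 - s) / n.+1%:R) by ring.
  by move: le; move: (M * K / n.+1%:R) (M * K / (1 - s) / n.+1%:R) => p t; lra.
have hB : (w s)^-1 <= b 0%N * (1 - s).
  by rewrite /weight invrK; have /andP[] := Bgen_bounds sub (J_itvW Js).
rewrite cutoff_error// -/E.
have -> : (- (w s)^-1 * E) ^+ 2 * w s = (w s)^-1 * E ^+ 2 by field; rewrite gt_eqF.
apply: (@le_trans _ _ (b 0%N * (1 - s) * (4 * M * K / (1 - s) / n.+1%:R) ^+ 2)).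
  apply: ler_pM => //; [by rewrite invr_ge0 ltW|exact: sqr_ge0|].
  rewrite -(real_normK (num_real E)) ler_pXn2r ?nnegrE//.
  exact: le_trans hE.
by rewrite le_eqVlt; apply/orP; left; apply/eqP; rewrite /q; field; rewrite !gt_eqF.
Qed.

(** The cut-off remainders converge in the graph norm. *)
Lemma remainder_Dmin : Dmin b y.
Proof.
have sy := remainder_smooth; have Ly := remainder_L2; have LS := Sop_remainder_L2.
split; first by split => //; [exact: smooth_AC_loc|exact/smooth_AC_loc/smooth_qderiv].
exists (Sop b y); split => //; exists (fun n s => chi n s * y s).
have ty n := chi_test hc1 hc12 hc2 hv1 hv1_left hv1_right n sy.
have Dy n := test_function_Dmin' sub (ty n).
have LSn n : L2 b (Sop b (fun s => chi n s * y s)) by case: (Dy n) => -[].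
have Lc n : L2 b (fun s => chi n s * Sop b y s).
  exact: (chi_L2 sub hc1 hc12 hc2 hv1 hv1_left hv1_right n LS).
have Lr n : L2 b (r n) := L2B sub (LSn n) (Lc n).
have L0 : L2 b (fun=> 0 : R).
  have := L2Z sub 0 Ly; congr (L2 b _); apply/funext => s; exact: mul0r.
split => //; first exact: (chi_L2cvg sub hc1 hc12 hc2 hv1 hv1_left hv1_right Ly).
have cr : L2cvg b r (fun=> 0).
  have [Q Q0 HQ] := cutoff_error_bound.
  have cQ : (Q / n.+1%:R)%:E @[n --> \oo] --> 0%:E.
    apply: cvg_EFin; first exact: nearW.
    rewrite -[X in _ --> X](mulr0 Q); apply: cvgMl_tmp; exact: cvg_harmonic.
  apply: (squeeze_cvge _ (cvg_cst 0%E) cQ); apply: nearW => n.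
  apply/andP; split; first exact: (sqnorm_ge0 sub).
  apply: le_trans (HQ n); rewrite le_eqVlt; apply/orP; left; apply/eqP.
  by apply: eq_integral => s _; rewrite subr0.
have H := L2cvgDZ sub 1 Lc Lr LS L0
  (chi_L2cvg sub hc1 hc12 hc2 hv1 hv1_left hv1_right LS) cr.
have e1 : (fun n => Sop b (fun s => chi n s * y s)) =
    (fun n s => chi n s * Sop b y s + 1 * r n s).
  by apply/funext => n; apply/funext => s; rewrite /r mul1r addrC subrK.
have e2 : (fun s => Sop b y s + 1 * 0) = Sop b y.
  by apply/funext => s; rewrite mulr0 addr0.
by rewrite e1 -{2}e2.
Qed.

Lemma eigenvalue_principal : eigenvalue_S b v1 l.
Proof.
exists phi; split.
- exists y, 1; split; first exact: remainder_Dmin.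
  by move=> s _; rewrite /y mul1r subrK.
- exact: (phi_not_ae0 sub pl).
- apply: (@filterS _ _ (ae_filter_ringOfSetsType leb) setT); last exact: filterT.
  by move=> s _ Js; exact: (Sop_phi l sub).
Qed.

End principal_eigenvalue.

(** * First eigenvalue, decay parameter and Hardy constants *)

Theorem theorem2p2 (R : realType) (b : nat -> R) (c1 c2 : R) (v1 : R -> R)
  (hb : branching_rates b)
  (hc1 : 0 < c1) (hc12 : c1 < c2) (hc2 : c2 < 1)
  (hv1 : smooth v1)
  (hv1_left : forall s, 0 < s -> s < c1 -> v1 s = 1)
  (hv1_right : forall s, c2 < s -> s < 1 -> v1 s = 0)
  (hB : (dB1 b < 0)%E) :
  exists l0 : R,
    [/\ is_first_eigenvalue b v1 l0,
        is_decay_parameter b l0,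
        l0 = inf [set rayleigh b g | g in
                   [set g | test_function g /\ exists s, @J R s /\ g s != 0]],
        ((4%:R%:E * Dsq b)^-1 <= l0%:E)%E &
        (l0%:E <= (Dsq b)^-1)%E].
Proof.
have [m sub] := branching_subcritical hb hB.
have [l pl] := principal_ex sub; exists l.
have [lo up] := Dsq_bounds sub pl; split => //.
- split; first exact: (eigenvalue_principal sub pl hc1 hc12 hc2).
  exact: (eigenvalue_ge sub pl hc1 hc12 hc2).
- exact: decay_principal sub pl.
- exact: (rayleigh_inf sub pl hc1 hc12 hc2 hv1 hv1_left hv1_right).
Qed.
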